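(* Given $d\in\mathbb{N}$ and $\ell\in\mathbb{N}_0\cup\{\infty\}$, let $G$ be a Lie group modelled on a locally convex space $F$; let $\Omega$ be an open subset of $\mathbb{R}^d$ and $\mathcal{W}\subseteq C^\infty(\Omega,\mathbb{R})$ be a set of smooth functions containing the constant function $1$ and such that: (i) $f(x)\ge0$ for all $f\in\mathcal{W}$ and $x\in\Omega$; (ii) for each $x\in\Omega$ there exists $f\in\mathcal{W}$ with $f(x)>0$; (iii) for all $n\in\mathbb{N}$, $f_1,\ldots,f_n\in\mathcal{W}$ and $k_1,\ldots,k_n\in\mathbb{N}_0$ with $k_1,\ldots,k_n\le\ell$, there exist $C>0$ and $f\in\mathcal{W}$ such that $\|\delta^{k_1}_xf_1\|\cdots\|\delta^{k_n}_xf_n\|\le C\,f(x)$ for all $x\in\Omega$. Then $C^\infty_c(\Omega,G)$ is dense in the Lie group $C^\ell_{\mathcal{W}}(\Omega,G)^{\bullet}_{\mathrm{ex}}$. If $\Omega=\mathbb{R}^d$, $\ell=\infty$ and $\mathcal{W}$ is, moreover, a set of BCR-weights, then $C^\infty_c(\mathbb{R}^d,G)$ is dense in $\mathcal{S}(\mathbb{R}^d,G,\mathcal{W})$. Notably, $C^\infty_c(\mathbb{R}^d,G)$ is dense in $\mathcal{S}(\mathbb{R}^d,G)$.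
   Context: ''Locally convex space'' means a real, Hausdorff locally convex topological vector space. Lie groups modelled on such spaces are smooth in the sense of Bastiani calculus (continuous iterated directional derivatives of all orders); $e$ is the neutral element of $G$. $C^\infty_c(\Omega,G)$ is the group of smooth maps $\gamma\colon\Omega\to G$ for which the closure of $\{x:\gamma(x)\neq e\}$ in $\Omega$ is compact. Fix a norm $\|\cdot\|$ on $\mathbb{R}^d$. For a $C^\ell$-map $\gamma$ on an open subset of $\mathbb{R}^d$ and $j\le\ell$, $\delta^j_x\gamma(y):=\frac{d^j}{dt^j}\big|_{t=0}\gamma(x+ty)$; for a continuous seminorm $q$ on the range, $\|\delta^j_x\gamma\|_q:=\sup\{q(\delta^j_x\gamma(y)):\|y\|\le1\}$, and for real-valued functions $\|\delta^j_xf\|:=\|\delta^j_xf\|_{|\cdot|}$. Weighted function spaces. For open $Q\subseteq\Omega$, $C^\ell_{\mathcal{W}}(Q,F)$ is the space of $C^\ell$-maps $\gamma\colon Q\to F$ with $\|\gamma\|_{q,f,k}:=\max_{0\le j\le k}\sup_{x\in Q}|f(x)|\,\|\delta^j_x\gamma\|_q<\infty$ for all $f\in\mathcal{W}$, all $k\in\mathbb{N}_0$ with $k\le\ell$ and all continuous seminorms $q$ on $F$, with the locally convex topology defined by these seminorms. $C^\ell_{\mathcal{W}}(Q,F)^\bullet$ is the subspace of those $\gamma$ such that for all $f,k,q$ as before and $\varepsilon>0$ there is a compact $K\subseteq Q$ with $\|\gamma|_{Q\setminus K}\|_{q,f,k}<\varepsilon$. For an open $0$-neighbourhood $V\subseteq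 F$, $C^\ell_{\mathcal{W}}(\Omega,V)^\bullet$ denotes the set of $V$-valued elements of $C^\ell_{\mathcal{W}}(\Omega,F)^\bullet$. Weighted mapping groups. $C^\ell_{\mathcal{W}}(\Omega,G)^\bullet_{\mathrm{ex}}$ is the group of all $C^\ell$-maps $\gamma\colon\Omega\to G$ for which there exist a chart $\phi\colon U\to V\subseteq F$ of $G$ with $e\in U$, $\phi(e)=0$, a compact set $K\subseteq\Omega$ with $\gamma(\Omega\setminus K)\subseteq U$, and $h\in C^\infty_c(\Omega,\mathbb{R})$ which is constantly $1$ on a neighbourhood of $K$ in $\Omega$, such that $(1-h)\cdot(\phi\circ\gamma)|_{\Omega\setminus K}\in C^\ell_{\mathcal{W}}(\Omega\setminus K,F)^\bullet$. It has a unique Lie group structure modelled on $C^\ell_{\mathcal{W}}(\Omega,F)^\bullet$ such that for each chart $\phi\colon U\to V\subseteq F$ of $G$ with $e\in U$, $\phi(e)=0$, there is an open $0$-neighbourhood $V_0\subseteq V$ for which $\{\phi^{-1}\circ\eta:\eta\in C^\ell_{\mathcal{W}}(\Omega,V_0)^\bullet\}$ is open and $\gamma\mapsto\phi\circ\gamma$ is a chart from this set onto $C^\ell_{\mathcal{W}}(\Omega,V_0)^\bullet$. BCR-weights. For $\Omega=\mathbb{R}^d$, $\mathcal{W}$ is a set of BCR-weights if: $f\ge1$ for all $f\in\mathcal{W}$; for all $f_1,f_2\in\mathcal{W}$ there is $f\in\mathcal{W}$ with $f_1\le f$ and $f_2\le f$ pointwise; and for each $f_1\in\mathcal{W}$ there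 is $f_2\in\mathcal{W}$ such that for every $\varepsilon>0$ there is $n\in\mathbb{N}$ such that $\|x\|\ge n$ or $f_1(x)\ge n$ implies $f_1(x)\le\varepsilon f_2(x)$. For such $\mathcal{W}$, $\mathcal{S}(\mathbb{R}^d,G,\mathcal{W})=C^\infty_{\mathcal{W}}(\mathbb{R}^d,G)^\bullet_{\mathrm{ex}}$ as a Lie group. $\mathcal{S}(\mathbb{R}^d,G):=\mathcal{S}(\mathbb{R}^d,G,\mathcal{W})$ for $\mathcal{W}=\{x\mapsto(1+\|x\|_2^2)^n:n\in\mathbb{N}_0\}$, with $\|\cdot\|_2$ the euclidean norm. *)

(* Defs.v *)
From HB Require Import structures.
From mathcomp Require Import all_boot all_order all_algebra.
From mathcomp Require Import all_classical all_reals all_analysis.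
From mathcomp Require Import lra.

Set Implicit Arguments.
Unset Strict Implicit.
Unset Printing Implicit Defensive.

Import Order.TTheory GRing.Theory Num.Theory.
Import numFieldNormedType.Exports.

Local Open Scope classical_set_scope.
Local Open Scope ring_scope.
Local Open Scope convex_scope.

(** An order of differentiability in N_0 \cup {oo}; [None] stands for oo. *)
Definition diff_order := option nat.

Definition le_order (k : nat) (l : diff_order) : bool :=
  if l is Some n then (k <= n)%N else true.

Section calculus.
Context {R : realType}.

(** [derive] and [derivable] of MathComp-Analysis require normed modules; these
    are the same notions for functions between topological vector spaces. *)
Section directional_derivative.
Context {V F : tvsType R}.

Definition dquotient (f : V -> F) (x v : V) : R -> F :=
  fun h => h^-1 *: (f (x + h *: v) - f x).

Definition dderivable (f : V -> F) (x v : V) : Prop :=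
  exists df : F, dquotient f x v h @[h --> (0 : R)^'] --> df.

Definition dderive (v : V) (f : V -> F) : V -> F :=
  fun x => xget 0 [set df : F | dquotient f x v h @[h --> (0 : R)^'] --> df].

(** [iter_dderive f [:: y1; ...; yj] x = (D_yj ... D_y1 f) x] *)
Definition iter_dderive (f : V -> F) (ys : seq V) : V -> F :=
  foldl (fun g y => dderive y g) f ys.

(** [f] is C^l on the open set [U]. Only the germs of [f] at the points of [U]
    matter, hence a map defined on [U] is represented by any extension to [V];
    [V^j] is ['I_j -> V] with the product topology. *)
Definition Ck (l : diff_order) (U : set V) (f : V -> F) : Prop :=
  (forall (ys : seq V) (y x : V), le_order (size ys).+1 l -> U x ->
     dderivable (iter_dderive f ys) x y) /\
  (forall j : nat, le_order j l ->
     {in U `*` setT, continuous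
       (fun p : V * prod_topology (fun _ : 'I_j => V) =>
          iter_dderive f (codom p.2) p.1)}).

End directional_derivative.

(** [tderive j c] is the [j]-th derivative of the curve [c]. *)
Definition tderive {F : tvsType R} (j : nat) (c : R -> F) : R -> F :=
  iter j (@dderive R^o F 1) c.

Definition delta {V F : tvsType R} (j : nat) (f : V -> F) (x y : V) : F :=
  tderive j (fun t => f (x + t *: y)) 0.

End calculus.

Section seminorms.
Context {R : realType}.

Record is_seminorm (V : lmodType R) (q : V -> R) : Prop := IsSeminorm {
  seminormD : forall x y, q (x + y) <= q x + q y;
  seminormZ : forall a x, q (a *: x) = `|a| * q x }.

Record vnorm (V : lmodType R) := VNorm {
  vnorm_fun :> V -> R;
  vnorm_seminorm : is_seminorm vnorm_fun;
  vnorm_eq0 : forall x, vnorm_fun x = 0 -> x = 0 }.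

Record cseminorm (F : tvsType R) := CSeminorm {
  cseminorm_fun :> F -> R;
  cseminorm_seminorm : is_seminorm cseminorm_fun;
  cseminorm_continuous : continuous cseminorm_fun }.

Lemma seminorm0 (V : lmodType R) (q : V -> R) : is_seminorm q -> q 0 = 0.
Proof. by move=> hq; rewrite -(scale0r 0) (seminormZ hq) normr0 mul0r. Qed.

Lemma seminorm_ge0 (V : lmodType R) (q : V -> R) x : is_seminorm q -> 0 <= q x.
Proof.
move=> hq; have := seminormD hq x (- x).
rewrite subrr (seminorm0 hq) -scaleN1r (seminormZ hq) normrN1 mul1r.
by rewrite -mulr2n pmulrn_lge0.
Qed.

Lemma sum_is_seminorm (V : lmodType R) (I : Type) (p : I -> V -> R)
    (s : seq I) : (forall i, is_seminorm (p i)) ->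
  is_seminorm (fun x => \sum_(i <- s) p i x).
Proof.
move=> hp; split=> [x y|a x].
  by rewrite -big_split /=; apply: ler_sum => i _; exact: (seminormD (hp i)).
by rewrite mulr_sumr; apply: eq_bigr => i _; exact: (seminormZ (hp i)).
Qed.

Fact abs_is_seminorm : is_seminorm (fun x : R^o => `|x|).
Proof. by split=> [x y|a x]; [exact: ler_normD | exact: normrM]. Qed.

Fact abs_continuous : continuous (fun x : R^o => `|x| : R).
Proof. by move=> x; exact: norm_continuous. Qed.

Definition abs_seminorm : cseminorm R^o :=
  CSeminorm abs_is_seminorm abs_continuous.

End seminorms.

Section seminormed.
Context {R : realType} {V : lmodType R} {I : Type} (p : I -> V -> R).

(** Finite sums give the same topology as finite maxima. *)
Definition seminorms_nbhs (x : V) : set_system V :=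
  [set A | exists (s : seq I) (e : R), 0 < e /\
    [set y | \sum_(i <- s) p i (y - x) < e] `<=` A].

Hypothesis hp : forall i, is_seminorm (p i).

Let psum (s : seq I) (x : V) := \sum_(i <- s) p i x.

Let psum_seminorm s : is_seminorm (psum s).
Proof. exact: sum_is_seminorm. Qed.

Let psum_catl s t x : psum s x <= psum (s ++ t) x.
Proof.
rewrite /psum big_cat /= lerDl.
exact: (@seminorm_ge0 _ _ (psum t) _ (psum_seminorm t)).
Qed.

Let psum_catr s t x : psum t x <= psum (s ++ t) x.
Proof.
rewrite /psum big_cat /= lerDr.
exact: (@seminorm_ge0 _ _ (psum s) _ (psum_seminorm s)).
Qed.

Lemma seminorms_nbhs_filter x : ProperFilter (seminorms_nbhs x).
Proof.
split.
  move=> [s [e [e0 /(_ x)]]]; apply => /=.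
  have := seminorm0 (psum_seminorm s).
  by rewrite /psum subrr => ->.
split.
- by exists [::], 1; split.
- move=> P Q [s [e [e0 sP]]] [t [f [f0 tQ]]].
  exists (s ++ t), (Num.min e f); split; first by rewrite lt_min e0.
  move=> y /=; rewrite lt_min => /andP[h1 h2]; split.
    by apply: sP; apply: le_lt_trans h1; exact: psum_catl.
  by apply: tQ; apply: le_lt_trans h2; exact: psum_catr.
- move=> P Q PQ [s [e [e0 sP]]]; exists s, e; split => //.
  exact: subset_trans PQ.
Qed.

Lemma seminorms_nbhs_singleton x A : seminorms_nbhs x A -> A x.
Proof.
move=> [s [e [e0]]]; apply => /=.
by have := seminorm0 (psum_seminorm s); rewrite /psum subrr => ->.
Qed.

Lemma seminorms_nbhs_nbhs x A :
  seminorms_nbhs x A -> seminorms_nbhs x (seminorms_nbhs^~ A).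
Proof.
move=> [s [e [e0 sA]]]; exists s, e; split => // y /= ye.
exists s, (e - psum s (y - x)); split; first by rewrite subr_gt0.
move=> z /= ze; apply: sA => /=.
have -> : z - x = (z - y) + (y - x) by rewrite addrA subrK.
apply: le_lt_trans (seminormD (psum_seminorm s) _ _) _.
by rewrite -ltrBrDr.
Qed.

End seminormed.

Section seminormed_tvs.
Context {R : realType} {V : preTopologicalLmodType R} {I : Type}.
Context (p : I -> V -> R).
Hypothesis hp : forall i, is_seminorm (p i).
Hypothesis nbhsV : forall x : V, nbhs x = seminorms_nbhs p x.

Let psum (s : seq I) (x : V) := \sum_(i <- s) p i x.

Let psum_seminorm s : is_seminorm (psum s).
Proof. exact: sum_is_seminorm. Qed.

Let ball_nbhs s e (x : V) : 0 < e -> nbhs x [set y | psum s (y - x) < e].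
Proof. by move=> e0; rewrite nbhsV; exists s, e; split. Qed.

Lemma seminorms_add_continuous : continuous (fun x : V * V => x.1 + x.2).
Proof.
move=> [x y] A /=; rewrite /nbhs/= -/(nbhs (x + y) A) nbhsV.
move=> [s [e [e0 sA]]].
have e2 : 0 < e / 2 by rewrite divr_gt0.
exists ([set z | psum s (z - x) < e / 2], [set z | psum s (z - y) < e / 2]).
  by split; exact: ball_nbhs.
move=> [a b] /= [ha hb]; apply: sA => /=.
have -> : a + b - (x + y) = (a - x) + (b - y) by rewrite opprD addrACA.
apply: le_lt_trans (seminormD (psum_seminorm s) _ _) _.
by rewrite [e]splitr; exact: ltrD.
Qed.

Lemma seminorms_scale_continuous :
  continuous (fun z : R^o * V => z.1 *: z.2).
Proof.
move=> [a x] A /=; rewrite /nbhs/= -/(nbhs (a *: x) A) nbhsV.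
move=> [s [e [e0 sA]]].
set M := `|a| + psum s x + 2.
have psx := seminorm_ge0 x (psum_seminorm s).
have M2 : 2 <= M by rewrite /M lerDr addr_ge0.
have M0 : 0 < M by apply: lt_le_trans M2.
set r := Num.min 1 (e / (2 * M)).
have r0 : 0 < r by rewrite lt_min ltr01 divr_gt0// mulr_gt0.
exists ([set b : R^o | `|b - a| < r], [set z | psum s (z - x) < r]).
  split; last exact: ball_nbhs.
  by apply/nbhs_ballP; exists r => // b /=; rewrite distrC.
move=> [b z] /= [hb hz]; apply: sA => /=.
have -> : b *: z - a *: x = b *: (z - x) + (b - a) *: x.
  by rewrite scalerBr scalerBl addrA subrK.
apply: le_lt_trans (seminormD (psum_seminorm s) _ _) _.
rewrite !(seminormZ (psum_seminorm s)).
have rM : r * M <= e / 2.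
  rewrite -ler_pdivlMr//; rewrite /r ge_min; apply/orP; right.
  by rewrite invfM mulrA.
have bM : `|b| <= `|a| + 1.
  rewrite -[b](subrK a) addrC; apply: le_trans (ler_normD _ _) _.
  rewrite lerD2l; apply: ltW; apply: lt_le_trans hb _.
  by rewrite ge_min lexx.
have h1 : `|b| * psum s (z - x) <= M * r.
  apply: ler_pM => //; [exact: seminorm_ge0|  | exact: ltW].
  by apply: le_trans bM _; rewrite /M; lra.
have h2 : `|b - a| * psum s x < r * M.
  apply: le_lt_trans (_ : r * psum s x < _).
    by rewrite ler_wpM2r // ltW.
  by rewrite ltr_pM2l // /M; have := normr_ge0 a; lra.
rewrite [e]splitr; apply: ler_ltD.
  by rewrite (le_trans h1) // mulrC.
exact: lt_le_trans h2 rM.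
Qed.

Lemma seminorms_locally_convex :
  exists2 B : set_system V, (forall b, b \in B -> convex_set b) & basis B.
Proof.
exists [set B | exists (s : seq I) (e : R) (x : V),
    B = [set y | psum s (y - x) < e]].
  move=> B /[!inE]/= -[s [e [x ->]]].
  apply/convex_setW => y z; rewrite !inE/= => yx zx l l0 l1.
  rewrite inE/=; pose k : R := l%:num.
  have k1 : 0 < 1 - k by rewrite subr_gt0.
  have -> : (y <| l |> z : V) - x = k *: (y - x) + (1 - k) *: (z - x) :> V.
    rewrite !scalerBr addrACA -opprD -scalerDl [k + _]addrC subrK scale1r.
    by [].
  apply: le_lt_trans (seminormD (psum_seminorm s) _ _) _.
  rewrite !(seminormZ (psum_seminorm s)) !gtr0_norm//.
  have -> : e = k * e + (1 - k) * e by rewrite -mulrDl [k + _]addrC subrK mul1r.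
  by apply: ltrD; rewrite ltr_pM2l.
split.
  move=> B [s [e [x ->]]]; rewrite openE => y /= yx; rewrite /interior nbhsV.
  exists s, (e - psum s (y - x)); split; first by rewrite subr_gt0.
  move=> z /= zy; have -> : z - x = (z - y) + (y - x) by rewrite addrA subrK.
  apply: le_lt_trans (seminormD (psum_seminorm s) _ _) _.
  by rewrite -ltrBrDr.
move=> x A; rewrite nbhsV => -[s [e [e0 sA]]].
exists [set y | psum s (y - x) < e] => //; split; first by exists s, e, x.
by rewrite /= subrr (seminorm0 (psum_seminorm s)).
Qed.

End seminormed_tvs.

Section weighted.
Context {R : realType} {d : nat} {F : tvsType R}.
Local Notation E := 'rV[R]_d.

(** [||delta^j_x gamma||_q], in [\bar R] *)
Definition delta_norm (N : vnorm E) (q : cseminorm F) (j : nat)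
    (gamma : E -> F) (x : E) : \bar R :=
  ereal_sup [set (q (delta j gamma x y))%:E | y in [set y | N y <= 1]].

(** [||gamma||_{q,f,k}] on [Q]; it is [0] if [Q] is empty. *)
Definition weighted_norm (N : vnorm E) (Q : set E) (q : cseminorm F)
    (f : E -> R^o) (k : nat) (gamma : E -> F) : \bar R :=
  \big[maxe/0%E]_(j < k.+1)
    ereal_sup [set (`|f x|%:E * delta_norm N q j gamma x)%E | x in Q].

(** The weights are total functions, of which only the restrictions to the open
    set under consideration matter. *)
Definition in_CW (N : vnorm E) (l : diff_order) (W : set (E -> R^o))
    (Q : set E) (gamma : E -> F) : Prop :=
  Ck l Q gamma /\
  forall f k (q : cseminorm F), W f -> le_order k l ->
    (weighted_norm N Q q f k gamma < +oo)%E.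

Definition in_CW_bullet (N : vnorm E) (l : diff_order) (W : set (E -> R^o))
    (Q : set E) (gamma : E -> F) : Prop :=
  in_CW N l W Q gamma /\
  forall f k (q : cseminorm F) (eps : R), W f -> le_order k l -> 0 < eps ->
    exists K : set E, [/\ compact K, K `<=` Q &
      (weighted_norm N (Q `\` K) q f k gamma < eps%:E)%E].

End weighted.

Section tvs_cvg.
Context {R : realType} {F : tvsType R} {T : Type} (G : set_system T).
Context {FG : Filter G}.

Lemma tvs_cvgD (f g : T -> F) (a b : F) :
  f t @[t --> G] --> a -> g t @[t --> G] --> b ->
  f t + g t @[t --> G] --> a + b.
Proof. apply: continuous2_cvg; exact: (add_continuous (a, b)). Qed.

Lemma tvs_cvgZ (k : T -> R) (f : T -> F) (c : R) (a : F) :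
  k t @[t --> G] --> c -> f t @[t --> G] --> a ->
  k t *: f t @[t --> G] --> c *: a.
Proof.
by apply: (@continuous2_cvg _ R^o F); exact: (scale_continuous (c, a)).
Qed.

End tvs_cvg.

Section calculus_linear.
Context {R : realType} {V F : tvsType R}.
Hypothesis hF : hausdorff_space F.
Implicit Types (f g : V -> F) (U : set V) (x v : V).

Lemma dderive_eq f x v (df : F) :
  dquotient f x v h @[h --> (0 : R)^'] --> df -> dderive v f x = df.
Proof.
move=> fdf; have : [set l : F | dquotient f x v h @[h --> (0 : R)^'] --> l]
    (dderive v f x) by apply: xgetPex; exists df.
by move=> /= h; apply: (@cvg_unique _ hF _ _ _ _ h fdf).
Qed.

Lemma dderivableP f x v : dderivable f x v ->
  dquotient f x v h @[h --> (0 : R)^'] --> dderive v f x.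
Proof. by move=> [df fdf]; rewrite (dderive_eq fdf). Qed.

Lemma dquotient_lin (a : R) f g x v (df dg : F) :
  dquotient f x v h @[h --> (0 : R)^'] --> df ->
  dquotient g x v h @[h --> (0 : R)^'] --> dg ->
  dquotient (a *: f + g) x v h @[h --> (0 : R)^'] --> a *: df + dg.
Proof.
move=> fdf gdg.
have -> : dquotient (a *: f + g) x v =
    fun h => a *: dquotient f x v h + dquotient g x v h.
  apply/funext => h /=; rewrite /dquotient !fctE.
  rewrite scalerA mulrC -scalerA -scalerDr; congr (_ *: _).
  by rewrite scalerBr opprD addrACA.
by apply: tvs_cvgD => //; apply: tvs_cvgZ => //; exact: cvg_cst.
Qed.

Lemma dquotient_near U f g x v : open U -> U x -> {in U, f =1 g} ->
  {near (0 : R)^', dquotient f x v =1 dquotient g x v}.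
Proof.
move=> oU Ux fg.
have cont : (fun h : R => x + h *: v) h @[h --> (0 : R)] --> x.
  rewrite -[X in _ --> X]addr0 -(scale0r v).
  apply: tvs_cvgD; first exact: cvg_cst.
  by apply: tvs_cvgZ; [exact: cvg_id|exact: cvg_cst].
have : \forall h \near (0 : R), U (x + h *: v).
  by apply: cont; exact: open_nbhs_nbhs.
move=> /(@nbhs_dnbhs _ _ _) nU.
near=> h; rewrite /dquotient !fg ?inE//; near: h; exact: nU.
Unshelve. all: by end_near. Qed.

Lemma dquotient_local U f g x v (df : F) : open U -> U x -> {in U, f =1 g} ->
  dquotient f x v h @[h --> (0 : R)^'] --> df ->
  dquotient g x v h @[h --> (0 : R)^'] --> df.
Proof.
move=> oU Ux fg; apply: cvg_trans; apply: near_eq_cvg.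
exact: (dquotient_near _ oU Ux fg).
Qed.

Lemma iter_dderive_rcons f ys y :
  iter_dderive f (rcons ys y) = dderive y (iter_dderive f ys).
Proof. by rewrite /iter_dderive -cats1 foldl_cat. Qed.

Definition dderivable_below f U n := forall (ys : seq V) (y x : V),
  (size ys < n)%N -> U x -> dderivable (iter_dderive f ys) x y.

Lemma iter_dderive_lin (a : R) f g U ys : open U ->
  dderivable_below f U (size ys) -> dderivable_below g U (size ys) ->
  {in U, iter_dderive (a *: f + g) ys =1
         a *: iter_dderive f ys + iter_dderive g ys}.
Proof.
move=> oU; elim/last_ind: ys => [//|ys y IH].
rewrite size_rcons !iter_dderive_rcons => df dg x /[!inE] Ux.
have {}IH : {in U, a *: iter_dderive f ys + iter_dderive g ys =1
    iter_dderive (a *: f + g) ys}.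
  move=> z zU; rewrite IH// => zs w t zsn.
    by apply: df; exact: leqW.
  by apply: dg; exact: leqW.
apply: dderive_eq; apply: (dquotient_local oU Ux IH); apply: dquotient_lin.
  by apply: dderivableP; exact: df.
by apply: dderivableP; exact: dg.
Qed.

Lemma Ck_below l f U j : Ck l U f -> le_order j l -> dderivable_below f U j.
Proof.
move=> [df _] jl ys y x ysj Ux; apply: df => //.
by case: l jl => //= n; exact: leq_trans.
Qed.

Lemma Ck_lin l (a : R) f g U : open U ->
  Ck l U f -> Ck l U g -> Ck l U (a *: f + g).
Proof.
move=> oU Cf Cg; split.
  move=> ys y x ysl Ux.
  have ysl' : le_order (size ys) l by case: l ysl {Cf Cg} => //= n /ltnW.
  have /(dquotient_local oU Ux) h : {in U,
      a *: iter_dderive f ys + iter_dderive g ys =1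
      iter_dderive (a *: f + g) ys}.
    move=> z zU; rewrite (@iter_dderive_lin _ _ _ U)//; exact: (@Ck_below l).
  eexists; apply: h; apply: dquotient_lin; apply: dderivableP.
    by case: Cf => + _; exact.
  by case: Cg => + _; exact.
move=> j jl p pU.
have [Up _] : (U `*` setT) p by rewrite inE in pU.
have /= near_eq : \forall r \near p, (fun r => a *: iter_dderive f (codom r.2) r.1 +
    iter_dderive g (codom r.2) r.1) r = iter_dderive (a *: f + g) (codom r.2) r.1.
  have : \forall r \near p, U r.1.
    by apply: cvg_fst; exact: open_nbhs_nbhs.
  apply: filterS => r Ur /=.
  by rewrite (@iter_dderive_lin _ _ _ U) ?inE//; rewrite size_codom card_ord;
    exact: (@Ck_below l).
rewrite /continuous_at -(nbhs_singleton near_eq).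
apply: cvg_trans (near_eq_cvg near_eq) _.
apply: tvs_cvgD; last by case: Cg => _ /(_ j jl p pU).
apply: tvs_cvgZ; first exact: cvg_cst.
by case: Cf => _ /(_ j jl p pU).
Qed.

Lemma dquotient0 x v : dquotient (0 : V -> F) x v h @[h --> (0 : R)^'] --> (0 : F).
Proof.
rewrite (_ : dquotient _ x v = cst 0); first exact: cvg_cst.
by apply/funext => h; rewrite /dquotient !fctE subrr scaler0.
Qed.

Lemma iter_dderive0 ys : iter_dderive (0 : V -> F) ys = 0.
Proof.
elim/last_ind: ys => // ys y IH; rewrite iter_dderive_rcons IH.
by apply/funext => x; apply: dderive_eq; exact: dquotient0.
Qed.

Lemma Ck0 l U : Ck l U (0 : V -> F).
Proof.
split=> [ys y x _ _|j _ p _].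
  by rewrite iter_dderive0; exists 0; exact: dquotient0.
rewrite (_ : (fun r => _) = cst 0); first exact: cst_continuous.
by apply/funext => r; rewrite iter_dderive0.
Qed.

Lemma deltaE j f x y : delta j f x y = iter_dderive f (nseq j y) x.
Proof.
suff H t : tderive j (fun t => f (x + t *: y)) t =
    iter_dderive f (nseq j y) (x + t *: y).
  by rewrite /delta H scale0r addr0.
elim: j t => [//|j IH] t.
have -> : nseq j.+1 y = rcons (nseq j y) y by rewrite -cats1 -[[:: y]]/(nseq 1 y) -nseqD addn1.
rewrite iter_dderive_rcons [LHS]/(@dderive _ R^o F 1 _ t) /dderive.
have -> : dquotient (tderive j (fun s => f (x + s *: y)) : R^o -> F) t 1 =
    dquotient (iter_dderive f (nseq j y)) (x + t *: y) y.
  apply/funext => h; rewrite /dquotient !IH.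
  congr (_ *: (iter_dderive f (nseq j y) _ - _)).
  by rewrite -addrA -scalerDl [h *: 1]mulr1.
by [].
Qed.

End calculus_linear.

Section weighted_linear.
Context {R : realType} {d : nat} {F : tvsType R}.
Local Notation E := 'rV[R]_d.
Hypothesis hF : hausdorff_space F.
Variables (N : vnorm E) (l : diff_order) (W : set (E -> R^o)).
Implicit Types (Q : set E) (u v : E -> F) (q : cseminorm F).

Lemma weighted_norm_ge0 Q q f k u : (0 <= weighted_norm N Q q f k u)%E.
Proof. by apply: bigmax_ge_id. Qed.

Lemma weighted_norm_le Q q f k u (c : \bar R) : (0 <= c)%E ->
  (forall j x y, (j <= k)%N -> Q x -> N y <= 1 ->
    (`|f x|%:E * (q (delta j u x y))%:E <= c)%E) ->
  (weighted_norm N Q q f k u <= c)%E.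
Proof.
move=> c0 H; apply/bigmax_leP; split=> // j _.
apply: ge_ereal_sup => _ [x Qx <-].
have [->|fx0] := eqVneq `|f x| 0; first by rewrite mul0e.
have fx : 0 < `|f x| by rewrite lt_neqAle eq_sym fx0 normr_ge0.
rewrite -lee_pdivlMl//.
apply: ge_ereal_sup => _ [y /= Ny <-].
by rewrite lee_pdivlMl//; apply: H => //; rewrite -ltnS.
Qed.

Lemma weighted_norm_ge Q q f k u j x y : (j <= k)%N -> Q x -> N y <= 1 ->
  (`|f x|%:E * (q (delta j u x y))%:E <= weighted_norm N Q q f k u)%E.
Proof.
move=> jk Qx Ny; rewrite -ltnS in jk.
apply: (bigmax_sup (Ordinal jk)) => //=.
apply: (@le_trans _ _ (`|f x|%:E * delta_norm N q j u x)%E).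
  by apply: lee_wpmul2l => //; apply: ereal_sup_ubound; exists y.
by apply: ereal_sup_ubound; exists x.
Qed.

Lemma weighted_norm_lin U Q q f k (a : R) u v : open U -> Q `<=` U ->
  le_order k l -> Ck l U u -> Ck l U v ->
  (weighted_norm N Q q f k (a *: u + v)%R <=
   `|a|%:E * weighted_norm N Q q f k u + weighted_norm N Q q f k v)%E.
Proof.
move=> oU QU kl Cu Cv; apply: weighted_norm_le.
  by rewrite adde_ge0 ?mule_ge0 ?weighted_norm_ge0.
move=> j x y jk Qx Ny.
have jl : le_order j l by case: l kl {Cu Cv} => //= n; exact: leq_trans.
rewrite [in leLHS]deltaE// (@iter_dderive_lin _ _ _ _ _ _ _ U)//; last 3 first.
- by rewrite size_nseq; exact: (@Ck_below _ _ _ l).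
- by rewrite size_nseq; exact: (@Ck_below _ _ _ l).
- by rewrite inE; exact: QU.
rewrite [X in q X](_ : _ = a *: delta j u x y + delta j v x y); last first.
  by rewrite !deltaE.
apply: (@le_trans _ _ (`|a|%:E * (`|f x|%:E * (q (delta j u x y))%:E) +
  `|f x|%:E * (q (delta j v x y))%:E)%E).
  rewrite -!EFinM -EFinD lee_fin mulrCA -mulrDr ler_wpM2l//.
  apply: le_trans (seminormD (cseminorm_seminorm q) _ _) _.
  by rewrite (seminormZ (cseminorm_seminorm q)).
apply: leeD; last exact: weighted_norm_ge.
by apply: lee_wpmul2l => //; exact: weighted_norm_ge.
Qed.

Lemma weighted_norm0 Q q f k : weighted_norm N Q q f k (0 : E -> F) = 0%E.
Proof.
apply/eqP; rewrite eq_le weighted_norm_ge0 andbT.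
apply: weighted_norm_le => // j x y _ _ _.
by rewrite deltaE// iter_dderive0// (seminorm0 (cseminorm_seminorm q)) mule0.
Qed.

Lemma weighted_norm_sub Q Q' q f k u : Q `<=` Q' ->
  (weighted_norm N Q q f k u <= weighted_norm N Q' q f k u)%E.
Proof.
move=> QQ'; apply: weighted_norm_le; first exact: weighted_norm_ge0.
by move=> j x y jk /QQ' Qx Ny; exact: weighted_norm_ge.
Qed.

Lemma in_CW_bullet0 Q : in_CW_bullet N l W Q (0 : E -> F).
Proof.
split=> [|f k q eps _ _ e0].
  by split=> [|f k q _ _]; [exact: Ck0 | rewrite weighted_norm0].
by exists set0; split=> //; [exact: compact0 | rewrite weighted_norm0 lte_fin].
Qed.

Lemma in_CW_bullet_lin Q (a : R) u v : open Q ->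
  in_CW_bullet N l W Q u -> in_CW_bullet N l W Q v ->
  in_CW_bullet N l W Q (a *: u + v).
Proof.
move=> oQ [[Cu Wu] Bu] [[Cv Wv] Bv]; split.
  split=> [|f k q fW kl]; first exact: Ck_lin.
  apply: le_lt_trans (weighted_norm_lin _ _ _ oQ _ kl Cu Cv) _ => //.
  apply: lte_add_pinfty; last exact: Wv.
  by apply: lte_mul_pinfty => //; exact: Wu.
move=> f k q eps fW kl e0.
have a1 : 0 < `|a| + 1 by rewrite ltr_wpDl.
have eu : 0 < eps / 2 / (`|a| + 1) by rewrite !divr_gt0.
have ev : 0 < eps / 2 by rewrite divr_gt0.
have [K [cK KQ Ku]] := Bu f k q _ fW kl eu.
have [L [cL LQ Lv]] := Bv f k q _ fW kl ev.
exists (K `|` L); split; [exact: compactU| by move=> x [/KQ|/LQ]|].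
apply: le_lt_trans (weighted_norm_lin _ _ _ oQ _ kl Cu Cv) _; first by move=> x [].
have hu : (weighted_norm N (Q `\` (K `|` L)) q f k u < (eps / 2 / (`|a| + 1))%:E)%E.
  apply: le_lt_trans Ku; apply: weighted_norm_sub.
  by move=> x [Qx KLx]; split=> // Kx; apply: KLx; left.
have hv : (weighted_norm N (Q `\` (K `|` L)) q f k v < (eps / 2)%:E)%E.
  apply: le_lt_trans Lv; apply: weighted_norm_sub.
  by move=> x [Qx KLx]; split=> // Kx; apply: KLx; right.
rewrite [eps]splitr EFinD; apply: lee_ltD => //.
  rewrite ge0_fin_numE ?mule_ge0 ?weighted_norm_ge0//.
  by apply: lte_mul_pinfty => //; apply: lt_trans hu _; exact: ltry.
apply: (@le_trans _ _ (`|a|%:E * (eps / 2 / (`|a| + 1))%:E)%E).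
  by apply: lee_wpmul2l => //; exact: ltW.
rewrite -EFinM lee_fin mulrCA ler_piMr ?ltW//.
by rewrite ltr_pdivrMr// mul1r ltrDl.
Qed.

End weighted_linear.

Section weighted_space.
Context {R : realType} {d : nat} {F : tvsType R}.
Local Notation E := 'rV[R]_d.
Context (hF : hausdorff_space F) (N : vnorm E) (l : diff_order).
Context (W : set (E -> R^o)) (Omega : set E) (oOmega : open Omega).

(** A function on [Omega] is represented by its extension by [0] to [R^d]. *)
Definition CW_bullet_pred (_ : hausdorff_space F) (_ : open Omega) :
    {pred E -> F} :=
  [pred u | `[< in_CW_bullet N l W Omega u /\
                forall x, ~ Omega x -> u x = 0 >]].

Fact CW_bullet_submod_closed : submod_closed (CW_bullet_pred hF oOmega).
Proof.
split=> [|a u v].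
  by apply/asboolP; split=> //; exact: in_CW_bullet0.
move=> /asboolP[Wu u0] /asboolP[Wv v0]; apply/asboolP; split.
  exact: in_CW_bullet_lin.
by move=> x Ox; rewrite !fctE u0// v0// scaler0 addr0.
Qed.

HB.instance Definition _ :=
  GRing.isSubmodClosed.Build R (E -> F) (CW_bullet_pred hF oOmega)
    CW_bullet_submod_closed.

Record CW_bullet := CWBullet {
  CW_bullet_fun :> E -> F;
  CW_bullet_funP : CW_bullet_fun \in CW_bullet_pred hF oOmega }.

HB.instance Definition _ := [isSub for CW_bullet_fun].
HB.instance Definition _ := [Choice of CW_bullet by <:].
HB.instance Definition _ := [SubChoice_isSubLmodule of CW_bullet by <:].

(** The defining seminorms are indexed by [q], [f \in W] and [k <= l]. *)
Record CW_index := CWIndex {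
  CW_index_q : cseminorm F;
  CW_index_f : E -> R^o;
  CW_index_k : nat;
  CW_index_W : W CW_index_f;
  CW_index_l : le_order CW_index_k l }.

Definition CW_seminorm (i : CW_index) (u : CW_bullet) : R :=
  fine (weighted_norm N Omega (CW_index_q i) (CW_index_f i) (CW_index_k i) u).

Lemma CW_bulletP (u : CW_bullet) : in_CW_bullet N l W Omega u.
Proof. by have /asboolP[] := CW_bullet_funP u. Qed.

Lemma CW_seminormE i (u : CW_bullet) : (CW_seminorm i u)%:E =
  weighted_norm N Omega (CW_index_q i) (CW_index_f i) (CW_index_k i) u.
Proof.
rewrite /CW_seminorm fineK// ge0_fin_numE ?weighted_norm_ge0//.
by have [[_ Wu] _] := CW_bulletP u; apply: Wu; case: i.
Qed.

Lemma CW_seminorm_lin i (a : R) (u v : CW_bullet) :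
  CW_seminorm i (a *: u + v) <= `|a| * CW_seminorm i u + CW_seminorm i v.
Proof.
rewrite -lee_fin EFinD EFinM !CW_seminormE.
have [[Cu _] _] := CW_bulletP u; have [[Cv _] _] := CW_bulletP v.
exact: (@weighted_norm_lin _ _ _ hF N l Omega Omega _ _ _ a u v oOmega _
  (CW_index_l i)).
Qed.

Lemma CW_seminorm_is_seminorm i : is_seminorm (CW_seminorm i).
Proof.
have CW0 : CW_seminorm i 0 = 0.
  by apply/EFin_inj; rewrite CW_seminormE; exact: weighted_norm0.
have CWZ a u : CW_seminorm i (a *: u) <= `|a| * CW_seminorm i u.
  by have := CW_seminorm_lin i a u 0; rewrite CW0 !addr0.
split=> [u v|a u].
  by have := CW_seminorm_lin i 1 u v; rewrite scale1r normr1 mul1r.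
apply/eqP; rewrite eq_le CWZ/=.
have [->|a0] := eqVneq a 0; first by rewrite scale0r CW0 normr0 mul0r.
have := CWZ a^-1 (a *: u); rewrite scalerA mulVf// scale1r normfV.
by rewrite ler_pdivlMl// normr_gt0.
Qed.

HB.instance Definition _ := hasNbhs.Build CW_bullet (seminorms_nbhs CW_seminorm).
HB.instance Definition _ := Nbhs_isNbhsTopological.Build CW_bullet
  (seminorms_nbhs_filter CW_seminorm_is_seminorm)
  (seminorms_nbhs_singleton CW_seminorm_is_seminorm)
  (seminorms_nbhs_nbhs CW_seminorm_is_seminorm).

Let CW_nbhsE (u : CW_bullet) : nbhs u = seminorms_nbhs CW_seminorm u.
Proof. by []. Qed.

(** This factory only installs the uniform structure (translates of the
    [0]-neighbourhoods); the mixins below complete the [tvsType]. *)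
HB.instance Definition _ := PreTopologicalLmod_isTvs.Build R CW_bullet
  (seminorms_add_continuous CW_seminorm_is_seminorm CW_nbhsE)
  (seminorms_scale_continuous CW_seminorm_is_seminorm CW_nbhsE)
  (seminorms_locally_convex CW_seminorm_is_seminorm CW_nbhsE).
HB.instance Definition _ :=
  PreTopologicalNmodule_isTopologicalNmodule.Build CW_bullet
    (seminorms_add_continuous CW_seminorm_is_seminorm CW_nbhsE).
HB.instance Definition _ :=
  TopologicalNmodule_isTopologicalLmodule.Build R CW_bullet
    (seminorms_scale_continuous CW_seminorm_is_seminorm CW_nbhsE).
HB.instance Definition _ := Uniform_isTvs.Build R CW_bullet
  (seminorms_locally_convex CW_seminorm_is_seminorm CW_nbhsE).

End weighted_space.

Record chart {R : realType} (F : tvsType R) (G : topologicalType) := Chart {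
  chart_dom : set G;
  chart_cod : set F;
  chart_map :> G -> F;
  chart_inv : F -> G;
  chart_dom_open : open chart_dom;
  chart_cod_open : open chart_cod;
  chart_map_cod : forall g, chart_dom g -> chart_cod (chart_map g);
  chart_inv_dom : forall y, chart_cod y -> chart_dom (chart_inv y);
  chart_mapK : {in chart_dom, cancel chart_map chart_inv};
  chart_invK : {in chart_cod, cancel chart_inv chart_map};
  chart_map_continuous : {in chart_dom, continuous chart_map};
  chart_inv_continuous : {in chart_cod, continuous chart_inv} }.

Definition smooth_transition {R : realType} (F : tvsType R)
    (G : topologicalType) (c c' : chart F G) : Prop :=
  Ck None [set y | chart_cod c y /\ chart_dom c' (chart_inv c y)]
    (c' \o chart_inv c).

(** The atlas is the maximal one, so that its elements are all the charts;
    [lie_model_hausdorff] is there because a [tvsType] is a locally convex space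
    that need not be Hausdorff. The sets on which the group operations are
    required to be smooth in charts are open by continuity. *)
HB.mixin Record isLieGroup (R : realType) (F : tvsType R) G
    of Topological G & Group G := {
  lie_atlas : set (chart F G);
  lie_model_hausdorff : hausdorff_space F;
  lie_hausdorff : hausdorff_space G;
  lie_atlas_cover : forall g : G, exists2 c, lie_atlas c & chart_dom c g;
  lie_atlas_compatible : forall c c', lie_atlas c -> lie_atlas c' ->
    smooth_transition c c';
  lie_atlas_maximal : forall c,
    (forall c', lie_atlas c' -> smooth_transition c c' /\ smooth_transition c' c) ->
    lie_atlas c;
  lie_mulg_continuous : continuous (fun p : G * G => (p.1 * p.2)%g);
  lie_mulg_smooth : forall c1 c2 c3,
    lie_atlas c1 -> lie_atlas c2 -> lie_atlas c3 ->
    Ck None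
      [set p : F * F | [/\ chart_cod c1 p.1, chart_cod c2 p.2 &
         chart_dom c3 (chart_inv c1 p.1 * chart_inv c2 p.2)%g]]
      (fun p : F * F => c3 (chart_inv c1 p.1 * chart_inv c2 p.2)%g);
  lie_invg_continuous : continuous (fun g : G => (g^-1)%g);
  lie_invg_smooth : forall c1 c2, lie_atlas c1 -> lie_atlas c2 ->
    Ck None
      [set y : F | chart_cod c1 y /\ chart_dom c2 ((chart_inv c1 y)^-1)%g]
      (fun y : F => c2 ((chart_inv c1 y)^-1)%g) }.

#[short(type="lieGroupType")]
HB.structure Definition LieGroup (R : realType) (F : tvsType R) :=
  {G of isLieGroup R F G & Topological G & Group G}.

Section mapping_groups.
Context {R : realType} {d : nat} {F : tvsType R} {G : lieGroupType F}.
Local Notation E := 'rV[R]_d.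

Definition Ck_map (l : diff_order) (Omega : set E) (gamma : E -> G) : Prop :=
  {in Omega, continuous gamma} /\
  forall c : chart F G, lie_atlas c ->
    Ck l (Omega `&` gamma @^-1` chart_dom c) (c \o gamma).

(** [C^oo_c(Omega,G)] *)
Definition Cc_map (Omega : set E) (gamma : E -> G) : Prop :=
  Ck_map None Omega gamma /\
  compact (closure [set x | Omega x /\ gamma x <> 1%g] `&` Omega).

(** [C^oo_c(Omega,R)] *)
Definition Cc_fun (Omega : set E) (h : E -> R^o) : Prop :=
  Ck None Omega h /\
  compact (closure [set x | Omega x /\ h x <> 0] `&` Omega).

(** [C^l_W(Omega,G)^\bullet_ex] *)
Definition in_CW_ex (N : vnorm E) (l : diff_order) (W : set (E -> R^o))
    (Omega : set E) (gamma : E -> G) : Prop :=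
  Ck_map l Omega gamma /\
  exists (c : chart F G) (K : set E) (h : E -> R^o),
    [/\ lie_atlas c, chart_dom c 1%g & c 1%g = 0] /\
    [/\ compact K, K `<=` Omega &
        forall x, (Omega `\` K) x -> chart_dom c (gamma x)] /\
    [/\ Cc_fun Omega h,
        exists O : set E,
          [/\ open O, K `<=` O & forall x, (O `&` Omega) x -> h x = 1] &
        in_CW_bullet N l W (Omega `\` K)
          (fun x => (1 - h x : R) *: c (gamma x))].

(** [H] is the Lie group [C^l_W(Omega,G)^\bullet_ex]: [iota] identifies the
    group [H] with that group of maps under pointwise multiplication, a map on
    [Omega] being represented by its extension by [1] to [R^d]. *)
Record is_CW_group (hF : hausdorff_space F) (N : vnorm E) (l : diff_order)
    (W : set (E -> R^o)) (Omega : set E) (oOmega : open Omega)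
    (H : lieGroupType (CW_bullet hF N l W oOmega)) (iota : H -> E -> G) :
    Prop := IsCWGroup {
  CW_group_inj : injective iota;
  CW_group_mul : forall a b x, iota (a * b)%g x = (iota a x * iota b x)%g;
  CW_group_range : range iota =
    [set gamma | in_CW_ex N l W Omega gamma /\
                 forall x, ~ Omega x -> gamma x = 1%g];
  CW_group_chart : forall c : chart F G,
    lie_atlas c -> chart_dom c 1%g -> c 1%g = 0 ->
    exists V0 : set F, [/\ open V0, V0 0, V0 `<=` chart_cod c &
      exists2 C : chart (CW_bullet hF N l W oOmega) H, lie_atlas C &
        [/\ chart_cod C = [set eta | forall x, Omega x -> V0 (eta x)],
            chart_dom C = [set a | exists2 eta, chart_cod C eta &
              forall x, Omega x -> iota a x = chart_inv c (eta x)] &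
            forall a x, chart_dom C a -> Omega x ->
              C a x = c (iota a x)]] }.

(** [C^oo_c(Omega,G)] is a dense subset of the group of maps represented by
    [H]. *)
Definition Cc_dense (Omega : set E) (H : topologicalType)
    (iota : H -> E -> G) : Prop :=
  [set gamma | Cc_map Omega gamma /\ forall x, ~ Omega x -> gamma x = 1%g]
    `<=` range iota /\
  dense [set a | Cc_map Omega (iota a)].

End mapping_groups.

Section weights.
Context {R : realType} {d : nat}.
Local Notation E := 'rV[R]_d.

Record weight_conditions (N : vnorm E) (l : diff_order) (Omega : set E)
    (W : set (E -> R^o)) : Prop := WeightConditions {
  weight_smooth : forall f, W f -> Ck None Omega f;
  weight_one : exists2 f, W f & forall x, Omega x -> f x = 1;
  weight_ge0 : forall f x, W f -> Omega x -> 0 <= f x;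
  weight_gt0 : forall x, Omega x -> exists2 f, W f & 0 < f x;
  weight_prod : forall (n : nat) (f : 'I_n -> E -> R^o) (k : 'I_n -> nat),
    (0 < n)%N -> (forall i, W (f i)) -> (forall i, le_order (k i) l) ->
    exists (C : R) (g : E -> R^o), [/\ 0 < C, W g &
      forall x, Omega x ->
        (\big[*%E/1%E]_(i < n) delta_norm N abs_seminorm (k i) (f i) x
           <= (C * g x)%:E)%E] }.

Record BCR_weights (N : vnorm E) (W : set (E -> R^o)) : Prop := BCRWeights {
  BCR_ge1 : forall f x, W f -> 1 <= f x;
  BCR_directed : forall f1 f2, W f1 -> W f2 ->
    exists2 f, W f & forall x, f1 x <= f x /\ f2 x <= f x;
  BCR_decay : forall f1, W f1 -> exists2 f2, W f2 &
    forall eps : R, 0 < eps -> exists n : nat, forall x,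
      n%:R <= N x \/ n%:R <= f1 x -> f1 x <= eps * f2 x }.

(** [x |-> (1 + ||x||_2^2)^n] *)
Definition schwartz_weights : set (E -> R^o) :=
  [set f | exists n : nat,
     f = fun x : E => (1 + \sum_(i < d) (x ord0 i) ^+ 2) ^+ n].

End weights.

(* Main.v *)
(** Let [a] be an element of the group and [C] the chart of it induced by a chart [c]
    of [G] at the neutral element. Near infinity and near the boundary of [Omega] the
    map [a] is small in [c]; cutting off there yields [a2] in the domain of [C] such
    that [a * a2^-1] has compact support. Smoothing [a * a2^-1] in finitely many charts,
    one compact set after the other, gives a smooth compactly supported [b] which is
    uniformly so close to [a * a2^-1] that [p = b^-1 * a * a2^-1] lies in the domain of
    [C]. As [a = b * p * a2] and multiplication is continuous, it suffices that the
    smooth compactly supported functions are dense in the modelling space, on which [C]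
    takes its values.

    In that space, [u] is first replaced by [chi * u] with a cutoff [chi] whose
    derivatives of order [j] are [O(delta^-j)]. At distance [s <= delta] from the
    boundary, [f * D^i u] is [O(eps * s^(k-i))] by a Taylor argument that uses the
    weight condition (iii), so the error is small once [delta] is small and then the
    radius of [chi] is large. The compactly supported [chi * u] is approximated by
    averages over a grid with tensor product B-splines made from smooth steps: the
    partial derivatives of such an average are averages of difference quotients, whence
    convergence in [C^k] without any completeness of [F]. *)

Require Import Defs.
From HB Require Import structures.
From mathcomp Require Import all_boot all_order all_algebra.
From mathcomp Require Import all_classical all_reals all_analysis.
From mathcomp Require Import zify lra ring.

Set Implicit Arguments.
Unset Strict Implicit.
Unset Printing Implicit Defensive.

Import Order.TTheory GRing.Theory Num.Theory.
Import numFieldNormedType.Exports.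

Local Open Scope classical_set_scope.
Local Open Scope ring_scope.

(** * Continuous seminorms *)

(** Every estimate in [F] goes through one continuous seminorm at a time, and the mean value
    inequality takes the place of integration. The weighted seminorms see derivatives along a single
    repeated direction, whereas averages converge in partial derivatives and the decay argument
    mixes two directions; polarization passes from equal to arbitrary directions at a constant cost.
    The order of choices for the cutoff is forced. Near the boundary the powers of the distance
    absorb the factors [delta^-j], so the tolerance there can be fixed before [delta]; at infinity
    nothing absorbs them, so the radius has to wait until [delta] is known. In the group, a
    compactly supported factor need only be approximated uniformly, without its derivatives: whether
    a compactly supported element lies in the domain of [C] is a question about its values alone.
    This is what allows it to be smoothed chart by chart, each correction acting on a map that is
    known only to be continuous. *)

Section seminorm_topology.
Context {R : realType} {F : tvsType R}.
Implicit Types (q : cseminorm F) (x y : F).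

Lemma cseminormD q x y : q (x + y) <= q x + q y.
Proof. exact: seminormD (cseminorm_seminorm q) _ _. Qed.

Lemma cseminormZ q (a : R) x : q (a *: x) = `|a| * q x.
Proof. exact: seminormZ (cseminorm_seminorm q) _ _. Qed.

Lemma cseminorm_ge0 q x : 0 <= q x.
Proof. exact: seminorm_ge0 (cseminorm_seminorm q). Qed.

Lemma cseminorm0 q : q 0 = 0.
Proof. exact: seminorm0 (cseminorm_seminorm q). Qed.

Lemma cseminormN q x : q (- x) = q x.
Proof. by rewrite -scaleN1r cseminormZ normrN1 mul1r. Qed.

Lemma cseminormB q x y : q (x - y) <= q x + q y.
Proof. by rewrite -(cseminormN q y) cseminormD. Qed.

Lemma cseminorm_distC q x y : q (x - y) = q (y - x).
Proof. by rewrite -cseminormN opprB. Qed.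

Lemma cseminorm_trans q y x z : q (x - z) <= q (x - y) + q (y - z).
Proof. by rewrite -{1}(subrK y x) -addrA cseminormD. Qed.

Lemma cseminorm_sum q (I : Type) (r : seq I) (P : pred I) (G : I -> F) :
  q (\sum_(i <- r | P i) G i) <= \sum_(i <- r | P i) q (G i).
Proof.
elim/big_rec2: _ => [|i a b _ h]; first by rewrite cseminorm0.
by apply: le_trans (cseminormD _ _ _) _; rewrite lerD2l.
Qed.

Lemma nbhs_cseminorm q x (e : R) : 0 < e -> nbhs x [set y | q (y - x) < e].
Proof.
move=> e0.
have h : (fun y => q (y - x)) @ x --> (q (x - x) : R).
  apply: (@continuous_comp _ _ _ (fun y => y - x) q).
    by apply: tvs_cvgD; [exact: cvg_id|exact: cvg_cst].
  exact: cseminorm_continuous.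
move: h => /cvgrPdist_lt /(_ e e0); rewrite subrr cseminorm0.
by apply: filterS => y /=; rewrite sub0r normrN ger0_norm// cseminorm_ge0.
Qed.

(** The infimum of this set is the Minkowski functional of [b] at [x]. *)
Definition gauge_set (b : set F) x : set R := [set t | 0 < t /\ b (t^-1 *: x)].

Section gauge.
Variable b : set F.
Hypothesis b_convex : forall x y (t : R), 0 <= t <= 1 -> b x -> b y ->
  b (t *: x + (1 - t) *: y).
Hypothesis b_sym : forall x, b x -> b (- x).
Hypothesis b_nbhs : nbhs (0 : F) b.

Let b0 : b 0. Proof. exact: nbhs_singleton. Qed.

Let gauge x : R := inf (gauge_set b x).

Let gauge_set_has_inf x : has_inf (gauge_set b x).
Proof.
split; last by exists 0 => t [/ltW].
have : (fun t : R => t *: x) @ (0 : R) --> (0 : F).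
  by rewrite -(scale0r x); apply: tvs_cvgZ; [exact: cvg_id|exact: cvg_cst].
move=> /(_ b b_nbhs) /nbhs_ballP[e /= e0 he].
exists (2 / e); split; first by rewrite divr_gt0.
apply: he => /=; rewrite /ball/= sub0r normrN invf_div gtr0_norm ?divr_gt0//.
by rewrite ltr_pdivrMr// mulr_natr mulr2n ltrDl.
Qed.

Let gauge_set_up x s t : gauge_set b x s -> s <= t -> gauge_set b x t.
Proof.
move=> [s0 bs] st; have t0 := lt_le_trans s0 st; split=> //.
have := @b_convex (s^-1 *: x) 0 (s / t) _ bs b0.
rewrite scaler0 addr0 scalerA mulrAC mulfV ?gt_eqF// mul1r; apply.
by rewrite divr_ge0 ?(ltW s0) ?(ltW t0)//= ler_pdivrMr// mul1r.
Qed.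

Let gauge_lt x t : gauge x < t -> gauge_set b x t.
Proof.
by move=> /(inf_lt (gauge_set_has_inf x).1)[s xs /ltW]; exact: gauge_set_up.
Qed.

Let gauge_le x t : gauge_set b x t -> gauge x <= t.
Proof. by move=> h; apply: ge_inf => //; exact: (gauge_set_has_inf x).2. Qed.

Let gauge_ge0 x : 0 <= gauge x.
Proof.
apply: lb_le_inf; first exact: (gauge_set_has_inf x).1.
by move=> t [/ltW].
Qed.

Let gaugeD x y : gauge (x + y) <= gauge x + gauge y.
Proof.
apply/ler_addgt0Pr => e e0.
have e2 : 0 < e / 2 by rewrite divr_gt0.
have [s0 bs] : gauge_set b x (gauge x + e / 2) by apply: gauge_lt; rewrite ltrDl.
have [t0 bt] : gauge_set b y (gauge y + e / 2) by apply: gauge_lt; rewrite ltrDl.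
set s := gauge x + e / 2 in s0 bs *; set t := gauge y + e / 2 in t0 bt *.
have -> : gauge x + gauge y + e = s + t by rewrite /s /t; lra.
have st0 : 0 < s + t by exact: addr_gt0.
apply: gauge_le; split=> //.
(* [(x + y) / (s + t)] is the convex combination of [x / s] and [y / t] with weights [s / (s + t)]
   and [t / (s + t)]. *)
have := @b_convex _ _ (s / (s + t)) _ bs bt.
have -> : 1 - s / (s + t) = t / (s + t).
  by rewrite -{1}(mulfV (lt0r_neq0 st0)) -mulrBl addrAC subrr add0r.
rewrite !scalerA [s / _ * _]mulrAC [t / _ * _]mulrAC !mulfV ?gt_eqF// !mul1r.
rewrite -scalerDr; apply.
by rewrite divr_ge0 ?(ltW s0) ?(ltW st0)//= ler_pdivrMr// mul1r lerDl ltW.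
Qed.

Let gaugeZ_le (a : R) x : gauge (a *: x) <= `|a| * gauge x.
Proof.
have [->|a0] := eqVneq a 0.
  rewrite scale0r normr0 mul0r; apply/ler_addgt0Pr => e e0; rewrite add0r.
  by apply: gauge_le; split=> //; rewrite scaler0.
have na0 : 0 < `|a| by rewrite normr_gt0.
apply/ler_addgt0Pr => e e0.
have [s0 bs] : gauge_set b x (gauge x + e / `|a|).
  by apply: gauge_lt; rewrite ltrDl divr_gt0.
have -> : `|a| * gauge x + e = `|a| * (gauge x + e / `|a|).
  by rewrite mulrDr mulrCA mulfV ?gt_eqF// mulr1.
apply: gauge_le; split; first exact: mulr_gt0.
have [ap|an] := ltP 0 a.
  rewrite gtr0_norm// in bs *.
  by rewrite scalerA invfM mulrAC mulVf ?gt_eqF// mul1r.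
have {}an : a < 0 by rewrite lt_neqAle a0.
set t := gauge x + _ in s0 bs *.
rewrite ltr0_norm// scalerA invfM mulrAC invrN mulNr mulVf// mulN1r scaleNr.
exact: b_sym.
Qed.

Let gauge_seminorm : is_seminorm gauge.
Proof.
split=> // a x; apply/eqP; rewrite eq_le gaugeZ_le/=.
have [->|a0] := eqVneq a 0; first by rewrite normr0 mul0r gauge_ge0.
have := gaugeZ_le a^-1 (a *: x); rewrite scalerA mulVf// scale1r normfV.
by rewrite ler_pdivlMl// normr_gt0.
Qed.

Let gauge_continuous : continuous gauge.
Proof.
move=> x; apply/cvgrPdist_le => e e0.
(* Points of the neighbourhood [x + e b] differ from [x] by a vector of gauge at most [e]. *)
have /nbhsT -/(_ x) : nbhs 0 ( *:%R e @` b) by apply: nbhs0Z => //; rewrite gt_eqF.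
apply: filterS => y [z [w bw <-] <-].
have h : gauge (e *: w) <= e.
  by apply: gauge_le; split=> //; rewrite scalerA mulVf ?gt_eqF// scale1r.
have hN : gauge (- (e *: w)) = gauge (e *: w).
  by rewrite -scaleN1r (seminormZ gauge_seminorm) normrN1 mul1r.
apply: le_trans h; rewrite ler_norml; apply/andP; split.
  by rewrite lerNl opprB lerBlDr addrC gaugeD.
rewrite lerBlDr -{1}(addrK (e *: w) x) -hN addrC.
exact: gaugeD.
Qed.

Lemma gauge_cseminorm : exists q, [set y | q y < 1] `<=` b.
Proof.
exists (CSeminorm gauge_seminorm gauge_continuous) => y /= /gauge_lt[_].
by rewrite invr1 scale1r.
Qed.

End gauge.

(** A convex neighbourhood from the basis becomes symmetric when intersected with its opposite; the
    gauge of the intersection is the seminorm. This is the bridge from the locally convex topology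
    of [F] to estimates. *)
Lemma cseminorm_sub_nbhs (V : set F) : nbhs (0 : F) V ->
  exists q, [set y | q y < 1] `<=` V.
Proof.
move=> V0; have [B Bconv [Bopen Bb]] := @locally_convex R F.
have [b [Bb' b0] bV] := Bb 0 V V0.
have bc : forall x y (t : R), 0 <= t <= 1 -> b x -> b y -> b (t *: x + (1 - t) *: y).
  move=> x y t /andP[t0 t1] bx bY.
  have /= := Bconv b (mem_set Bb') x y (Itv01 t0 t1) (mem_set bx) (mem_set bY).
  by rewrite inE.
have [q qb] : exists q, [set y | q y < 1] `<=` b `&` (-%R @` b).
  apply: gauge_cseminorm.
  - move=> x y t t01 [bx [x' bx' xx']] [bY [y' by' yy']]; split; first exact: bc.
    exists (t *: x' + (1 - t) *: y'); first exact: bc.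
    by rewrite opprD -!scalerN xx' yy'.
  - move=> x [bx [y bY yx]]; split; first by rewrite -yx opprK.
    by exists x.
  - have nb : nbhs (0 : F) b by apply: open_nbhs_nbhs; split=> //; exact: Bopen.
    by apply: filterI => //; exact: nbhs0N.
by exists q => y /qb[/bV].
Qed.

Lemma cseminorm_nbhsP (x : F) (V : set F) : nbhs x V ->
  exists q, [set y | q (y - x) < 1] `<=` V.
Proof.
move=> xV; have : nbhs (0 : F) [set z | V (x + z)].
  suff : (fun z => x + z) @ (0 : F) --> x + 0 by rewrite addr0 => /(_ V); exact.
  apply: tvs_cvgD; [exact: cvg_cst|exact: cvg_id].
move=> /cseminorm_sub_nbhs[q qV]; exists q => y /qV /=.
by rewrite addrC subrK.
Qed.

Lemma cseminorm_cvgP (T : Type) (G : set_system T) {FG : Filter G} (f : T -> F) (l : F) :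
  (forall q (e : R), 0 < e -> \forall t \near G, q (f t - l) <= e) -> f @ G --> l.
Proof.
move=> h V /cseminorm_nbhsP[q qV].
have : \forall t \near G, q (f t - l) <= 1 / 2 by apply: h.
apply: filterS => t ht; apply: qV => /=.
by apply: le_lt_trans ht _; rewrite ltr_pdivrMr// mul1r ltr1n.
Qed.

Lemma cvg_cseminorm (T : Type) (G : set_system T) {FG : Filter G} (f : T -> F) (l : F) q
    (e : R) : f @ G --> l -> 0 < e -> \forall t \near G, q (f t - l) < e.
Proof. by move=> fl e0; exact: (fl _ (nbhs_cseminorm q l e0)). Qed.

Lemma cseminorm_cvg (T : Type) (G : set_system T) {FG : Filter G} (f : T -> F) (l : F) q :
  f @ G --> l -> q (f t) @[t --> G] --> (q l : R).
Proof.
by move=> fl; apply: (cvg_comp f q fl); exact: cseminorm_continuous.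
Qed.

Lemma tvs_cvgB (T : Type) (G : set_system T) {FG : Filter G} (f g : T -> F) (a b : F) :
  f t @[t --> G] --> a -> g t @[t --> G] --> b -> f t - g t @[t --> G] --> a - b.
Proof.
move=> fa gb; apply: tvs_cvgD => //.
by apply: (cvg_comp g _ gb); exact: opp_continuous.
Qed.

Lemma hausdorff_cseminorm_eq0 (hF : hausdorff_space F) x :
  (forall q, q x = 0) -> x = 0.
Proof.
move=> h; apply: hF => A B xA /cseminorm_nbhsP[q qB].
exists x; split; first exact: nbhs_singleton.
by apply: qB; rewrite /= subr0 h.
Qed.

End seminorm_topology.

Section cseminorm_constructions.
Context {R : realType} {F : tvsType R}.
Variables (p q : cseminorm F).

Let add_seminorm : is_seminorm (fun x => p x + q x).
Proof.
split=> [x y|a x]; first by rewrite addrACA lerD// cseminormD.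
by rewrite !cseminormZ mulrDr.
Qed.

Let add_continuous_seminorm : continuous (fun x => p x + q x : R).
Proof.
by move=> x; apply: (@cvgD _ R^o); exact: cseminorm_continuous.
Qed.

Definition cseminorm_add : cseminorm F :=
  CSeminorm add_seminorm add_continuous_seminorm.

End cseminorm_constructions.

(** * Mean value inequality for curves in a locally convex space *)

Section mean_value.
Context {R : realType} {F : tvsType R}.
Implicit Types (c : R -> F) (q : cseminorm F).

Definition is_curve_derivative c (t : R) (l : F) :=
  h^-1 *: (c (t + h) - c t) @[h --> (0 : R)^'] --> l.

Lemma curve_derivative_near c t l q (e : R) : is_curve_derivative c t l -> 0 < e ->
  \forall h \near (0 : R), q (c (t + h) - c t - h *: l) <= `|h| * e.
Proof.
move=> cl e0; have : \forall h \near (0 : R)^', q (h^-1 *: (c (t + h) - c t) - l) < e.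
  exact: cvg_cseminorm.
rewrite near_withinE => /nbhs_ballP[d /= d0 hd].
apply/nbhs_ballP; exists d => //= h hh.
have [->|h0] := eqVneq h 0.
  by rewrite addr0 subrr scale0r subr0 cseminorm0 normr0 mul0r.
have {hd} := hd h hh h0 => /ltW.
have -> : c (t + h) - c t - h *: l = h *: (h^-1 *: (c (t + h) - c t) - l).
  by rewrite scalerBr scalerA mulfV// scale1r.
by rewrite cseminormZ => hd; rewrite ler_pM2l// normr_gt0.
Qed.

Lemma curve_derivative_continuous c t l :
  is_curve_derivative c t l -> c @ t --> c t.
Proof.
move=> cl; apply: cseminorm_cvgP => q e e0.
have h1 := curve_derivative_near q cl ltr01.
have h2 : \forall h \near (0 : R), `|h| * (1 + q l) < e.
  have : (fun h : R => `|h| * (1 + q l)) @ (0 : R) --> `|(0:R)| * (1 + q l).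
    apply: cvgM; last exact: cvg_cst.
    by apply: cvg_norm; exact: cvg_id.
  by rewrite normr0 mul0r => /cvgr_lt; apply.
have /nbhs_ballP[d /= d0 hd] : \forall h \near (0 : R),
    q (c (t + h) - c t - h *: l) <= `|h| * 1 /\ `|h| * (1 + q l) < e.
  by apply: filterI; [exact: h1|exact: h2].
apply/nbhs_ballP; exists d => //= s ts.
have [] := hd (s - t); first by move: ts; rewrite /ball/= sub0r normrN distrC.
rewrite [t + _]addrC subrK => /= k1 k2; apply: ltW; apply: le_lt_trans k2.
rewrite mulrDr -cseminormZ -{1}(subrK ((s - t) *: l) (c s - c t)).
by apply: le_trans (cseminormD _ _ _) _; rewrite lerD2r.
Qed.

(** The points [t] satisfying the estimate with slope [M + e] have a supremum, which satisfies it
    too since [c] is continuous; if it were less than [b], the derivative there would carry the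
    estimate a little further. Neither an integral nor a linear functional enters. *)
Lemma cseminorm_mvt c (dc : R -> F) q (M a b : R) : a <= b ->
  (forall t, a <= t <= b -> is_curve_derivative c t (dc t)) ->
  (forall t, a <= t <= b -> q (dc t) <= M) ->
  q (c b - c a) <= M * (b - a).
Proof.
move=> ab dcP dcM; apply/ler_addgt0Pr => e0 e0_gt0.
pose e := e0 / (b - a + 1).
have e_gt0 : 0 < e by rewrite divr_gt0// ltr_wpDl ?subr_ge0.
suff : q (c b - c a) <= (M + e) * (b - a).
  move=> /le_trans; apply; rewrite mulrDl lerD2l /e mulrAC ler_pdivrMr.
    by rewrite ler_pM2l// lerDl.
  by rewrite ltr_wpDl ?subr_ge0.
have M0 : 0 <= M by apply: le_trans (cseminorm_ge0 q _) (dcM a _); rewrite lexx.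
pose S := [set t | a <= t <= b /\ q (c t - c a) <= (M + e) * (t - a)].
have Sa : S a by split; rewrite ?lexx// !subrr cseminorm0 mulr0.
have S_sup : has_sup S by split; [exists a|exists b => t [/andP[]]].
pose s := sup S.
have sab : a <= s <= b.
  apply/andP; split; first by apply: ub_le_sup => //; case: S_sup.
  by apply: ge_sup => [|t [/andP[]]//]; exists a.
have Ss : S s.
  split=> //; rewrite leNgt; apply/negP => hs.
  have cs := curve_derivative_continuous (dcP s sab).
  have : (fun t => q (c t - c a) - (M + e) * (t - a)) @ s -->
      q (c s - c a) - (M + e) * (s - a).
    apply: cvgB.
      by apply: cseminorm_cvg; apply: tvs_cvgD => //; exact: cvg_cst.
    apply: cvgM; first exact: cvg_cst.
    by apply: cvgB; [exact: cvg_id|exact: cvg_cst].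
  move=> /cvgr_gt /(_ 0); rewrite subr_gt0 => /(_ hs).
  move=> /nbhs_ballP[d /= d0 hd].
  have [t St ts] := sup_adherent d0 S_sup.
  have tles : t <= s by apply: ub_le_sup => //; case: S_sup.
  have /hd : ball s d t.
    by rewrite /ball/= ger0_norm ?subr_ge0// ltrBlDr addrC -ltrBlDr.
  by rewrite /= subr_gt0 ltNge; case: St => _ ->.
have [sb|] := ltP s b; last first.
  move=> bs; suff -> : b = s by case: Ss.
  by apply/eqP; rewrite eq_le bs/=; case/andP: sab.
have /nbhs_ballP[d /= d0 hd] := curve_derivative_near q (dcP s sab) e_gt0.
pose h := Num.min (d / 2) (b - s).
have h0 : 0 < h by rewrite lt_min divr_gt0//= subr_gt0.
have hd' : h < d by rewrite gt_min ltr_pdivrMr// ltr_pMr// ltr1n.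
have hb : s + h <= b by rewrite -lerBrDl ge_min lexx orbT.
have := hd h; rewrite /ball/= sub0r normrN gtr0_norm// => /(_ hd') hq.
have : S (s + h).
  split; first by rewrite hb andbT ler_wpDr//; [exact: ltW|case/andP: sab].
  rewrite -(subrK (c s) (c (s + h))) -addrA.
  apply: le_trans (cseminormD _ _ _) _.
  rewrite -[s + h - a]addrAC mulrDr [leRHS]addrC lerD//; last by case: Ss.
  rewrite -(subrK (h *: dc s) (_ - _)).
  apply: le_trans (cseminormD _ _ _) _.
  rewrite mulrDl addrC cseminormZ gtr0_norm// lerD//; last by rewrite mulrC.
  by rewrite mulrC ler_pM2r// dcM.
move=> /(ub_le_sup S_sup.2); rewrite -/s.
by rewrite leNgt ltrDl h0.
Qed.

End mean_value.

Section segment.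
Context {R : realType} {V F : tvsType R}.
Implicit Types (f : V -> F) (x v w : V) (q : cseminorm F).

Lemma line_curve_derivative f x w (t s : R) (l : F) :
  dquotient f (x + (s * t) *: w) w h @[h --> (0 : R)^'] --> l ->
  is_curve_derivative (fun s => f (x + (s * t) *: w)) s (t *: l).
Proof.
move=> fl; rewrite /is_curve_derivative.
have [->|t0] := eqVneq t 0.
  rewrite scale0r (_ : (fun h => _) = cst 0); first exact: cvg_cst.
  by apply/funext => h; rewrite !mulr0 subrr scaler0.
have tl : (fun h : R => h * t) @ (0 : R)^' --> (0 : R)^'.
  move=> A /= /nbhs_ballP[e /= e0 hA]; apply/nbhs_ballP.
  exists (e / `|t|); first by rewrite /= divr_gt0// normr_gt0.
  move=> h /= hh h0; apply: hA; last by rewrite mulf_neq0.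
  move: hh; rewrite /ball/= !sub0r !normrN normrM ltr_pdivlMr//.
  by rewrite normr_gt0.
have -> : (fun h => h^-1 *: (f (x + ((s + h) * t) *: w) - f (x + (s * t) *: w))) =
    (fun h => t *: dquotient f (x + (s * t) *: w) w (h * t)).
  apply/funext => h; rewrite /dquotient scalerA invfM mulrCA mulfV// mulr1.
  by rewrite mulrDl scalerDl addrA.
apply: tvs_cvgZ; first exact: cvg_cst.
exact: (cvg_comp _ _ tl fl).
Qed.

(** The mean value inequality on [0, 1] for the curve [f (x + (s * t) *: w) - (s * t) *: l] in the
    variable [s]; in this parametrization [t] may have either sign. *)
Lemma cseminorm_segment f x w (df : R -> F) (l : F) q (t M : R) :
  (forall s, 0 <= s <= 1 ->
    dquotient f (x + (s * t) *: w) w h @[h --> (0 : R)^'] --> df s) ->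
  (forall s, 0 <= s <= 1 -> q (df s - l) <= M) ->
  q (f (x + t *: w) - f x - t *: l) <= `|t| * M.
Proof.
move=> fdf dfM.
pose c s := f (x + (s * t) *: w) - (s * t) *: l.
have -> : f (x + t *: w) - f x - t *: l = c 1 - c 0.
  by rewrite /c mul1r mul0r !scale0r addr0 subr0 addrAC.
rewrite -[leRHS]mulr1 -{2}(subr0 1).
apply: (cseminorm_mvt (dc := fun s => t *: (df s - l))) => //= s s01.
  have -> : t *: (df s - l) = t *: df s - t *: l by rewrite scalerBr.
  rewrite /is_curve_derivative.
  have h1 := line_curve_derivative (fdf s s01).
  have h2 : (fun h : R => h^-1 *: ((h * t) *: l)) @ (0 : R)^' --> t *: l.
    have : (cst (t *: l) : R -> F) @ (0 : R)^' --> t *: l by exact: cvg_cst.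
    apply: cvg_trans; apply: near_eq_cvg.
    near=> h; rewrite /= scalerA mulrA mulVf ?mul1r//.
    by near: h; exact: nbhs_dnbhs_neq.
  apply: cvg_trans (tvs_cvgB h1 h2); apply: near_eq_cvg.
  apply: nearW => h; rewrite /c /= -scalerBr; congr (_ *: _).
  rewrite mulrDl !scalerDl [_ *: l + _ *: l]addrC opprD opprB !addrA subrK.
  by rewrite [RHS]addrAC.
by rewrite cseminormZ ler_wpM2l// dfM.
Unshelve. all: by end_near. Qed.

End segment.

(** * Bastiani calculus *)

Section continuity_of_derivatives.
Context {R : realType} {V F : tvsType R}.
Implicit Types (f g : V -> F) (U : set V) (x v w : V) (q : cseminorm F).

Lemma cvg_prod_topology (I : Type) (W : topologicalType) (T : Type) (G : set_system T)
    {FG : Filter G} (g : T -> I -> W) (l : I -> W) :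
  (forall i, g t i @[t --> G] --> l i) ->
  (g t : prod_topology (fun _ : I => W)) @[t --> G] --> (l : prod_topology (fun _ : I => W)).
Proof.
move=> gl; apply/cvg_sup => i A [B [[C oC <-] Cl] BA].
have GC : G [set t | C (g t i)] by apply: gl; exact: open_nbhs_nbhs.
change (G [set t | A (g t)]).
by apply: filterS GC => t Ct; exact: BA.
Qed.

(** [Ck] states continuity on a product space indexed by ['I_j]; this form, with point and
    directions depending on a parameter, is the one in which it gets applied. *)
Lemma iter_dderive_cvg (l : diff_order) f U (T : topologicalType) (t0 : T)
    (xs : T -> V) (ys : seq (T -> V)) : Ck l U f -> U (xs t0) ->
  le_order (size ys) l -> xs @ t0 --> xs t0 ->
  (forall i, (i < size ys)%N ->
     nth (fun _ => 0) ys i @ t0 --> nth (fun _ => 0) ys i t0) ->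
  iter_dderive f [seq y t | y <- ys] (xs t) @[t --> t0] -->
  iter_dderive f [seq y t0 | y <- ys] (xs t0).
Proof.
move=> [_ Cf] Ux sl cxs cys.
pose g t : V * prod_topology (fun _ : 'I_(size ys) => V) :=
  (xs t, fun i : 'I_(size ys) => nth (fun _ => 0) ys i t).
have gE t : [seq y t | y <- ys] = codom (g t).2.
  apply: (@eq_from_nth _ 0); first by rewrite size_map size_codom card_ord.
  move=> i; rewrite size_map => iy.
  rewrite (nth_map (fun _ => 0))// codomE (nth_map (Ordinal iy)) ?size_enum_ord//.
  by rewrite (nth_ord_enum _ (Ordinal iy)).
have cg : g @ t0 --> g t0.
  apply: (@cvg_pair _ _ _ _ (nbhs (xs t0)) (nbhs (g t0).2)); first exact: cxs.
  apply: cvg_prod_topology => i; exact: cys.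
have := Cf _ sl (g t0); rewrite inE => /(_ (conj Ux I)) cf.
rewrite gE; under eq_fun do rewrite gE.
exact: (cvg_comp g _ cg cf).
Qed.

Lemma iter_dderive_continuous (l : diff_order) f U x ys : Ck l U f -> U x ->
  le_order (size ys) l -> iter_dderive f ys @ x --> iter_dderive f ys x.
Proof.
move=> Cf Ux sl.
pose zs := [seq (fun _ : V => y) | y <- ys].
have e (t : V) : [seq y t | y <- zs] = ys by rewrite /zs -map_comp map_id_in.
have := @iter_dderive_cvg l f U V x (fun t => t) zs Cf Ux.
rewrite size_map => /(_ sl cvg_id).
have -> : (fun t : V => iter_dderive f [seq y t | y <- zs] t) = iter_dderive f ys.
  by apply/funext => t; rewrite e.
rewrite e; apply=> i iy.
by rewrite (nth_map 0)//; exact: cvg_cst.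
Qed.

Lemma Ck_continuous (l : diff_order) f U x : Ck l U f -> U x -> f @ x --> f x.
Proof. by move=> Cf Ux; apply: (iter_dderive_continuous (ys := [::]) Cf Ux); case: l {Cf}. Qed.

Lemma Ck_dderivable n f U x v : Ck (Some n.+1) U f -> U x -> dderivable f x v.
Proof. by move=> [h _] Ux; exact: (h [::] v x isT Ux). Qed.

Lemma Ck_dderive_continuous n f U (p : V * V) : Ck (Some n.+1) U f -> U p.1 ->
  dderive p'.2 f p'.1 @[p' --> p] --> dderive p.2 f p.1.
Proof.
move=> Cf Up.
have /= := @iter_dderive_cvg _ f U _ p fst [:: snd] Cf Up isT cvg_fst.
by apply=> -[|//] _ /=; exact: cvg_snd.
Qed.

Lemma Ck_leq (l l' : diff_order) f U : (forall k, le_order k l -> le_order k l') ->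
  Ck l' U f -> Ck l U f.
Proof. by move=> ll' [h1 h2]; split=> [ys y x /ll'|j /ll']; [exact: h1|exact: h2]. Qed.

Lemma Ck_NoneP f U : Ck None U f <-> forall n, Ck (Some n) U f.
Proof.
split=> [Cf n|Cf]; first exact: Ck_leq Cf.
split=> [ys y x _ Ux|j _]; first by have [h _] := Cf (size ys).+1; apply: h => //=.
by have [_ h] := Cf j; apply: h => /=.
Qed.

(** Reduces to finite orders, on which induction is possible. *)
Lemma CkP (l : diff_order) f U :
  Ck l U f <-> forall n, le_order n l -> Ck (Some n) U f.
Proof.
split=> [Cf n nl|Cf].
  by apply: Ck_leq Cf => k; case: l nl => //= m nm kn; exact: leq_trans kn nm.
by case: l Cf => [n|] Cf; [exact: (Cf n (leqnn n))|apply/Ck_NoneP => n; exact: Cf].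
Qed.

Lemma Ck_subset (l : diff_order) f U U' : U' `<=` U -> Ck l U f -> Ck l U' f.
Proof.
move=> U'U [h1 h2]; split=> [ys y x sl /U'U|j jl p].
  exact: h1.
by rewrite inE => -[/U'U Up _]; apply: h2 => //; rewrite inE.
Qed.

Lemma Ck_bigcup (l : diff_order) f U :
  (forall x, U x -> exists2 U', Ck l U' f & U' x) -> Ck l U f.
Proof.
move=> h; split=> [ys y x sl /h[U' [h1 _]]|j jl p]; first exact: h1.
rewrite inE => -[/h[U' [_ h2] U'p] _]; apply: h2 => //.
by rewrite inE.
Qed.

Lemma iter_dderive_eq f g U ys : open U -> {in U, f =1 g} ->
  {in U, iter_dderive f ys =1 iter_dderive g ys}.
Proof.
move=> oU; elim: ys f g => [|y ys IH] f g fg //=.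
apply: IH => x /[!inE] Ux; rewrite /dderive.
have fg' : {in U, g =1 f} by move=> z zU; rewrite fg.
congr (xget _ _); apply/seteqP; split=> l /=.
  exact: (dquotient_local oU Ux fg).
exact: (dquotient_local oU Ux fg').
Qed.

Lemma Ck_eq (l : diff_order) f g U : open U -> {in U, f =1 g} -> Ck l U f -> Ck l U g.
Proof.
move=> oU fg [h1 h2]; split=> [ys y x sl Ux|j jl p].
  have [df hdf] := h1 ys y x sl Ux; exists df.
  exact: (dquotient_local oU Ux (iter_dderive_eq ys oU fg) hdf).
rewrite inE => -[Up _].
have near_eq : \forall r \near p, iter_dderive f (codom r.2) r.1 = iter_dderive g (codom r.2) r.1.
  have : \forall r \near p, U r.1 by apply: cvg_fst; exact: open_nbhs_nbhs.
  by apply: filterS => r Ur; apply: (iter_dderive_eq _ oU fg); rewrite inE.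
rewrite /continuous_at -(nbhs_singleton near_eq).
apply: cvg_trans (h2 j jl p _); last by rewrite inE.
exact: near_eq_cvg.
Qed.

End continuity_of_derivatives.

Lemma line_cvg {R : realType} {V : tvsType R} (x v : V) :
  x + h *: v @[h --> (0 : R)^'] --> x.
Proof.
rewrite -[X in _ --> X]addr0 -(scale0r v).
apply: tvs_cvgD; first exact: cvg_cst.
by apply: tvs_cvgZ; [exact: nbhs_dnbhs|exact: cvg_cst].
Qed.

(** * Strict differentiability, and linearity in the direction *)

Section strict_differentiability.
Context {R : realType} {V F : tvsType R}.
Hypothesis hF : hausdorff_space F.
Implicit Types (f g : V -> F) (U : set V) (x v w : V) (q : cseminorm F).

(** Directional derivatives are continuous in point and direction jointly, so along every short
    segment they stay close to [dderive v f x]; the mean value inequality does the rest. The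
    estimate is uniform in base point and direction, which derivability at [x] alone would not
    give. *)
Lemma strict_derivative n f U x v q (e : R) : open U -> Ck (Some n.+1) U f -> U x ->
  0 < e -> \forall z \near ((x, v), (0 : R)),
    q (f (z.1.1 + z.2 *: z.1.2) - f z.1.1 - z.2 *: dderive v f x) <= `|z.2| * e.
Proof.
move=> oU Cf Ux e0.
pose W := [set p : V * V | U p.1 /\ q (dderive p.2 f p.1 - dderive v f x) < e].
have WN : nbhs (x, v) W.
  apply: filterI; first by apply: cvg_fst; exact: open_nbhs_nbhs.
  have := Ck_dderive_continuous (p := (x, v)) Cf Ux => /=.
  by move=> h; apply: cvg_cseminorm h e0.
pose m (z : (V * V) * R) : V * V := (z.1.1 + z.2 *: z.1.2, z.1.2).
have : m z @[z --> ((x, v), (0 : R))] --> ((x, v) : V * V).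
  suff : m z @[z --> ((x, v), (0 : R))] --> m ((x, v), 0).
    by rewrite [X in _ --> X]/m /= scale0r addr0.
  have c1 : (z.1 : V * V) @[z --> ((x, v), (0 : R))] --> (x, v) by exact: cvg_fst.
  have c11 : z.1.1 @[z --> ((x, v), (0 : R))] --> x by exact: (cvg_comp _ _ c1 cvg_fst).
  have c12 : z.1.2 @[z --> ((x, v), (0 : R))] --> v by exact: (cvg_comp _ _ c1 cvg_snd).
  apply: (@cvg_pair _ _ _ _ (nbhs (x + 0 *: v)) (nbhs v)); last exact: c12.
  by apply: tvs_cvgD; [exact: c11|apply: tvs_cvgZ; [exact: cvg_snd|exact: c12]].
move=> /(_ _ WN) [[A B] /= [nA /nbhs_ballP[d /= d0 dB]] AB].
exists (A, ball (0 : R) d); first by split=> //; exact: nbhsx_ballx.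
move=> [[y w] t] /= [Aw td].
have Wm s : 0 <= s <= 1 -> W (y + (s * t) *: w, w).
  move=> /andP[s0 s1]; apply: (AB ((y, w), s * t)); split=> //=; apply: dB.
  move: td; rewrite /ball/= !sub0r !normrN normrM; apply: le_lt_trans.
  by rewrite ler_piMl// ger0_norm.
apply: (cseminorm_segment (df := fun s => dderive w f (y + (s * t) *: w))).
  move=> s /Wm[/= Us _]; apply: dderivableP => //; exact: Ck_dderivable Cf Us.
by move=> s /Wm[_ /= /ltW].
Qed.

Lemma strict_derivative_cvg n f U x v (T : Type) (G : set_system T) {FG : Filter G}
    (xs ws : T -> V) (ts : T -> R) : open U -> Ck (Some n.+1) U f -> U x ->
  xs t @[t --> G] --> x -> ws t @[t --> G] --> v -> ts t @[t --> G] --> (0 : R)^' ->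
  (ts t)^-1 *: (f (xs t + ts t *: ws t) - f (xs t)) @[t --> G] --> dderive v f x.
Proof.
move=> oU Cf Ux cx cw ct; apply: cseminorm_cvgP => q e e0.
have h1 := strict_derivative v q oU Cf Ux e0.
have ct0 : ts t @[t --> G] --> (0 : R) by apply: cvg_trans ct _; exact: nbhs_dnbhs.
have ct1 : \forall t \near G, ts t != 0.
  have : \forall t \near (0 : R)^', t != 0 by exact: nbhs_dnbhs_neq.
  exact: (ct [set t : R | t != 0]).
have h2 : ((xs t, ws t), ts t) @[t --> G] --> ((x, v), (0 : R)).
  by apply: (@cvg_pair _ _ _ _ (nbhs (x, v)) (nbhs (0 : R))) => //;
    apply: (@cvg_pair _ _ _ _ (nbhs x) (nbhs v)).
have {}h1 : \forall t \near G, q (f (xs t + ts t *: ws t) - f (xs t) -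
    ts t *: dderive v f x) <= `|ts t| * e by exact: (h2 _ h1).
near=> t.
have t0 : ts t != 0 by near: t.
have : q (f (xs t + ts t *: ws t) - f (xs t) - ts t *: dderive v f x) <= `|ts t| * e.
  by near: t.
set D := f _ - f _.
have -> : D - ts t *: dderive v f x = ts t *: ((ts t)^-1 *: D - dderive v f x).
  by rewrite scalerBr scalerA mulfV// scale1r.
by rewrite cseminormZ ler_pM2l// normr_gt0.
Unshelve. all: by end_near. Qed.

Lemma dquotient_cvgZ f x (a : R) v (l : F) :
  dquotient f x v h @[h --> (0 : R)^'] --> l ->
  dquotient f x (a *: v) h @[h --> (0 : R)^'] --> a *: l.
Proof.
move=> fl; have [->|a0] := eqVneq a 0.
  rewrite !scale0r (_ : dquotient _ _ _ = cst 0); first exact: cvg_cst.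
  by apply/funext => t; rewrite /dquotient scaler0 addr0 subrr scaler0.
have tl : (fun t : R => t * a) @ (0 : R)^' --> (0 : R)^'.
  move=> A /= /nbhs_ballP[e /= e0 hA]; apply/nbhs_ballP.
  exists (e / `|a|); first by rewrite /= divr_gt0// normr_gt0.
  move=> t /= tt t0; apply: hA; last by rewrite mulf_neq0.
  by move: tt; rewrite /ball/= !sub0r !normrN normrM ltr_pdivlMr// normr_gt0.
have -> : dquotient f x (a *: v) = (fun t => a *: dquotient f x v (t * a)).
  by apply/funext => t; rewrite /dquotient !scalerA invfM mulrCA mulfV// mulr1.
apply: tvs_cvgZ; first exact: cvg_cst.
exact: (cvg_comp _ _ tl fl).
Qed.

Lemma dderiveZ f x (a : R) v : dderivable f x v -> dderive (a *: v) f x = a *: dderive v f x.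
Proof. by move=> /(dderivableP hF) h; apply: dderive_eq => //; exact: dquotient_cvgZ. Qed.

(** The increment along [v + w] is split at [x + t *: v]. The second difference quotient then has a
    moving base point, hence the appeal to strict differentiability. *)
Lemma dderiveD n f U x v w : open U -> Ck (Some n.+1) U f -> U x ->
  dderive (v + w) f x = dderive v f x + dderive w f x.
Proof.
move=> oU Cf Ux; apply: dderive_eq => //.
have h1 := dderivableP hF (Ck_dderivable v Cf Ux).
have xl : x + t *: v @[t --> (0 : R)^'] --> x by exact: line_cvg.
have h2 : t^-1 *: (f (x + t *: v + t *: w) - f (x + t *: v)) @[t --> (0 : R)^']
    --> dderive w f x.
  apply: (strict_derivative_cvg (xs := fun t => x + t *: v) oU Cf Ux xl).
    exact: cvg_cst.
  exact: cvg_id.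
apply: cvg_trans (tvs_cvgD h1 h2); apply: near_eq_cvg; apply: nearW => t.
rewrite /dquotient /= -scalerDr; congr (_ *: _).
rewrite [t *: (v + w)]scalerDr [x + (_ + _)]addrA.
by rewrite [LHS]addrC [LHS]addrA subrK.
Qed.

End strict_differentiability.

Definition differential {R : realType} {V F : tvsType R} (f : V -> F) : V * V -> F :=
  fun p => dderive p.2 f p.1.

Definition is_dderive {R : realType} {V F : tvsType R} (f : V -> F) (x v : V) (l : F) :=
  dquotient f x v h @[h --> (0 : R)^'] --> l.

Section is_dderive_theory.
Context {R : realType} {V F : tvsType R}.
Implicit Types (f g : V -> F) (U : set V) (x v w : V).

Lemma is_dderiveD f g x v a b : is_dderive f x v a -> is_dderive g x v b ->
  is_dderive (fun y => f y + g y) x v (a + b).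
Proof.
move=> fa gb; have := dquotient_lin (a := 1) fa gb; rewrite !scale1r.
by rewrite (_ : f + g = (fun y => f y + g y)).
Qed.

Lemma is_dderive_cst x v (c : F) : is_dderive (fun _ : V => c) x v 0.
Proof.
rewrite /is_dderive (_ : dquotient _ _ _ = cst 0); first exact: cvg_cst.
by apply/funext => t; rewrite /dquotient subrr scaler0.
Qed.

Lemma is_dderive_sum (I : Type) (r : seq I) (f : I -> V -> F) x v (l : I -> F) :
  (forall i, is_dderive (f i) x v (l i)) ->
  is_dderive (fun y => \sum_(i <- r) f i y) x v (\sum_(i <- r) l i).
Proof.
move=> h; elim: r => [|i r IH].
  rewrite big_nil; under eq_fun do rewrite big_nil; exact: is_dderive_cst.
by rewrite big_cons; under eq_fun do rewrite big_cons; exact: is_dderiveD.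
Qed.

Lemma tvs_cvg_sum (T : Type) (G : set_system T) {FG : Filter G} (a b : nat)
    (f : nat -> T -> F) (l : nat -> F) :
  (forall i, (a <= i < b)%N -> f i t @[t --> G] --> l i) ->
  \sum_(a <= i < b) f i t @[t --> G] --> \sum_(a <= i < b) l i.
Proof.
elim: b => [|b IH] h.
  by rewrite big_geq//; under eq_fun do rewrite big_geq//; exact: cvg_cst.
have [ab|ab] := leqP a b; last first.
  by rewrite big_geq//; under eq_fun do rewrite big_geq//; exact: cvg_cst.
rewrite big_nat_recr//=; under eq_fun do rewrite big_nat_recr//=.
apply: tvs_cvgD; last by apply: h; rewrite ab/=.
by apply: IH => i /andP[ai ib]; apply: h; rewrite ai ltnW.
Qed.

Lemma dderivable_eq U f g x v : open U -> U x -> {in U, f =1 g} ->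
  dderivable f x v -> dderivable g x v.
Proof. by move=> oU Ux fg [l fl]; exists l; exact: (dquotient_local oU Ux fg fl). Qed.

End is_dderive_theory.

(** * The differential as a map on the product space *)

Section differential.
Context {R : realType} {V F : tvsType R}.
Hypothesis hF : hausdorff_space F.
Implicit Types (f g : V -> F) (U : set V) (x v w : V).

Lemma is_dderiveP f x v : dderivable f x v -> is_dderive f x v (dderive v f x).
Proof. exact: dderivableP. Qed.

Lemma iter_dderive_head_lin k f U (a : R) x y w vs : open U -> Ck (Some k.+1) U f ->
  (size vs <= k)%N -> U x ->
  iter_dderive f ((a *: y + w) :: vs) x =
  a *: iter_dderive f (y :: vs) x + iter_dderive f (w :: vs) x.
Proof.
move=> oU Cf sk Ux.
have below z : dderivable_below (dderive z f) U (size vs).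
  move=> zs u t szs Ut; have [h _] := Cf.
  by apply: (h (z :: zs)) => //=; rewrite ltnS (leq_trans szs).
have e : {in U, dderive (a *: y + w) f =1 a *: dderive y f + dderive w f}.
  move=> z /[!inE] Uz; rewrite !fctE (dderiveD hF _ _ oU Cf Uz) dderiveZ//.
  exact: Ck_dderivable Cf Uz.
rewrite /= (iter_dderive_eq vs oU e) ?inE//.
by rewrite (iter_dderive_lin hF a oU) ?inE.
Qed.

(** Closed formula for the iterated derivative of [differential f] at [(x, y)] along pairs
    [(v_i, w_i)]. The differential is linear in [y], so at most one pair can act on [y]: in the
    [i]-th summand [w_i] takes the place of [y] and [v_i] is omitted. *)
Definition iter_differential f (vws : seq (V * V)) (p : V * V) : F :=
  iter_dderive f (p.2 :: unzip1 vws) p.1 +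
  \sum_(i < size vws) iter_dderive f (nth 0 (unzip2 vws) i ::
     take i (unzip1 vws) ++ drop i.+1 (unzip1 vws)) p.1.

(** By linearity in [y], the quotient of the first term splits into a quotient at fixed [y] and a
    derivative along [w] at a point moving to [x]; the latter tends to the new last summand. The old
    summands depend on [x] alone. *)
Lemma is_dderive_iter_differential k f U vws x y v w : open U ->
  Ck (Some k.+2) U f -> (size vws <= k)%N -> U x ->
  is_dderive (iter_differential f vws) (x, y) (v, w)
    (iter_differential f (rcons vws (v, w)) (x, y)).
Proof.
move=> oU Cf sk Ux; rewrite /iter_differential size_rcons big_ord_recr /=.
set vs := unzip1 vws; set ws := unzip2 vws.
have -> : unzip1 (rcons vws (v, w)) = rcons vs v by rewrite /unzip1 map_rcons.
have -> : unzip2 (rcons vws (v, w)) = rcons ws w by rewrite /unzip2 map_rcons.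
have svs : size vs = size vws by rewrite size_map.
have sws : size ws = size vws by rewrite size_map.
rewrite nth_rcons sws ltnn eqxx -cats1 take_size_cat// drop_oversize ?cats0; last first.
  by rewrite size_cat svs addn1.
rewrite [X in _ + X]addrC addrA; apply: is_dderiveD.
  have h1 : dquotient (iter_dderive f (y :: vs)) x v h @[h --> (0 : R)^'] -->
      iter_dderive f (y :: vs ++ [:: v]) x.
    rewrite cats1 -rcons_cons iter_dderive_rcons; apply: dderivableP => //.
    by have [h _] := Cf; apply: (h (y :: vs)) => //=; rewrite svs ltnS ltnS.
  have xl : x + h *: v @[h --> (0 : R)^'] --> x by exact: line_cvg.
  have h2 : iter_dderive f (w :: vs) (x + h *: v) @[h --> (0 : R)^'] -->
      iter_dderive f (w :: vs) x.
    apply: (cvg_comp _ _ xl); apply: iter_dderive_continuous Cf Ux _ => /=.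
    by rewrite svs ltnS (leq_trans sk).
  apply: cvg_trans (tvs_cvgD h1 h2); apply: near_eq_cvg.
  have : \forall h \near (0 : R)^', h != 0 by exact: nbhs_dnbhs_neq.
  have : \forall h \near (0 : R)^', U (x + h *: v).
    by apply: (xl U); exact: open_nbhs_nbhs.
  apply: filterS2 => h Uh h0; rewrite /dquotient /=.
  rewrite -[dderive (y + h *: w) f]/(iter_dderive f [:: y + h *: w]).
  have := @iter_dderive_head_lin k.+1 f U h (x + h *: v) w y vs oU Cf _ Uh.
  rewrite svs => /(_ (leqW sk)) /=; rewrite [h *: w + y]addrC => ->.
  rewrite -addrA [X in _ = X]scalerDr scalerA mulVf// scale1r; exact: addrC.
rewrite [X in is_dderive _ _ _ X](eq_bigr (fun i : 'I_(size vws) =>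
    iter_dderive f (rcons (nth 0 ws i :: take i vs ++ drop i.+1 vs) v) x)); last first.
  move=> i _; have ik := ltn_ord i.
  rewrite nth_rcons sws ik take_cat svs ik drop_cat svs.
  rewrite rcons_cons -cats1 -catA; congr (iter_dderive f (_ :: _ ++ _) x).
  case: ltnP => // ki.
  have -> : i.+1 = size vws by apply/eqP; rewrite eqn_leq ik.
  by rewrite subnn drop0 drop_oversize// svs.
apply: is_dderive_sum => i; set us := nth 0 ws i :: _.
have -> : iter_dderive f (rcons us v) x = dderive v (iter_dderive f us) x.
  by rewrite iter_dderive_rcons.
have : is_dderive (iter_dderive f us) x v (dderive v (iter_dderive f us) x).
  apply: dderivableP => //; have [h _] := Cf; apply: h => //=.
  rewrite size_cat size_take size_drop svs ltn_ord.
  by rewrite ltnS subnS -addnS; have := ltn_ord i; lia.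
by [].
Qed.

Lemma open_setXT U : open U -> open (U `*` [set: V]).
Proof.
move=> oU; rewrite (_ : _ `*` _ = fst @^-1` U).
  by apply: open_comp => // p _; exact: cvg_fst.
by apply/seteqP; split=> p //= [].
Qed.

Lemma iter_dderive_differential k f U vws : open U -> Ck (Some k.+1) U f ->
  (size vws <= k)%N ->
  {in U `*` setT, iter_dderive (differential f) vws =1 iter_differential f vws}.
Proof.
move=> oU; elim/last_ind: vws k => [|vws [v w] IH] k Cf.
  by move=> _ p _; rewrite /iter_differential /= big_ord0 addr0.
rewrite size_rcons; case: k Cf => // k Cf sk [x y]; rewrite inE => -[/= Ux _].
rewrite iter_dderive_rcons; apply: dderive_eq => //.
have e : {in U `*` [set: V], iter_differential f vws =1 iter_dderive (differential f) vws}.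
  by move=> p pU; rewrite (IH k.+1)// ltnW.
apply: (dquotient_local (open_setXT oU) _ e); first by split.
exact: (is_dderive_iter_differential (k := k)) Cf sk Ux.
Qed.

Lemma Ck_differential k f U : open U -> Ck (Some k.+1) U f ->
  Ck (Some k) (U `*` setT) (differential f).
Proof.
move=> oU Cf; split=> [vws [v w] [x y] /= sk [/= Ux _]|j /= jk p].
  case: k Cf sk => // k Cf; rewrite ltnS => sk.
  have e : {in U `*` [set: V],
      iter_differential f vws =1 iter_dderive (differential f) vws}.
    by move=> p pU; rewrite (iter_dderive_differential oU Cf)// ltnW.
  apply: (dderivable_eq (open_setXT oU) _ e); first by split.
  by exists (iter_differential f (rcons vws (v, w)) (x, y));
    apply: is_dderive_iter_differential Cf sk Ux.
rewrite inE => -[[Up1 _] _].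
pose T := (V * V * prod_topology (fun _ : 'I_j => (V * V)%type))%type.
have szp (r : T) : size (codom r.2) = j.
  by rewrite size_codom card_ord.
have near_eq : \forall r \near p, iter_differential f (codom r.2) r.1 =
    iter_dderive (differential f) (codom r.2) r.1.
  have : \forall r \near p, (U `*` [set: V]) r.1.
    by apply: cvg_fst; apply: open_nbhs_nbhs; split; [exact: open_setXT|].
  apply: filterS => r Ur; rewrite (iter_dderive_differential oU Cf) ?inE//.
  by rewrite szp.
rewrite /continuous_at -(nbhs_singleton near_eq).
apply: cvg_trans (near_eq_cvg near_eq) _.
have c1 : r.1.1 @[r --> p] --> p.1.1 by exact: (cvg_comp _ _ cvg_fst cvg_fst).
have c2 : r.1.2 @[r --> p] --> p.1.2 by exact: (cvg_comp _ _ cvg_fst cvg_snd).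
have cpr i : r.2 i @[r --> p] --> p.2 i.
  have c5 : r.2 @[r --> p] --> p.2 by exact: cvg_snd.
  exact: (cvg_comp _ _ c5 (@proj_continuous _ (fun _ : 'I_j => (V * V)%type) i _)).
have c3 i : (r.2 i).1 @[r --> p] --> (p.2 i).1 by exact: (cvg_comp _ _ (cpr i) cvg_fst).
have c4 i : (r.2 i).2 @[r --> p] --> (p.2 i).2 by exact: (cvg_comp _ _ (cpr i) cvg_snd).
pose vs := [seq (fun r : T => (r.2 i).1) | i <- enum 'I_j].
pose ws := [seq (fun r : T => (r.2 i).2) | i <- enum 'I_j].
have vsE (r : T) : unzip1 (codom r.2) = [seq z r | z <- vs].
  by rewrite /unzip1 codomE -!map_comp.
have wsE (r : T) : unzip2 (codom r.2) = [seq z r | z <- ws].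
  by rewrite /unzip2 codomE -!map_comp.
have svs : size vs = j by rewrite size_map size_enum_ord.
have sws : size ws = j by rewrite size_map size_enum_ord.
have cvs i : nth (fun=> 0) vs i @ p --> nth (fun=> 0) vs i p.
  have [iv|iv] := ltnP i j; last by rewrite nth_default ?svs//; exact: cvg_cst.
  by rewrite (nth_map (Ordinal iv)) ?size_enum_ord// (nth_ord_enum _ (Ordinal iv)).
have cws i : nth (fun=> 0) ws i @ p --> nth (fun=> 0) ws i p.
  have [iv|iv] := ltnP i j; last by rewrite nth_default ?sws//; exact: cvg_cst.
  by rewrite (nth_map (Ordinal iv)) ?size_enum_ord// (nth_ord_enum _ (Ordinal iv)).
pose D (zs : seq (T -> V)) (r : T) := iter_dderive f [seq z r | z <- zs] r.1.1.
have E : (fun r : T => iter_differential f (codom r.2) r.1) = fun r =>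
    D ((fun r : T => r.1.2) :: vs) r + \sum_(0 <= i < j)
       D (nth (fun=> 0) ws i :: take i vs ++ drop i.+1 vs) r.
  apply/funext => r.
  rewrite /iter_differential vsE wsE szp -(big_mkord xpredT
    (fun i => iter_dderive f (nth 0 [seq z r | z <- ws] i ::
      take i [seq z r | z <- vs] ++ drop i.+1 [seq z r | z <- vs]) r.1.1)) /=.
  congr (_ + _); apply: eq_big_nat => i ij.
  by rewrite /D /= map_cat map_take map_drop (nth_map (fun=> 0)) ?sws.
have Ep := congr1 (fun h => h p) E; cbv beta in Ep; rewrite Ep E.
apply: tvs_cvgD.
  apply: (@iter_dderive_cvg _ _ _ _ _ _ _ p (fun r => r.1.1)
    ((fun r : T => r.1.2) :: vs) Cf) => //=; first by rewrite svs ltnS.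
  by move=> [|i]//= _; exact: cvs.
apply: tvs_cvg_sum => i /andP[_ ij].
apply: (@iter_dderive_cvg _ _ _ _ _ _ _ p (fun r => r.1.1)
    (nth (fun=> 0) ws i :: take i vs ++ drop i.+1 vs) Cf) => //=.
  by rewrite size_cat size_take size_drop svs ij; lia.
move=> [|m] _; first exact: cws.
move=> /=.
rewrite nth_cat size_take svs ij; case: ifPn => mi.
  by rewrite nth_take//; exact: cvs.
by rewrite nth_drop; exact: cvs.
Qed.

End differential.

Section differential_recursion.
Context {R : realType} {V F : tvsType R}.
Hypothesis hF : hausdorff_space F.
Implicit Types (f g : V -> F) (U : set V) (x v w : V).

Lemma Ck0P f U : Ck (Some 0) U f <-> (forall x, U x -> f @ x --> f x).
Proof.
split=> [Cf x Ux|cf]; first exact: Ck_continuous Cf Ux.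
split=> [//|[|//] _ p]; rewrite inE => -[Up _].
have e (r : V * prod_topology (fun _ : 'I_0 => V)) : codom r.2 = [::].
  by apply/nilP; rewrite /nilp size_codom card_ord.
rewrite /continuous_at e (_ : (fun r => _) = fun r => f r.1).
  by apply: (cvg_comp _ _ cvg_fst); exact: cf.
by apply/funext => r; rewrite e.
Qed.

(** Lets iterated derivatives of [f] be read off [differential f]: the first direction is frozen as
    second component, the others become [(z, 0)]. *)
Lemma iter_dderive_pair (g : V * V -> F) ys x y :
  iter_dderive (fun z => g (z, y)) ys x = iter_dderive g [seq (z, 0) | z <- ys] (x, y).
Proof.
elim: ys g => [//|z ys IH] g /=; rewrite -IH; congr (iter_dderive _ ys x).
apply/funext => t; rewrite /dderive.
rewrite (_ : dquotient (fun z0 => g (z0, y)) t z = dquotient g (t, y) (z, 0))//.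
apply/funext => h; rewrite /dquotient; congr (_ *: (g _ - _)).
by congr pair; rewrite /= scaler0 addr0.
Qed.

Lemma CkS_of k f U : open U -> (forall x, U x -> f @ x --> f x) ->
  (forall x v, U x -> dderivable f x v) -> Ck (Some k) (U `*` setT) (differential f) ->
  Ck (Some k.+1) U f.
Proof.
move=> oU cf df Cd.
have E y ys : iter_dderive f (y :: ys) =
    (fun x => iter_dderive (differential f) [seq (z, 0) | z <- ys] (x, y)).
  by apply/funext => x; rewrite -iter_dderive_pair.
split=> [[|y ys] v x /= sk Ux|[|j] jk p].
- exact: df.
- rewrite ltnS in sk; have [h _] := Cd.
  have Uxy : (U `*` [set: V]) (x, y) by split.
  have /(h _ (v, 0) (x, y))/(_ Uxy)[l hl] :
      le_order (size [seq (z, (0 : V)) | z <- ys]).+1 (Some k) by rewrite size_map.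
  exists l; move: hl; rewrite -[iter_dderive _ ys]/(iter_dderive f (y :: ys)) E.
  rewrite (_ : dquotient _ (x, y) (v, 0) = dquotient (fun x0 =>
    iter_dderive (differential f) [seq (z, 0) | z <- ys] (x0, y)) x v)//.
  apply/funext => t; rewrite /dquotient; congr (_ *: (iter_dderive _ _ _ - _)).
  by congr pair; rewrite /= scaler0 addr0.
- by have /Ck0P cf0 := cf; have [_ h] := cf0; exact: (h 0%N).
- rewrite inE => -[Up _].
  pose T := (V * prod_topology (fun _ : 'I_j.+1 => V))%type.
  pose zs := [seq (fun r : T => (r.2 (lift ord0 i), (0 : V))) | i <- enum 'I_j].
  have e : (fun r : T => iter_dderive f (codom r.2) r.1) = fun r =>
      iter_dderive (differential f) [seq z r | z <- zs] (r.1, r.2 ord0).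
    by apply/funext => r; rewrite codomE enum_ordSl map_cons E -!map_comp.
  have ep := congr1 (fun h => h p) e; cbv beta in ep.
  rewrite /continuous_at ep e.
  have cpr i : r.2 i @[r --> p] --> p.2 i.
    have c5 : r.2 @[r --> p] --> p.2 by exact: cvg_snd.
    exact: (cvg_comp _ _ c5 (@proj_continuous _ (fun _ : 'I_j.+1 => V) i _)).
  apply: (@iter_dderive_cvg _ _ _ _ _ _ _ p (fun r => (r.1, r.2 ord0)) zs Cd) => //=.
  + by rewrite size_map size_enum_ord.
  + apply: (@cvg_pair _ _ _ _ (nbhs p.1) (nbhs (p.2 ord0))); [exact: cvg_fst|exact: cpr].
  + move=> i; rewrite size_map size_enum_ord => ij.
    rewrite (nth_map (Ordinal ij)) ?size_enum_ord// (nth_ord_enum _ (Ordinal ij)).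
    by apply: (@cvg_pair _ _ _ _ (nbhs _) (nbhs _)); [exact: cpr|exact: cvg_cst].
Qed.

(** Trades one order of differentiability for a larger domain space. The product and chain rules
    below are therefore inductions on the order in which the domain space varies. *)
Lemma CkS k f U : open U -> Ck (Some k.+1) U f <->
  [/\ forall x, U x -> f @ x --> f x, forall x v, U x -> dderivable f x v &
      Ck (Some k) (U `*` setT) (differential f)].
Proof.
move=> oU; split=> [Cf|[cf df Cd]]; last exact: CkS_of.
split=> [x Ux|x v Ux|]; [exact: Ck_continuous Cf Ux|exact: Ck_dderivable Cf Ux|].
exact: Ck_differential.
Qed.

End differential_recursion.

(** * Stability of C^k under pairing, products and composition *)

Section Ck_operations.
Context {R : realType}.

Lemma is_dderive_scale (V F : tvsType R) (a : V -> R^o) (u : V -> F) x v b w :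
  is_dderive a x v b -> is_dderive u x v w -> u (x + h *: v) @[h --> (0 : R)^'] --> u x ->
  is_dderive (fun y => (a y : R) *: u y) x v ((b : R) *: u x + (a x : R) *: w).
Proof.
move=> ab uw cu.
have h1 : (dquotient a x v h : R) *: u (x + h *: v) @[h --> (0 : R)^'] --> (b : R) *: u x.
  by apply: tvs_cvgZ; [exact: ab|exact: cu].
have h2 : (a x : R) *: dquotient u x v h @[h --> (0 : R)^'] --> (a x : R) *: w.
  by apply: tvs_cvgZ; [exact: cvg_cst|exact: uw].
apply: cvg_trans (tvs_cvgD h1 h2); apply: near_eq_cvg; apply: nearW => h.
have e (k p q : R) (u1 u0 : F) :
    (k * (p - q)) *: u1 + q *: (k *: (u1 - u0)) = k *: (p *: u1 - q *: u0).
  rewrite [q *: (k *: _)]scalerA [q * k]mulrC -!scalerA -scalerDr.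
  by rewrite scalerBl scalerBr addrA subrK.
exact: e.
Qed.

Lemma Ro_hausdorff : hausdorff_space (R^o : tvsType R).
Proof. exact: Rhausdorff. Qed.

Lemma prod_hausdorff (F1 F2 : tvsType R) : hausdorff_space F1 -> hausdorff_space F2 ->
  hausdorff_space (F1 * F2)%type.
Proof.
move=> h1 h2 [x1 x2] [y1 y2] h; congr pair.
  apply: h1 => A B xA yB.
  have [] := h (fst @^-1` A) (fst @^-1` B).
  - by apply: (@cvg_fst _ _ (nbhs x1) (nbhs x2)).
  - by apply: (@cvg_fst _ _ (nbhs y1) (nbhs y2)).
  - by move=> [z1 z2] [Az Bz]; exists z1.
apply: h2 => A B xA yB.
have [] := h (snd @^-1` A) (snd @^-1` B).
- by apply: (@cvg_snd _ _ (nbhs x1) (nbhs x2)).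
- by apply: (@cvg_snd _ _ (nbhs y1) (nbhs y2)).
- by move=> [z1 z2] [Az Bz]; exists z2.
Qed.

Lemma Ck_cst (l : diff_order) (V F : tvsType R) (hF : hausdorff_space F) (U : set V)
    (c : F) : open U -> Ck l U (fun _ => c).
Proof.
move=> oU; apply/CkP => + _; case=> [|n]; first by apply/Ck0P => x _; exact: cvg_cst.
apply/CkS => //; split=> [x _|x v _|]; first exact: cvg_cst.
  by exists 0; exact: is_dderive_cst.
rewrite (_ : differential _ = 0); first exact: Ck0.
by apply/funext => p; apply: dderive_eq => //; exact: is_dderive_cst.
Qed.

Lemma Ck_linear (l : diff_order) (V F : tvsType R) (hF : hausdorff_space F) (U : set V)
    (L : V -> F) : (forall (a : R) x y, L (a *: x + y) = a *: L x + L y) ->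
  continuous L -> open U -> Ck l U L.
Proof.
move=> Llin Lcont oU; apply/CkP => n _; elim: n V U L Llin Lcont oU => [|n IH] V U L Llin Lcont oU.
  by apply/Ck0P => x _; exact: Lcont.
have dL x v : is_dderive L x v (L v).
  have : (fun _ : R => L v) h @[h --> (0 : R)^'] --> L v by exact: cvg_cst.
  apply: cvg_trans; apply: near_eq_cvg.
  have : \forall h \near (0 : R)^', h != 0 by exact: nbhs_dnbhs_neq.
  apply: filterS => h h0; rewrite /dquotient [x + _]addrC Llin addrK.
  by rewrite scalerA mulVf// scale1r.
apply/CkS => //; split=> [x _|x v _|]; first exact: Lcont.
  by exists (L v); exact: dL.
rewrite (_ : differential L = fun p => L p.2).
  apply: IH; last exact: open_setXT.
    by move=> a x y; rewrite -Llin.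
  by move=> p; apply: (cvg_comp _ _ cvg_snd); exact: Lcont.
by apply/funext => p; apply: dderive_eq => //; exact: dL.
Qed.

Lemma is_dderive_pair (V F1 F2 : tvsType R) (f : V -> F1) (g : V -> F2) x v a b :
  is_dderive f x v a -> is_dderive g x v b ->
  is_dderive (fun y => (f y, g y)) x v (a, b).
Proof. by move=> fa gb; apply: (@cvg_pair _ _ _ _ (nbhs a) (nbhs b)). Qed.

Lemma Ck_pair (l : diff_order) (V F1 F2 : tvsType R) (hF1 : hausdorff_space F1)
    (hF2 : hausdorff_space F2) (U : set V) (f : V -> F1) (g : V -> F2) : open U ->
  Ck l U f -> Ck l U g -> Ck l U (fun x => (f x, g x)).
Proof.
have hF := prod_hausdorff hF1 hF2.
move=> oU Cf Cg; apply/CkP => n nl.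
have {}Cf : Ck (Some n) U f by have /CkP := Cf; exact.
have {}Cg : Ck (Some n) U g by have /CkP := Cg; exact.
elim: n V U f g oU Cf Cg {nl} => [|n IH] V U f g oU Cf Cg.
  apply/Ck0P => x Ux; apply: (@cvg_pair _ _ _ _ (nbhs _) (nbhs _)).
    exact: Ck_continuous Cf Ux.
  exact: Ck_continuous Cg Ux.
have d x v : U x -> is_dderive (fun y => (f y, g y)) x v (dderive v f x, dderive v g x).
  move=> Ux; apply: is_dderive_pair; apply: is_dderiveP => //; last exact: Ck_dderivable Cg Ux.
  exact: Ck_dderivable Cf Ux.
have [cf df Cdf] := iffLR (CkS hF1 n f oU) Cf.
have [cg dg Cdg] := iffLR (CkS hF2 n g oU) Cg.
apply/CkS => //; split=> [x Ux|x v Ux|].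
- by apply: (@cvg_pair _ _ _ _ (nbhs _) (nbhs _)); [exact: cf|exact: cg].
- by exists (dderive v f x, dderive v g x); exact: d.
- apply: (@Ck_eq _ _ _ _ (fun p => (differential f p, differential g p))).
  + exact: open_setXT.
  + by move=> p; rewrite inE => -[Up _]; rewrite /differential (dderive_eq hF (d _ _ Up)).
  + by apply: IH => //; exact: open_setXT.
Qed.

(** The increment of [f] is [h] times [dquotient f x v h], so [g] is differentiated in a direction
    that moves with [h] and tends to [a]; strict differentiability of [g] covers this. *)
Lemma is_dderive_comp n (V F1 F2 : tvsType R) (hF1 : hausdorff_space F1)
    (hF2 : hausdorff_space F2) (W : set F1) (f : V -> F1) (g : F1 -> F2) x v a :
  open W -> Ck (Some n.+1) W g -> W (f x) -> is_dderive f x v a ->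
  is_dderive (g \o f) x v (dderive a g (f x)).
Proof.
move=> oW Cg Wfx fa.
have h1 : t^-1 *: (g (f x + t *: dquotient f x v t) - g (f x)) @[t --> (0 : R)^'] -->
    dderive a g (f x).
  apply: (strict_derivative_cvg hF2 (xs := fun _ => f x) oW Cg Wfx (cvg_cst _) fa).
  exact: cvg_id.
apply: cvg_trans h1; apply: near_eq_cvg.
have : \forall h \near (0 : R)^', h != 0 by exact: nbhs_dnbhs_neq.
apply: filterS => h h0; rewrite /dquotient /= scalerA mulfV// scale1r.
by rewrite [f x + _]addrC subrK.
Qed.

(** The differential of [g \o f] is [differential g] after the pair formed by [f \o fst] and
    [differential f], again a composite, with one order less. *)
Lemma Ck_comp (l : diff_order) (V F1 F2 : tvsType R) (hV : hausdorff_space V) (hF1 : hausdorff_space F1)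
    (hF2 : hausdorff_space F2) (U : set V) (W : set F1) (f : V -> F1) (g : F1 -> F2) :
  open U -> open W -> (forall x, U x -> W (f x)) ->
  Ck l U f -> Ck l W g -> Ck l U (g \o f).
Proof.
move=> oU oW UW Cf Cg; apply/CkP => n nl.
have {}Cf : Ck (Some n) U f by have /CkP := Cf; exact.
have {}Cg : Ck (Some n) W g by have /CkP := Cg; exact.
elim: n V F1 F2 hV hF1 hF2 U W f g oU oW UW Cf Cg {nl} =>
    [|n IH] V F1 F2 hV hF1 hF2 U W f g oU oW UW Cf Cg.
  apply/Ck0P => x Ux; apply: (cvg_comp f g); first exact: Ck_continuous Cf Ux.
  exact: Ck_continuous Cg (UW _ Ux).
have [cf df Cdf] := iffLR (CkS hF1 n f oU) Cf.
have [cg dg Cdg] := iffLR (CkS hF2 n g oW) Cg.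
have d x v : U x -> is_dderive (g \o f) x v (dderive (dderive v f x) g (f x)).
  move=> Ux; apply: is_dderive_comp Cg _ _ => //; first exact: UW.
  exact/is_dderiveP/df.
apply/CkS => //; split=> [x Ux|x v Ux|].
- by apply: (cvg_comp f g); [exact: cf|exact/cg/UW].
- by exists (dderive (dderive v f x) g (f x)); exact: d.
- have oUT : open (U `*` [set: V]) by exact: open_setXT.
  apply: (@Ck_eq _ _ _ _ (differential g \o (fun p => (f p.1, differential f p)))) => //.
    by move=> p; rewrite inE => -[Up _]; rewrite /differential (dderive_eq hF2 (d _ _ Up)).
  apply: (IH _ _ _ _ _ _ _ (W `*` [set: F1])) => //.
  + exact: prod_hausdorff.
  + exact: prod_hausdorff.
  + exact: open_setXT.
  + by move=> p [Up _]; split; [exact: UW|].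
  + apply: Ck_pair => //.
    have CU : Ck (Some n) U f by have /CkP := Cf; apply; exact: leqW.
    apply: (IH _ _ _ _ _ _ _ U fst f) => //; first exact: prod_hausdorff.
      by move=> p [].
    by apply: Ck_linear => // p; exact: cvg_fst.
Qed.

Lemma Ck_comp_fst (l : diff_order) (V V' F : tvsType R) (hV : hausdorff_space V)
    (hV' : hausdorff_space V') (hF : hausdorff_space F) (U : set V) (f : V -> F) : open U -> Ck l U f ->
  Ck l (U `*` [set: V']) (f \o fst).
Proof.
move=> oU Cf; have oUT : open (U `*` [set: V']).
  rewrite (_ : _ `*` _ = fst @^-1` U).
    by apply: open_comp => // p _; exact: cvg_fst.
  by apply/seteqP; split=> p //= [].
apply: (Ck_comp (prod_hausdorff hV hV') hV hF (W := U)) => //; first by move=> p [].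
by apply: Ck_linear => // p; exact: cvg_fst.
Qed.

Lemma Ck_scale (l : diff_order) (V F : tvsType R) (hV : hausdorff_space V)
    (hF : hausdorff_space F) (U : set V) (a : V -> R^o) (u : V -> F) : open U ->
  Ck l U a -> Ck l U u -> Ck l U (fun x => (a x : R) *: u x).
Proof.
move=> oU Ca Cu; apply/CkP => n nl.
have {}Ca : Ck (Some n) U a by have /CkP := Ca; exact.
have {}Cu : Ck (Some n) U u by have /CkP := Cu; exact.
elim: n V hV U a u oU Ca Cu {nl} => [|n IH] V hV U a u oU Ca Cu.
  apply/Ck0P => x Ux; apply: tvs_cvgZ; first exact: Ck_continuous Ca Ux.
  exact: Ck_continuous Cu Ux.
have [ca da Cda] := iffLR (CkS Ro_hausdorff n a oU) Ca.
have [cu du Cdu] := iffLR (CkS hF n u oU) Cu.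
have d x v : U x -> is_dderive (fun y => (a y : R) *: u y) x v
    ((dderive v a x : R) *: u x + (a x : R) *: dderive v u x).
  move=> Ux; apply: is_dderive_scale.
  - exact/is_dderiveP/da/Ux/Ro_hausdorff.
  - exact/is_dderiveP/du.
  - have xl : x + t *: v @[t --> (0 : R)^'] --> x by exact: line_cvg.
    exact: (cvg_comp _ _ xl (cu x Ux)).
have oUT : open (U `*` [set: V]) by exact: open_setXT.
apply/CkS => //; split=> [x Ux|x v Ux|].
- by apply: tvs_cvgZ; [exact: ca|exact: cu].
- eexists; exact: d.
- apply: (@Ck_eq _ _ _ _ (1 *: (fun p => (differential a p : R) *: u p.1) +
    (fun p => (a p.1 : R) *: differential u p))) => //.
    move=> p; rewrite inE => -[Up _].
    by rewrite {3}/differential (dderive_eq hF (d _ _ Up)) scale1r !fctE.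
  apply: Ck_lin => //; apply: IH => //; try exact: prod_hausdorff.
    by apply: Ck_comp_fst => //; have /CkP := Cu; apply; exact: leqW.
  apply: (@Ck_comp_fst _ _ _ R^o) => //.
  by have /CkP := Ca; apply; exact: leqW.
Qed.

End Ck_operations.

Lemma subrACA (M : zmodType) (a b c e : M) : a - b - (c - e) = a - c - (b - e).
Proof. by rewrite !opprD !opprK addrACA. Qed.

(** * Symmetry of higher derivatives *)

Section symmetry_of_derivatives.
Context {R : realType} {V F : tvsType R}.
Hypothesis hF : hausdorff_space F.
Implicit Types (f g : V -> F) (U : set V) (x y z v w : V) (q : cseminorm F).

Lemma Ck_dderive n f U v : Ck (Some n.+1) U f -> Ck (Some n) U (dderive v f).
Proof.
move=> Cf; have [h1 _] := Cf; split=> [ys y x /= sn Ux|j /= jn p].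
  by apply: (h1 (v :: ys)) => //=.
rewrite inE => -[Up _].
pose T := (V * prod_topology (fun _ : 'I_j => V))%type.
pose zs := [seq (fun r : T => r.2 i) | i <- enum 'I_j].
have e : (fun r : T => iter_dderive (dderive v f) (codom r.2) r.1) = fun r =>
    iter_dderive f [seq k r | k <- (fun=> v) :: zs] r.1.
  by apply/funext => r; rewrite codomE /= -!map_comp.
have ep := congr1 (fun h => h p) e; cbv beta in ep.
rewrite /continuous_at ep e.
have cpr i : r.2 i @[r --> p] --> p.2 i.
  have c5 : r.2 @[r --> p] --> p.2 by exact: cvg_snd.
  exact: (cvg_comp _ _ c5 (@proj_continuous _ (fun _ : 'I_j => V) i _)).
apply: (@iter_dderive_cvg _ _ _ _ _ _ _ p (fun r => r.1) ((fun=> v) :: zs) Cf) => //=.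
- by rewrite size_map size_enum_ord.
- exact: cvg_fst.
- move=> [|i]; first by move=> _; exact: cvg_cst.
  rewrite ltnS size_map size_enum_ord => ij /=.
  by rewrite (nth_map (Ordinal ij)) ?size_enum_ord// (nth_ord_enum _ (Ordinal ij)).
Qed.

Lemma Ck_iter_dderive n f U ys : Ck (Some (size ys + n)%N) U f ->
  Ck (Some n) U (iter_dderive f ys).
Proof. by elim: ys f => //= y ys IH f Cf; apply: IH; exact: Ck_dderive. Qed.

(** Mean value inequality along [v] for the map sending [y] to [f (y + t *: w) - f y]: its
    derivative is a first difference of [dderive v f], which strict differentiability compares with
    [t *: dderive w (dderive v f) x]. *)
Let second_difference f U x v w q (e : R) : open U -> Ck (Some 2) U f -> U x -> 0 < e ->
  \forall t \near (0 : R),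
    q ((f (x + t *: v + t *: w) - f (x + t *: v)) - (f (x + t *: w) - f x) -
       t *: (t *: dderive w (dderive v f) x)) <= `|t| * (`|t| * e).
Proof.
move=> oU Cf Ux e0.
have [[A B] /= [nA nB] AB] := strict_derivative hF w q oU (Ck_dderive v Cf) Ux e0.
have [[A1 A2] /= [nA1 nA2] A12] := nA.
have h1 : \forall t \near (0 : R), (A1 `&` U) (x + t *: v).
  have : x + t *: v @[t --> (0 : R)] --> x.
    rewrite -[X in _ --> X]addr0 -(scale0r v).
    by apply: tvs_cvgD; [exact: cvg_cst|apply: tvs_cvgZ; [exact: cvg_id|exact: cvg_cst]].
  by apply; apply: filterI => //; exact: open_nbhs_nbhs.
have h2 : \forall t \near (0 : R), forall s : R, 0 <= s <= 1 ->
    (A1 `&` U) (x + (s * t) *: v).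
  have /nbhs_ballP[d /= d0 hd] := h1; apply/nbhs_ballP; exists d => //= t td s /andP[s0 s1].
  apply: hd; move: td; rewrite /ball/= !sub0r !normrN normrM; apply: le_lt_trans.
  by rewrite ler_piMl// ger0_norm.
have h3 : \forall p \near ((0 : R), (0 : R)), U (x + p.1 *: v + p.2 *: w).
  have : x + p.1 *: v + p.2 *: w @[p --> ((0 : R), (0 : R))] --> x.
    rewrite -[X in _ --> X]addr0 -[X in _ --> X]addr0 -{1}(scale0r v) -(scale0r w).
    apply: tvs_cvgD; last by apply: tvs_cvgZ; [exact: cvg_snd|exact: cvg_cst].
    by apply: tvs_cvgD; [exact: cvg_cst|apply: tvs_cvgZ; [exact: cvg_fst|exact: cvg_cst]].
  by apply; exact: open_nbhs_nbhs.
have h4 : \forall t \near (0 : R), forall s : R, 0 <= s <= 1 -> U (x + (s * t) *: v + t *: w).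
  have [[P Q] /= [/nbhs_ballP[d /= d0 hd] nQ] PQ] := h3.
  have : \forall t \near (0 : R), ball 0 d t /\ Q t.
    by apply: filterI => //; exact: nbhsx_ballx.
  apply: filterS => t [td Qt] s /andP[s0 s1]; apply: (PQ (s * t, t)); split=> //=.
  apply: hd; move: td; rewrite /ball/= !sub0r !normrN normrM; apply: le_lt_trans.
  by rewrite ler_piMl// ger0_norm.
near=> t.
have Bt : B t by near: t.
have h2t : forall s : R, 0 <= s <= 1 -> (A1 `&` U) (x + (s * t) *: v) by near: t.
have h4t : forall s : R, 0 <= s <= 1 -> U (x + (s * t) *: v + t *: w) by near: t.
have [H4 H5] : (forall y, A1 y -> q (dderive v f (y + t *: w) - dderive v f y -
    t *: dderive w (dderive v f) x) <= `|t| * e) /\ True.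
  split=> // y Ay; apply: (AB ((y, w), t)); split=> //=; apply: A12; split=> //=.
  exact: nbhs_singleton.
pose g y := f (y + t *: w) - f y.
have := @cseminorm_segment _ _ _ g x v
  (fun s => dderive v f (x + (s * t) *: v + t *: w) - dderive v f (x + (s * t) *: v))
  (t *: dderive w (dderive v f) x) q t (`|t| * e).
apply=> s s01; last by apply: H4; have [] := h2t s s01.
have d1 := is_dderiveP hF (Ck_dderivable v Cf (h4t s s01)).
have [_ Us] := h2t s s01.
have d2 := is_dderiveP hF (Ck_dderivable v Cf Us).
apply: cvg_trans (tvs_cvgB d1 d2); apply: near_eq_cvg; apply: nearW => h.
rewrite /dquotient /g -scalerBr; congr (_ *: _).
by rewrite subrACA [x + _ + t *: w + _]addrAC.
Unshelve. all: by end_near. Qed.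

(** The second difference of [f] is symmetric in [v] and [w], while its two approximations carry the
    two mixed derivatives. *)
Lemma dderiveC f U x v w : open U -> Ck (Some 2) U f -> U x ->
  dderive w (dderive v f) x = dderive v (dderive w f) x.
Proof.
move=> oU Cf Ux; apply/eqP; rewrite -subr_eq0; apply/eqP.
apply: (hausdorff_cseminorm_eq0 hF) => q; apply/eqP.
rewrite eq_le cseminorm_ge0 andbT; apply/ler_addgt0Pr => e e0; rewrite add0r.
have e2 : 0 < e / 2 by rewrite divr_gt0.
have h1 := second_difference v w q oU Cf Ux e2.
have h2 := second_difference w v q oU Cf Ux e2.
have : \forall t \near (0 : R)^', [/\ t != 0,
    q ((f (x + t *: v + t *: w) - f (x + t *: v)) - (f (x + t *: w) - f x) -
       t *: (t *: dderive w (dderive v f) x)) <= `|t| * (`|t| * (e / 2)) &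
    q ((f (x + t *: w + t *: v) - f (x + t *: w)) - (f (x + t *: v) - f x) -
       t *: (t *: dderive v (dderive w f) x)) <= `|t| * (`|t| * (e / 2))].
  have h0 : \forall t \near (0 : R)^', t != 0 by exact: nbhs_dnbhs_neq.
  by apply: filterS3 h0 (nbhs_dnbhs h1) (nbhs_dnbhs h2) => t.
move=> /filter_ex[t [t0]].
set A := f (x + t *: v + t *: w); set B := f (x + t *: v); set C := f (x + t *: w).
have -> : f (x + t *: w + t *: v) = A by rewrite /A addrAC.
set l1 := dderive w _ x; set l2 := dderive v _ x => k1 k2.
have tt0 : 0 < `|t| * `|t| by rewrite mulr_gt0// normr_gt0.
rewrite -(ler_pM2l tt0) -mulrA -cseminormZ -cseminormZ.
have -> : t *: (t *: (l1 - l2)) = (A - C - (B - f x) - t *: (t *: l2)) -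
    (A - B - (C - f x) - t *: (t *: l1)).
  rewrite [A - C - _]subrACA; set X := A - B - _.
  by rewrite !scalerBr opprB [RHS]addrC addrA subrK.
apply: le_trans (cseminormB _ _ _) _; apply: le_trans (lerD k2 k1) _.
by rewrite le_eqVlt; apply/orP; left; apply/eqP; field.
Qed.

Lemma iter_dderive_move n f U x ys y zs : open U -> Ck (Some n) U f ->
  (size ys + (size zs).+1 <= n)%N -> U x ->
  iter_dderive f (ys ++ y :: zs) x = iter_dderive f (y :: ys ++ zs) x.
Proof.
move=> oU; elim/last_ind: ys zs => [//|ys v IH] zs Cf sn Ux.
rewrite size_rcons addSn in sn.
rewrite !cat_rcons -(IH (v :: zs))//=; last by rewrite addnS.
rewrite /iter_dderive !foldl_cat /=.
apply: (@iter_dderive_eq _ _ _ _ _ U zs oU); last by rewrite inE.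
move=> t /[!inE] Ut. apply: (dderiveC _ _ oU _ Ut).
apply: Ck_iter_dderive; apply: Ck_leq Cf => k /= /leq_trans; apply.
by apply: leq_trans sn; rewrite -addnS leq_add2l.
Qed.

Lemma iter_dderive_perm n f U x ys zs : open U -> Ck (Some n) U f ->
  (size ys <= n)%N -> U x -> perm_eq ys zs ->
  iter_dderive f ys x = iter_dderive f zs x.
Proof.
move=> oU; elim: ys n f zs => [|y ys IH] n f zs Cf sn Ux.
  by move=> /perm_size/esym/size0nil ->.
move=> yszs; have sz := perm_size yszs.
have : y \in zs by rewrite -(perm_mem yszs) mem_head.
move=> /splitPr e; case: e yszs sz => s1 s2 yszs sz.
rewrite (iter_dderive_move y oU Cf)//; last first.
  by move: sz; rewrite size_cat /= => <-.
case: n Cf sn => // n Cf sn; apply: (IH n) => //; first exact: Ck_dderive.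
by rewrite -(perm_cons y) (perm_trans yszs)// -cat1s perm_catCA.
Qed.

End symmetry_of_derivatives.

(** * Multilinearity, polarization and the Leibniz rule *)

Section multilinearity.
Context {R : realType} {V F : tvsType R}.
Hypothesis hF : hausdorff_space F.
Implicit Types (f g : V -> F) (U : set V) (x y z v w : V) (q : cseminorm F).

Lemma iter_dderive_head0 n f U x vs : open U -> Ck (Some n) U f ->
  (size vs < n)%N -> U x -> iter_dderive f (0 :: vs) x = 0.
Proof.
case: n => // n oU Cf sn Ux.
have := iter_dderive_head_lin hF 1 0 0 oU Cf sn Ux.
rewrite !scale1r addr0 => /eqP.
by rewrite -subr_eq0 opprD addrA subrr sub0r oppr_eq0 => /eqP.
Qed.

Lemma iter_dderive_headZ n f U x (a : R) y vs : open U -> Ck (Some n) U f ->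
  (size vs < n)%N -> U x -> iter_dderive f ((a *: y) :: vs) x = a *: iter_dderive f (y :: vs) x.
Proof.
case: n => // n oU Cf sn Ux.
have := iter_dderive_head_lin hF a y 0 oU Cf sn Ux.
by rewrite addr0 (iter_dderive_head0 oU Cf)// addr0.
Qed.

Lemma iter_dderive_head_sum n f U x (I : Type) (r : seq I) (a : I -> R) (v : I -> V) vs :
  open U -> Ck (Some n) U f -> (size vs < n)%N -> U x ->
  iter_dderive f ((\sum_(i <- r) a i *: v i) :: vs) x =
  \sum_(i <- r) a i *: iter_dderive f (v i :: vs) x.
Proof.
move=> oU Cf sn Ux; elim: r => [|i r IH].
  by rewrite !big_nil (iter_dderive_head0 oU Cf).
rewrite !big_cons -IH; case: n Cf sn => // n Cf sn.
exact: (iter_dderive_head_lin hF _ _ _ oU Cf).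
Qed.

Lemma iter_dderive_nseqZ n f U x (a : R) y k : open U -> Ck (Some n) U f ->
  (k <= n)%N -> U x ->
  iter_dderive f (nseq k (a *: y)) x = a ^+ k *: iter_dderive f (nseq k y) x.
Proof.
move=> oU; elim: k n f => [|k IH] n f Cf kn Ux; first by rewrite expr0 scale1r.
case: n Cf kn => // n Cf kn.
rewrite [nseq k.+1 _]/= -[LHS]/(iter_dderive (dderive (a *: y) f) (nseq k (a *: y)) x).
rewrite (IH n)//; last exact: Ck_dderive.
rewrite -[iter_dderive _ _ x]/(iter_dderive f (a *: y :: nseq k y) x).
by rewrite (iter_dderive_headZ _ _ oU Cf) ?size_nseq// scalerA exprSr.
Qed.

(** The linear coefficient contains [z] exactly once, and it is the one that polarization isolates;
    the constant coefficient is recorded for the induction. *)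
Lemma iter_dderive_binomial n f U x y z : open U -> Ck (Some n) U f -> U x ->
  exists c : nat -> F,
   [/\ forall s : R, iter_dderive f (nseq n (y + s *: z)) x = \sum_(a < n.+1) s ^+ a *: c a,
       c 0%N = iter_dderive f (nseq n y) x &
       c 1%N = n%:R *: iter_dderive f (z :: nseq n.-1 y) x].
Proof.
move=> oU; elim: n f => [|n IH] f Cf Ux.
  exists (fun a => if a == 0%N then f x else 0); split=> //=.
    by move=> s; rewrite big_ord_recl big_ord0 addr0 expr0 scale1r.
  by rewrite scale0r.
have [c [cE c0 c1]] := IH _ (Ck_dderive y Cf) Ux.
have [d [dE d0 d1]] := IH _ (Ck_dderive z Cf) Ux.
exists (fun a => (if (a <= n)%N then c a else 0) + (if a is b.+1 then d b else 0)); split.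
- move=> s.
  have sn : (size (nseq n (y + s *: z)%R) < n.+1)%N by rewrite size_nseq.
  have sE : y + s *: z = s *: z + y by exact: addrC.
  rewrite -[nseq n.+1 _]/((y + s *: z) :: nseq n (y + s *: z)) {1}sE.
  rewrite (iter_dderive_head_lin hF _ _ _ oU Cf)//.
  have -> : iter_dderive f (y :: nseq n (y + s *: z)) x =
      \sum_(a < n.+1) s ^+ a *: c a by rewrite -cE.
  have -> : iter_dderive f (z :: nseq n (y + s *: z)) x =
      \sum_(a < n.+1) s ^+ a *: d a by rewrite -dE.
  under [in RHS]eq_bigr do rewrite scalerDr.
  rewrite big_split /= [X in _ = X + _]big_ord_recr /= ltnn scaler0 addr0.
  rewrite [X in _ = _ + X]big_ord_recl /= scaler0 add0r addrC; congr (_ + _).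
    by apply: eq_bigr => i _; rewrite -ltnS ltn_ord.
  by rewrite scaler_sumr; apply: eq_bigr => i _; rewrite scalerA exprS.
- by rewrite leq0n addr0 c0.
- case: n {IH} Cf cE dE c0 c1 d0 d1 => [|n] Cf cE dE c0 c1 d0 d1.
    by rewrite /= add0r scale1r d0.
  rewrite /= c1 d0 -[in RHS]natr1 scalerDl scale1r; congr (_ + _).
  (* Symmetry of the derivatives brings [z] to the front. *)
  congr (_ *: _); rewrite -[LHS]/(iter_dderive f (y :: [:: z] ++ nseq n y) x).
  rewrite -(iter_dderive_move hF y oU Cf)//=.
  by rewrite size_nseq.
Qed.

End multilinearity.

(** Inverse of a Vandermonde matrix. *)
Lemma linear_coefficient_extraction (R : realType) n : exists w : 'I_n.+2 -> R,
  forall (F : lmodType R) (c : nat -> F),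
  \sum_s w s *: (\sum_(a < n.+2) ((s%:R / n.+2%:R : R) ^+ a *: c a)) = c 1%N.
Proof.
pose t (s : 'I_n.+2) : R := s%:R / n.+2%:R.
pose A := Vandermonde n.+2 (\row_s t s).
have Au : A \in unitmx.
  rewrite unitmxE det_Vandermonde unitfE; apply/prodf_neq0 => i _.
  apply/prodf_neq0 => j ij; rewrite !mxE /t -mulrBl.
  by rewrite mulf_neq0 ?invr_neq0 ?pnatr_eq0// subr_eq0 eqr_nat gtn_eqF.
pose e : 'cV[R]_n.+2 := \col_i (i == 1%N :> nat)%:R.
pose W := invmx A *m e.
exists (fun s => W s ord0) => F c.
have AW (a : 'I_n.+2) : \sum_s W s ord0 * t s ^+ a = (a == 1%N :> nat)%:R.
  have := congr1 (fun M : 'cV[R]_n.+2 => M a ord0) (mulKVmx Au e).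
  rewrite !mxE => <-; apply: eq_bigr => s _.
  by rewrite mulrC; congr (_ * _); rewrite !mxE.
under eq_bigr do rewrite scaler_sumr.
rewrite exchange_big /=.
under eq_bigr => a _.
  under eq_bigr do rewrite scalerA.
  rewrite -scaler_suml AW.
  over.
rewrite (bigD1 (Ordinal (isT : 1 < n.+2)%N))//= scale1r big1 ?addr0// => a ha.
by rewrite (_ : (a == 1%N :> nat) = false) ?scale0r//; apply/negbTE.
Qed.

Section polarization.
Context {R : realType} {V F : tvsType R}.
Hypothesis hF : hausdorff_space F.
Implicit Types (f g : V -> F) (U : set V) (x y z v w : V) (q : cseminorm F).
Variable N : V -> R.
Hypothesis hN : is_seminorm N.

(** Directions are freed one at a time. The derivative with a further free direction [z] is, up to
    an integer factor, the linear coefficient in [s] of the derivative along [y + s *: z], and this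
    coefficient is a fixed linear combination of values at finitely many [s]. Hence a constant
    independent of [f], [x] and [q]. *)
Lemma polarization_bound n : exists2 C : R, 0 <= C & forall f U x q M, open U ->
  Ck (Some n) U f -> U x ->
  (forall y, N y <= 1 -> q (iter_dderive f (nseq n y) x) <= M) ->
  forall ys, size ys = n -> (forall y, y \in ys -> N y <= 1) ->
  q (iter_dderive f ys x) <= C * M.
Proof.
have H i : (i <= n)%N -> exists2 C : R, 0 <= C & forall f U x q M, open U ->
  Ck (Some n) U f -> U x ->
  (forall y, N y <= 1 -> q (iter_dderive f (nseq n y) x) <= M) ->
  forall zs y, size zs = i -> (forall y, y \in zs -> N y <= 1) -> N y <= 1 ->
  q (iter_dderive f (zs ++ nseq (n - i) y) x) <= C * M.
  elim: i => [|i IH] i_n.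
    exists 1 => // f U x q M oU Cf Ux h [|//] y _ _ Ny; rewrite subn0 mul1r; exact: h.
  have [C C0 hC] := IH (ltnW i_n).
  pose m := (n - i.+1)%N.
  have mE : (n - i)%N = m.+1 by rewrite /m subnSK.
  have [w hw] := linear_coefficient_extraction R m.
  (* The sample points lie in [0, 1], so [y + t *: z] has norm at most 2; halving it to reach the
     unit ball costs [2 ^+ m.+1]. *)
  exists (\sum_s `|w s| * (2 ^+ m.+1 * C)).
    by apply: sumr_ge0 => s _; rewrite !mulr_ge0// exprn_ge0.
  move=> f U x q M oU Cf Ux h zs y szs Nzs Ny; rewrite -/m.
  have [zs' [z [e]]] : exists zs' z, zs = rcons zs' z /\ size zs' = i.
    case/lastP: zs szs {Nzs} => // zs' z; rewrite size_rcons => -[s]; by exists zs', z.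
  move=> szs'; rewrite e in szs Nzs *.
  have Nz : N z <= 1 by apply: Nzs; rewrite mem_rcons mem_head.
  have Cg : Ck (Some m.+1) U (iter_dderive f zs').
    by apply: Ck_iter_dderive; rewrite szs' -mE subnKC ?(ltnW i_n).
  have [c [cE _ c1]] := iter_dderive_binomial hF y z oU Cg Ux.
  have {}c1 : c 1%N = m.+1%:R *: iter_dderive f (rcons zs' z ++ nseq m y) x.
    by rewrite c1 cat_rcons /iter_dderive foldl_cat.
  have M0 : 0 <= M.
    by apply: le_trans (cseminorm_ge0 q _) (h 0 _); rewrite (seminorm0 hN).
  have pb (s : 'I_m.+2) : q (\sum_(a < m.+2) ((s%:R / m.+2%:R : R) ^+ a *: c a)) <=
      2 ^+ m.+1 * (C * M).
    rewrite -cE; set t : R := _ / _.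
    have t0 : 0 <= t by rewrite divr_ge0.
    have t1 : t <= 1 by rewrite ler_pdivrMr// mul1r ler_nat ltnW.
    have -> : y + t *: z = 2 *: (2^-1 *: (y + t *: z)).
      by rewrite scalerA mulfV// scale1r.
    rewrite (iter_dderive_nseqZ hF 2 _ oU Cg)// cseminormZ ger0_norm ?exprn_ge0//.
    rewrite ler_pM2l ?exprn_gt0//.
    have := hC f U x q M oU Cf Ux h zs' (2^-1 *: (y + t *: z)) szs'.
    rewrite mE /iter_dderive foldl_cat; apply.
      by move=> u uzs; apply: Nzs; rewrite mem_rcons inE uzs orbT.
    rewrite (seminormZ hN) gtr0_norm ?invr_gt0// ler_pdivrMl// mulr1.
    apply: le_trans (seminormD hN _ _) _.
    have : N (t *: z) <= 1.
      by rewrite (seminormZ hN) ger0_norm// mulr_ile1// (seminorm_ge0 _ hN).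
    by move: Ny; lra.
  apply: (@le_trans _ _ (q (c 1%N))).
    rewrite c1 cseminormZ ger0_norm//; apply: ler_peMl; first exact: cseminorm_ge0.
    by rewrite ler1n.
  rewrite -hw; apply: le_trans (cseminorm_sum _ _ _ _) _.
  rewrite mulr_suml; apply: ler_sum => s _.
  by rewrite cseminormZ -!mulrA ler_wpM2l// mulrA -mulrA.
have [C C0 hC] := H n (leqnn n); exists C => // f U x q M oU Cf Ux h ys sys Nys.
have := hC f U x q M oU Cf Ux h ys 0 sys Nys; rewrite subnn cats0; apply.
by rewrite (seminorm0 hN).
Qed.

End polarization.

Section leibniz.
Context {R : realType} {V F : tvsType R}.
Hypothesis hF : hausdorff_space F.
Hypothesis hV : hausdorff_space V.
Implicit Types (U : set V) (x y z v w : V) (q : cseminorm F).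

(** Each differentiation turns one product into two; after [n] of them there are [2 ^+ n] products,
    each at most [M]. *)
Lemma leibniz_bound n (a : V -> R^o) (u : V -> F) U x y q (M : R) : open U ->
  Ck (Some n) U a -> Ck (Some n) U u -> U x ->
  (forall i, (i <= n)%N -> `|iter_dderive a (nseq i y) x : R| *
     q (iter_dderive u (nseq (n - i) y) x) <= M) ->
  q (iter_dderive (fun z => (a z : R) *: u z) (nseq n y) x) <= 2 ^+ n * M.
Proof.
move=> oU; elim: n a u => [|n IH] a u Ca Cu Ux h.
  by rewrite expr0 mul1r /= cseminormZ; exact: (h 0%N).
have Can : Ck (Some n) U a by have /CkP := Ca; apply; exact: leqW.
have Cun : Ck (Some n) U u by have /CkP := Cu; apply; exact: leqW.
have Ca' := Ck_dderive y Ca; have Cu' := Ck_dderive y Cu.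
have C1 := Ck_scale hV hF oU Ca' Cun; have C2 := Ck_scale hV hF oU Can Cu'.
have e : {in U, dderive y (fun z => (a z : R) *: u z) =1
    1 *: (fun z => (dderive y a z : R) *: u z) + (fun z => (a z : R) *: dderive y u z)}.
  move=> z /[!inE] Uz; apply: dderive_eq => //; rewrite scale1r !fctE.
  apply: is_dderive_scale.
  - exact/is_dderiveP/(Ck_dderivable _ Ca Uz)/Ro_hausdorff.
  - exact/is_dderiveP/(Ck_dderivable _ Cu Uz).
  - have xl : z + t *: y @[t --> (0 : R)^'] --> z by exact: line_cvg.
    exact: (cvg_comp _ _ xl (Ck_continuous Cu Uz)).
rewrite [nseq n.+1 y]/= -[X in q X]/(iter_dderive (dderive y _) (nseq n y) x).
rewrite (iter_dderive_eq _ oU e) ?inE// (iter_dderive_lin hF _ oU) ?inE//; last 2 first.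
- by rewrite size_nseq; exact: (Ck_below C1 (leqnn n)).
- by rewrite size_nseq; exact: (Ck_below C2 (leqnn n)).
rewrite scale1r exprS -mulrA mulr_natl mulr2n.
apply: le_trans (cseminormD _ _ _) _; apply: lerD.
  apply: IH => // i i_n; have := h i.+1; rewrite ltnS subSS => /(_ i_n); exact.
apply: IH => // i i_n; have := h i (leqW i_n); by rewrite subSn.
Qed.

End leibniz.

(** * Smooth steps and B-splines *)

Section smooth_functions_of_one_variable.
Context {R : realType}.
Implicit Types (f g : R -> R) (t v : R).

Lemma is_derive_is_dderive f t v l : is_derive t 1 f l ->
  @is_dderive R R^o R^o f t v (v * l).
Proof.
move=> [fd fl]; rewrite -[v]mulr1 -[v * 1 * l]mulrA mul1r.
apply: (@dquotient_cvgZ R R^o R^o f t v 1 l).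
have : h^-1 *: ((f \o shift t) (h *: 1) - f t) @[h --> (0 : R)^'] --> (l : R).
  by rewrite -fl; apply: fd.
apply: cvg_trans; apply: near_eq_cvg; apply: nearW => h.
by rewrite /dquotient /= [t + _]addrC.
Qed.

Lemma is_derive_continuous f t l : is_derive t 1 f l -> {for t, continuous f}.
Proof. by move=> [fd _]; apply: differentiable_continuous; exact/derivable1_diffP. Qed.

Lemma CkS_of_is_derive n f g : (forall t, is_derive t 1 f (g t)) ->
  Ck (Some n) setT (g : R^o -> R^o) -> Ck (Some n.+1) setT (f : R^o -> R^o).
Proof.
move=> fg Cg; have oT : open [set: R^o] by exact: openT.
apply/(CkS Ro_hausdorff) => //; split=> [t _|t v _|].
- exact: is_derive_continuous (fg t).
- by exists (v * g t); exact: is_derive_is_dderive.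
have oTT := open_setXT oT.
apply: (@Ck_eq _ _ _ _ (fun p : R^o * R^o => ((g \o fst) p : R) *: (p.2 : R^o))) => //.
  move=> [t v] _; rewrite /differential /=.
  rewrite (dderive_eq Ro_hausdorff (is_derive_is_dderive (v := v) (fg t))).
  exact: mulrC.
apply: (Ck_scale (prod_hausdorff Ro_hausdorff Ro_hausdorff) Ro_hausdorff oTT).
  exact: (Ck_comp_fst Ro_hausdorff Ro_hausdorff Ro_hausdorff oT Cg).
by apply: (Ck_linear _ Ro_hausdorff) => // p; exact: cvg_snd.
Qed.

(** The factor [t^-1 ^+ k] closes the family under differentiation, up to linear combinations, so
    that one induction on the order shows all its members smooth. *)
Definition flat_exp k t : R := if 0 < t then t^-1 ^+ k * expR (- t^-1) else 0.

Lemma flat_exp_le0 k t : t <= 0 -> flat_exp k t = 0.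
Proof. by rewrite /flat_exp ltNge => ->. Qed.

Lemma flat_exp_ge0 k t : 0 <= flat_exp k t.
Proof.
rewrite /flat_exp; case: ifPn => // t0.
by rewrite mulr_ge0 ?expR_ge0// exprn_ge0// invr_ge0 ltW.
Qed.

Lemma flat_exp_gt0 k t : 0 < t -> 0 < flat_exp k t.
Proof.
by move=> t0; rewrite /flat_exp t0 mulr_gt0 ?expR_gt0// exprn_gt0// invr_gt0.
Qed.

(** A single term of the exponential series bounds [expR t^-1] from below. A bound linear in [t]
    suffices: the difference quotient of [flat_exp k] at 0 is [flat_exp k.+1], which thus tends to
    0. *)
Lemma flat_exp_bound k t : 0 <= t -> flat_exp k t <= (k.+1)`!%:R * t.
Proof.
rewrite le_eqVlt => /predU1P[<-|t0]; first by rewrite flat_exp_le0// mulr0.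
rewrite /flat_exp t0 expRN ler_pdivrMr ?expR_gt0//.
have := @expR_ge1Dxn R t^-1 k; rewrite invr_ge0 => /(_ (ltW t0)).
set T := t^-1 ^+ k.+1 / _ => h.
have : T <= expR t^-1 by apply: le_trans h; rewrite lerDr.
rewrite -(ler_pM2l (_ : 0 < (k.+1)`!%:R * t)) ?mulr_gt0 ?ltr0n ?fact_gt0//.
apply: le_trans; rewrite /T exprS mulrACA [_%:R * _]mulrC.
rewrite le_eqVlt; apply/orP; left; apply/eqP; field.
by rewrite pnatr_eq0 -lt0n fact_gt0 gt_eqF.
Qed.

Lemma is_dderive_is_derive f t l : @is_dderive R R^o R^o f t 1 l -> is_derive t 1 f l.
Proof.
move=> fl.
have h1 : h^-1 *: ((f \o shift t) (h *: 1) - f t) @[h --> (0 : R)^'] --> (l : R).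
  apply: cvg_trans fl; apply: near_eq_cvg; apply: nearW => h.
  by rewrite /dquotient /= [t + _]addrC.
apply: DeriveDef; first by apply/cvg_ex; exists l.
exact: cvg_lim h1.
Qed.

Lemma expR_Ck : Ck None setT (expR : R^o -> R^o).
Proof.
apply/Ck_NoneP; elim=> [|n IH]; first by apply/Ck0P => t _; exact: continuous_expR.
exact: (CkS_of_is_derive (fun t => is_derive_expR t)).
Qed.

Lemma is_derive_inv t : t != 0 -> is_derive t 1 (fun s : R => s^-1) (- t ^- 2).
Proof.
move=> t0; apply: DeriveDef; first exact: derivableV.
by rewrite deriveV// derive_id; exact: mulr1.
Qed.

Let is_derive_flat_exp_gt0 k t : 0 < t ->
  is_derive t 1 (flat_exp k) (flat_exp k.+2 t - k%:R * flat_exp k.+1 t).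
Proof.
move=> t0; have t_neq0 : t != 0 by rewrite gt_eqF.
apply: is_dderive_is_derive.
have dinv := is_derive_inv t_neq0.
have da : @is_dderive R R^o R^o (fun s => s^-1 ^+ k) t 1
    (1 * ((k%:R * t^-1 ^+ k.-1) *: - t ^- 2)).
  apply: is_derive_is_dderive.
  rewrite (_ : (fun s => s^-1 ^+ k) = (fun s => s^-1) ^+ k); first exact: is_deriveX.
  by apply/funext => s; elim: k => // k IH; rewrite !exprS fctE -IH.
have dN : @is_dderive R R^o R^o (fun s => - s^-1) t 1 (1 * t ^- 2).
  apply: is_derive_is_dderive; rewrite -[t ^- 2]opprK.
  exact: (is_deriveN dinv).
have C1 : Ck (Some 1) setT (expR : R^o -> R^o) by have /Ck_NoneP := expR_Ck.
have du : @is_dderive R R^o R^o (fun s => expR (- s^-1)) t 1 (t ^- 2 * expR (- t^-1)).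
  have oT : open [set: R^o] by exact: openT.
  have := is_dderive_comp (x := t) Ro_hausdorff Ro_hausdorff oT C1 I dN.
  rewrite (dderive_eq Ro_hausdorff (is_derive_is_dderive (v := 1 * t ^- 2) (is_derive_expR _))).
  by rewrite mul1r.
have cu : expR (- (t + h *: 1)^-1) @[h --> (0 : R)^'] --> expR (- t^-1).
  have c1 : t + h *: 1 @[h --> (0 : R)^'] --> t := @line_cvg R R^o t 1.
  have c2 : - (t + h *: 1)^-1 @[h --> (0 : R)^'] --> - t^-1.
    by apply: (@cvgN _ R^o); exact: cvgV.
  by apply: (cvg_comp _ _ c2); exact: continuous_expR.
have dau := is_dderive_scale da du cu.
pose U : set R^o := [set s : R | 0 < s].
have oU : open U by exact: open_gt.
have e : {in U, (fun s : R^o => (s^-1 ^+ k : R) *: (expR (- s^-1) : R^o)) =1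
    (flat_exp k : R^o -> R^o)} by move=> s /[!inE] s0; rewrite /flat_exp s0.
have := dquotient_local oU t0 e dau.
rewrite [X in _ --> X -> _](_ : _ = flat_exp k.+2 t - k%:R * flat_exp k.+1 t)//.
rewrite /flat_exp t0 -exprVn; set u := t^-1; set E := expR _.
rewrite -[LHS]/((1 * ((k%:R * u ^+ k.-1) * - u ^+ 2)) * E + u ^+ k * (u ^+ 2 * E)).
by case: (k) => [|n] /=; rewrite ?exprS; ring.
Qed.

Lemma is_derive_flat_exp k t :
  is_derive t 1 (flat_exp k) (flat_exp k.+2 t - k%:R * flat_exp k.+1 t).
Proof.
have [t0|t0|->] := ltgtP t 0; last 1 first.
- apply: is_dderive_is_derive; rewrite !flat_exp_le0// mulr0 subrr.
  have : (flat_exp k.+1 h : R) @[h --> (0 : R)^'] --> (0 : R).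
    apply/cvgrPdist_le => /= e e0; pose C : R := (k.+2)`!%:R.
    have C0 : 0 < C by rewrite ltr0n fact_gt0.
    have : \forall h \near (0 : R), `|h| <= e / C.
      apply/nbhs_ballP; exists (e / C); first by rewrite /= divr_gt0.
      by move=> h /=; rewrite /ball/= sub0r normrN => /ltW.
    move=> /nbhs_dnbhs; apply: filterS => h hh.
    rewrite sub0r normrN ger0_norm ?flat_exp_ge0//.
    have [h0|h0] := leP h 0; first by rewrite flat_exp_le0// ltW.
    apply: le_trans (flat_exp_bound _ (ltW h0)) _.
    by rewrite -ler_pdivlMl// mulrC -(gtr0_norm h0).
  apply: cvg_trans; apply: near_eq_cvg; apply: nearW => h.
  rewrite /dquotient add0r [h *: 1]mulr1 (@flat_exp_le0 _ 0)// subr0 /flat_exp.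
  case: ifP => [h0|_]; last by rewrite scaler0.
  by rewrite exprS -mulrA.
- pose U : set R^o := [set s : R | s < 0].
  have oU : open U by exact: open_lt.
  have e : {in U, (fun _ : R^o => (0 : R^o)) =1 (flat_exp k : R^o -> R^o)}.
    by move=> s /[!inE] /ltW s0; rewrite flat_exp_le0.
  apply: is_dderive_is_derive; rewrite !flat_exp_le0 ?ltW// mulr0 subrr.
  exact: (dquotient_local oU t0 e (is_dderive_cst _ _ 0)).
- exact: is_derive_flat_exp_gt0.
Qed.

Lemma flat_exp_Ck k : Ck None setT (flat_exp k : R^o -> R^o).
Proof.
have oT : open [set: R^o] by exact: openT.
apply/Ck_NoneP => n; elim: n k => [|n IH] k.
  by apply/Ck0P => t _; exact: is_derive_continuous (is_derive_flat_exp k t).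
apply: (CkS_of_is_derive (is_derive_flat_exp k)).
have := Ck_lin Ro_hausdorff (- k%:R) oT (IH k.+1) (IH k.+2).
apply: Ck_eq => // t _; rewrite !fctE addrC; congr (_ + _).
by rewrite -mulNr.
Qed.

End smooth_functions_of_one_variable.

Section smooth_steps.
Context {R : realType}.
Implicit Types (f g S : R -> R) (t : R).

Lemma antiderivative f : continuous f -> (forall t, t <= 0 -> f t = 0) ->
  exists2 P : R -> R, forall t, t <= 0 -> P t = 0 & forall t, is_derive t 1 P (f t).
Proof.
(* The starting point is negative, where [f] vanishes; this puts every [t >= 0] in the interior of
   an interval of integration. *)
move=> cf f0; pose P x := (\int[@lebesgue_measure R]_(t in [set` `[-1, x]]) (f t))%R.
have P0 t : t <= 0 -> P t = 0.
  move=> t0; rewrite /P /Rintegral integral0_eq//= => x; rewrite in_itv/= => /andP[_ xt].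
  by rewrite f0// (le_trans xt).
exists P => // t; have [t0|t0] := ltP t 0.
  have oU : open [set s : R^o | (s : R) < 0] by exact: open_lt.
  have e : {in [set s : R^o | (s : R) < 0], (fun _ : R^o => (0 : R^o)) =1 (P : R^o -> R^o)}.
    by move=> s /[!inE] /ltW s0; rewrite P0.
  apply: is_dderive_is_derive; rewrite f0 ?ltW//.
  exact: (dquotient_local oU t0 e (is_dderive_cst _ _ 0)).
have tt1 : t < t + 1 by rewrite ltrDl.
have int : (@lebesgue_measure R).-integrable `[-1, t + 1] (EFin \o f).
  apply: continuous_compact_integrable; first exact: segment_compact.
  exact: continuous_subspaceT.
have t1 : -1 < t by rewrite (lt_le_trans _ t0)// ltrN10.
have [Pd Pl] := continuous_FTC1_closed tt1 int t1 (cf t).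
by apply: DeriveDef; [exact: Pd|rewrite -derive1E; exact: Pl].
Qed.

Lemma is_derive_ge0_homo f g : (forall t, is_derive t 1 f (g t)) ->
  (forall t, 0 <= g t) -> {homo f : x y / x <= y}.
Proof.
move=> fg g0 x y xy.
have [|c _ e] := MVT_segment xy (fun t _ => fg t).
  by apply: continuous_subspaceT => t; exact: is_derive_continuous (fg t).
by rewrite -subr_ge0 e mulr_ge0// subr_ge0.
Qed.

(** The steps are built so that [S_{m+1}(t) = P(t) - P(t-1)] with [P' = S_m]; the
    derivative of the spline [bspline S m.+1] is then a difference of splines of
    order [m], which is what makes derivatives of averages computable. *)
Record is_step (m : nat) S : Prop := IsStep {
  step_smooth : Ck None setT (S : R^o -> R^o);
  step_le0 : forall t, t <= 0 -> S t = 0;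
  step_ge1 : forall t, m.+1%:R <= t -> S t = 1;
  step_homo : {homo S : x y / x <= y} }.

Lemma Ck_None_continuous f : Ck None setT (f : R^o -> R^o) -> continuous f.
Proof. by move=> Cf t; exact: (Ck_continuous Cf I). Qed.

Lemma Ck_antiderivative f g : (forall t, is_derive t 1 f (g t)) ->
  Ck None setT (g : R^o -> R^o) -> Ck None setT (f : R^o -> R^o).
Proof.
move=> fg Cg; apply/Ck_NoneP => -[|n].
  by apply/Ck0P => t _; exact: is_derive_continuous (fg t).
by apply: (CkS_of_is_derive fg); have /Ck_NoneP := Cg; exact.
Qed.

Lemma Ck_affine1 (a b : R) : Ck None setT ((fun t => a * t + b) : R^o -> R^o).
Proof.
have oT : open [set: R^o] by exact: openT.
have C1 : Ck None setT ((fun t => a * t) : R^o -> R^o).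
  apply: (Ck_linear _ Ro_hausdorff) => //; last exact: mulrl_continuous.
  by move=> c x y; rewrite -[c *: x]/(c * x) mulrDr mulrCA.
have C2 : Ck None setT ((fun=> b) : R^o -> R^o) by exact: (Ck_cst _ Ro_hausdorff).
have := Ck_lin Ro_hausdorff 1 oT C1 C2; apply: Ck_eq => // t _.
by rewrite !fctE scale1r.
Qed.

Lemma Ck_comp_affine1 f (a b : R) : Ck None setT (f : R^o -> R^o) ->
  Ck None setT ((fun t => f (a * t + b)) : R^o -> R^o).
Proof.
have oT : open [set: R^o] by exact: openT.
move=> Cf; exact: (Ck_comp Ro_hausdorff Ro_hausdorff Ro_hausdorff oT oT _ (Ck_affine1 a b) Cf).
Qed.

Lemma Ck_shift1 f : Ck None setT (f : R^o -> R^o) ->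
  Ck None setT ((fun t => f t - f (t - 1)) : R^o -> R^o).
Proof.
move=> Cf; have oT : open [set: R^o] by exact: openT.
have := Ck_lin Ro_hausdorff (-1) oT (Ck_comp_affine1 1 (-1) Cf) Cf.
by apply: Ck_eq => // t _; rewrite !fctE scaleN1r mul1r addrC.
Qed.

Lemma is_derive_shift1 f g t : (forall t, is_derive t 1 f (g t)) ->
  is_derive t 1 (fun t => f t - f (t - 1)) (g t - g (t - 1)).
Proof.
move=> fg.
have h1 : is_derive t 1 (fun s => f (s - 1)) (g (t - 1)).
  apply: is_dderive_is_derive; rewrite /is_dderive.
  rewrite (_ : dquotient _ _ _ = @dquotient R R^o R^o f (t - 1) 1).
    by rewrite -[g _]mul1r; exact: (is_derive_is_dderive (fg (t - 1))).
  by apply/funext => h; rewrite /dquotient addrAC.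
have h2 := fg t.
exact: is_deriveB.
Qed.

(** The normalised antiderivative of the bump [flat_exp 0 t * flat_exp 0 (1 - t)], which lives on
    [0, 1]. *)
Lemma step0 : exists S, is_step 0 S.
Proof.
have oT : open [set: R^o] by exact: openT.
pose b t : R := flat_exp 0 t * flat_exp 0 (1 - t).
have Cb : Ck None setT (b : R^o -> R^o).
  have C1 : Ck None setT ((fun t => flat_exp 0 (1 - t)) : R^o -> R^o).
    have := Ck_comp_affine1 (-1) 1 (flat_exp_Ck 0); apply: Ck_eq => // t _.
    by rewrite mulN1r addrC.
  exact: (Ck_scale Ro_hausdorff Ro_hausdorff oT (flat_exp_Ck 0) C1).
have b_ge0 t : 0 <= b t by rewrite mulr_ge0// flat_exp_ge0.
have b_le0 t : t <= 0 -> b t = 0 by move=> t0; rewrite /b flat_exp_le0// mul0r.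
have b_ge1 t : 1 <= t -> b t = 0.
  by move=> t1; rewrite /b [X in _ * X]flat_exp_le0 ?subr_le0//; exact: mulr0.
have [P P0 dP] := antiderivative (Ck_None_continuous Cb) b_le0.
have P_homo := is_derive_ge0_homo dP b_ge0.
have P1 t : 1 <= t -> P t = P 1.
  move=> t1; have [|c] := MVT_segment t1 (fun t _ => dP t).
    by apply: continuous_subspaceT => s; exact: is_derive_continuous (dP s).
  by rewrite in_itv/= => /andP[c1 _]; rewrite b_ge1// mul0r => /eqP; rewrite subr_eq0 => /eqP.
have P1_gt0 : 0 < P 1.
  rewrite lt_neqAle -{2}(P0 0)// P_homo// andbT; apply/negP => /eqP P10.
  pose x : R := 1 / 2.
  have x01 : 0 < x < 1 by rewrite divr_gt0//= ltr_pdivrMr// mul1r ltr1n.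
  have [x0 x1] := andP x01.
  have : P 0 < P x.
    have cP : {within `[0, x], continuous P}.
      by apply: continuous_subspaceT => s; exact: is_derive_continuous (dP s).
    have [c + e] := MVT x0 (fun t _ => dP t) cP.
    rewrite in_itv/= => /andP[c0 cx].
    rewrite -subr_gt0 e mulr_gt0 ?subr_gt0// /b mulr_gt0 ?flat_exp_gt0//.
    by rewrite subr_gt0 (lt_trans cx).
  by rewrite P0// ltNge P10 P_homo// ltW.
exists (fun t => (P 1)^-1 * P t); split.
- have CP := Ck_antiderivative dP Cb.
  have := Ck_lin Ro_hausdorff (P 1)^-1 oT CP (Ck0 Ro_hausdorff None setT).
  by apply: Ck_eq => // t _; rewrite !fctE addr0.
- by move=> t t0; rewrite (P0 t t0) mulr0.
- by move=> t t1; rewrite (P1 t t1) mulVf// gt_eqF.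
- by move=> x y xy; rewrite ler_pM2l ?invr_gt0// P_homo.
Qed.

(** [S' t] is the mean of [S] over the interval from [t - 1] to [t]; taking it widens the rise by
    one unit. *)
Lemma stepS m S : is_step m S -> exists2 S', is_step m.+1 S' &
  forall t, is_derive t 1 S' (S t - S (t - 1)).
Proof.
move=> [CS S0 S1 S_homo].
have [P P0 dP] := antiderivative (Ck_None_continuous CS) S0.
pose S' t := P t - P (t - 1).
have dS' t : is_derive t 1 S' (S t - S (t - 1)) by exact: is_derive_shift1.
exists S' => //; split.
- by apply: Ck_shift1; exact: Ck_antiderivative dP CS.
- by move=> t t0; rewrite /S' !P0 ?subrr// lerBlDr (le_trans t0).
- move=> t tm; have t1 : t - 1 <= t by rewrite lerBlDr lerDl.
  have [|c + e] := MVT_segment t1 (fun t _ => dP t).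
    by apply: continuous_subspaceT => s; exact: is_derive_continuous (dP s).
  rewrite in_itv/= => /andP[c1 _]; rewrite /S' e opprB addrC subrK mulr1 S1//.
  by apply: le_trans c1; rewrite lerBrDr natr1.
- apply: (is_derive_ge0_homo dS') => t.
  by rewrite subr_ge0 S_homo// lerBlDr lerDl.
Qed.

Lemma steps : exists S : nat -> R -> R, (forall m, is_step m (S m)) /\
  forall m t, is_derive t 1 (S m.+1) (S m t - S m (t - 1)).
Proof.
have [S0 hS0] := step0.
have h (m : nat) (S : {S | is_step m S}) : {S' : {S' | is_step m.+1 S'} |
    forall t, is_derive t 1 (sval S') (sval S t - sval S (t - 1))}.
  apply: cid; case: S => S hS; have [S' hS' dS'] := stepS hS.
  by exists (exist _ S' hS').
pose s := fix s m : {S | is_step m S} := if m is k.+1 then sval (h k (s k)) else exist _ S0 hS0.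
exists (fun m => sval (s m)); split=> [m|m t]; first exact: svalP (s m).
exact: svalP (h m (s m)) t.
Qed.

End smooth_steps.

Lemma is_dderive_Zl {R : realType} (V F : tvsType R) (a : V -> R^o) (c : F) x v (l : R) :
  @is_dderive R V R^o a x v l -> is_dderive (fun y : V => (a y : R) *: c) x v (l *: c).
Proof.
move=> al; rewrite -[l *: c]addr0 -[X in _ + X](scaler0 _ (a x)).
apply: is_dderive_scale; [exact: al|exact: is_dderive_cst|exact: cvg_cst].
Qed.

(** For a step this is a nonnegative bump on [[0, m + 2]] whose integer translates add up to 1 by
    telescoping: a smooth substitute for the uniform B-spline. *)
Definition bspline {R : realType} (S : nat -> R -> R) (m : nat) (t : R) : R :=
  S m t - S m (t - 1).

Section bsplines.
Context {R : realType}.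
Variable S : nat -> R -> R.
Hypothesis S_step : forall m, is_step m (S m).
Hypothesis S_derive : forall m (t : R), is_derive t 1 (S m.+1) (S m t - S m (t - 1)).

Lemma bspline_ge0 m t : 0 <= bspline S m t.
Proof. by rewrite subr_ge0; apply: (step_homo (S_step m)); rewrite lerBlDr lerDl. Qed.

Lemma bspline_le0 m t : t <= 0 -> bspline S m t = 0.
Proof.
move=> t0; rewrite /bspline !(step_le0 (S_step m)) ?subrr//.
by rewrite lerBlDr (le_trans t0).
Qed.

Lemma bspline_ge m t : m.+2%:R <= t -> bspline S m t = 0.
Proof.
move=> t0; rewrite /bspline !(step_ge1 (S_step m)) ?subrr//.
  by rewrite lerBrDr natr1.
by rewrite (le_trans _ t0)// ler_nat.
Qed.

Lemma bspline_Ck m : Ck None setT (bspline S m : R^o -> R^o).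
Proof. exact: Ck_shift1 (step_smooth (S_step m)). Qed.

Lemma is_derive_bspline m (t : R) :
  is_derive t 1 (bspline S m.+1) (bspline S m t - bspline S m (t - 1)).
Proof. exact: (@is_derive_shift1 _ (S m.+1) (bspline S m) t (S_derive m)). Qed.

Lemma bspline_sum m n t : m.+1%:R <= t <= n%:R ->
  \sum_(k < n) bspline S m (t - k%:R) = 1.
Proof.
move=> /andP[t1 t2].
rewrite -(big_mkord xpredT (fun k => bspline S m (t - k%:R))).
transitivity (\sum_(0 <= k < n) - (S m (t - k.+1%:R) - S m (t - k%:R))).
  apply: eq_bigr => k _; rewrite /bspline opprB; congr (_ - S m _).
  by rewrite -natr1 opprD addrA.
rewrite sumrN telescope_sumr// opprB subr0 (step_ge1 (S_step m))//.
by rewrite (step_le0 (S_step m)) ?subr0// subr_le0.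
Qed.

End bsplines.

Section coordinates.
Context {R : realType} {d : nat}.
Local Notation E := 'rV[R]_d.
Implicit Types (x y : E) (i j : 'I_d).

Definition set_coord i (a : R) x : E := \row_j (if j == i then a else x ord0 j).

Definition basis_vec i : E := delta_mx ord0 i.

Lemma set_coordE i a x j : set_coord i a x ord0 j = if j == i then a else x ord0 j.
Proof. by rewrite mxE. Qed.

Lemma basis_vecE i j : basis_vec i ord0 j = (j == i)%:R.
Proof. by rewrite mxE eqxx. Qed.

Lemma set_coord_add i j a x (h : R) : j != i ->
  set_coord i a (x + h *: basis_vec j) = set_coord i a x + h *: basis_vec j.
Proof.
move=> ji; apply/rowP => k; rewrite !(mxE, eqxx)/=.
by case: (eqVneq k i) => // e; rewrite e eq_sym (negbTE ji) mulr0 addr0.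
Qed.

Lemma set_coord_same i a x (h : R) :
  set_coord i a (x + h *: basis_vec i) = set_coord i a x.
Proof.
apply/rowP => k; rewrite !(mxE, eqxx)/=.
by case: (eqVneq k i) => // e; rewrite mulr0 addr0.
Qed.

Lemma set_coord_sub i a x (h : R) :
  set_coord i a x - h *: basis_vec i = set_coord i (a - h) x.
Proof.
apply/rowP => k; rewrite !(mxE, eqxx)/=.
by case: (eqVneq k i) => e; rewrite ?mulr1// mulr0 subr0.
Qed.

Lemma row_basis x : x = \sum_i x ord0 i *: basis_vec i.
Proof. exact: row_sum_delta. Qed.

Lemma row_hausdorff : hausdorff_space (E : tvsType R).
Proof. exact: norm_hausdorff. Qed.

End coordinates.

(** * Approximation by spline averages *)

Section averaging.
Context {R : realType} {d : nat} {F : tvsType R}.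
Local Notation E := 'rV[R]_d.
Hypothesis hF : hausdorff_space F.
Variable S : nat -> R -> R.
Hypothesis S_step : forall m, is_step m (S m).
Hypothesis S_derive : forall m (t : R), is_derive t 1 (S m.+1) (S m t - S m (t - 1)).
Variables (L : nat) (delta : R).
Hypothesis delta0 : 0 < delta.
Implicit Types (g h : E -> F) (x y : E) (i j : 'I_d) (m : nat).

(** In units of [delta], the nodes run from [-L] to [L]. *)
Definition node (k : nat) : R := k%:R - L%:R.

(** For [avg_dom], the splines occurring in the finite sum form a partition of
    unity. No integral is involved, so that [F] need not be complete, and nothing
    is required of [g]. *)
Definition avg i m g x : F :=
  \sum_(k < (2 * L).+1) bspline S m (x ord0 i / delta - node k) *:
    g (set_coord i (delta * node k) x).

Definition backward_diff i g x : F := delta^-1 *: (g x - g (x - delta *: basis_vec i)).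

(** The margin [m + 2] from the outermost nodes is the width of a spline: no spline that meets the
    point is missing from the sum. *)
Definition avg_dom m i x := `|x ord0 i| < delta * (L%:R - m.+2%:R).

Lemma avg_domP m i x : avg_dom m i x ->
  - (L%:R - m.+2%:R) < x ord0 i / delta < L%:R - m.+2%:R.
Proof.
by rewrite /avg_dom -ltr_pdivrMl// mulrC -(gtr0_norm delta0) -normf_div
  (gtr0_norm delta0) ltr_norml.
Qed.

Lemma avg_dom_leq m m' i x : (m' <= m)%N -> avg_dom m i x -> avg_dom m' i x.
Proof.
move=> mm'; rewrite /avg_dom => /lt_le_trans; apply.
by rewrite ler_pM2l// lerB// ler_nat.
Qed.

Lemma bspline_node_neq0 m (a : R) k : bspline S m (a / delta - node k) != 0 ->
  `|delta * node k - a| <= m.+2%:R * delta.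
Proof.
move=> h; have [h0|h0] := leP (a / delta - node k) 0.
  by rewrite bspline_le0 ?eqxx in h.
have [h1|h1] := leP m.+2%:R (a / delta - node k).
  by rewrite bspline_ge ?eqxx in h.
have -> : delta * node k - a = - (delta * (a / delta - node k)).
  have e : delta * (a / delta) = a by rewrite mulrCA mulfV ?gt_eqF// mulr1.
  by rewrite (mulrBr delta (a / delta)) e opprB.
by rewrite normrN gtr0_norm ?mulr_gt0// mulrC ler_pM2r// ltW.
Qed.

Lemma avg_weights m i x : avg_dom m i x ->
  \sum_(k < (2 * L).+1) bspline S m (x ord0 i / delta - node k) = 1.
Proof.
move=> /avg_domP/andP[t1 t2].
under eq_bigr do rewrite /node opprB addrA.
under eq_bigr => k _ do rewrite -[_ + L%:R - k%:R]/(x ord0 i / delta + L%:R - k%:R).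
apply: bspline_sum => //; apply/andP; split.
  have : (m.+1%:R : R) <= m.+2%:R by rewrite ler_nat.
  by move: t1; lra.
rewrite mul2n -addnn -natr1 natrD.
have : (0 : R) <= m.+2%:R by [].
by move: t2; lra.
Qed.

(** The average is a convex combination of values of [g] at nodes near [x]. This serves for
    convergence and, with [v] equal to 0, for bounds. *)
Lemma avg_close m i g x v (q : cseminorm F) (b : R) : avg_dom m i x ->
  (forall a, `|a - x ord0 i| <= m.+2%:R * delta -> q (g (set_coord i a x) - v) <= b) ->
  q (avg i m g x - v) <= b.
Proof.
move=> xm gb; have w1 := avg_weights xm.
rewrite -[v]scale1r -w1 scaler_suml -sumrB.
apply: le_trans (cseminorm_sum _ _ _ _) _.
rewrite -[leRHS]mul1r -w1 mulr_suml; apply: ler_sum => k _.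
rewrite -scalerBr cseminormZ ger0_norm ?bspline_ge0//.
have [->|h] := eqVneq (bspline S m (x ord0 i / delta - node k)) 0.
  by rewrite !mul0r.
rewrite ler_wpM2l ?bspline_ge0//; apply: gb; exact: bspline_node_neq0 h.
Qed.

Lemma avg_eq0 m i g x :
  (forall a, `|a - x ord0 i| <= m.+2%:R * delta -> g (set_coord i a x) = 0) ->
  avg i m g x = 0.
Proof.
move=> g0; rewrite /avg big1// => k _.
have [->|h] := eqVneq (bspline S m (x ord0 i / delta - node k)) 0.
  by rewrite scale0r.
by rewrite g0 ?scaler0//; exact: bspline_node_neq0 h.
Qed.

(** Summation by parts: the derivative of a spline of order [m.+1] is a difference of neighbouring
    splines of order [m], and an index shift moves the difference onto [g]. The two end terms vanish
    thanks to the margin in [avg_dom]. *)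
Lemma is_dderive_avg_same m i g x : avg_dom m.+1 i x ->
  is_dderive (avg i m.+1 g) x (basis_vec i) (avg i m (backward_diff i g) x).
Proof.
move=> xm; set t := x ord0 i / delta.
have [t1 t2] := andP (avg_domP xm); rewrite -/t in t1 t2.
pose G (a : R) := g (set_coord i (delta * (a - L%:R)) x).
have dphi (k : nat) : is_dderive (fun y : E => bspline S m.+1 (y ord0 i / delta - node k) : R^o)
    x (basis_vec i) (delta^-1 * (bspline S m (t - node k) - bspline S m (t - node k - 1))).
  have := is_derive_is_dderive (v := delta^-1) (is_derive_bspline S_derive m (t - node k)).
  rewrite /is_dderive.
  rewrite (_ : dquotient _ _ _ = dquotient (fun y : E =>
    bspline S m.+1 (y ord0 i / delta - node k) : R^o) x (basis_vec i))//.
  apply/funext => h; rewrite /dquotient; congr (_ *: (bspline S m.+1 _ - _)).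
  rewrite !(mxE, eqxx)/= mulr1 mulrDl /t -[h *: _]/(h * _).
  by rewrite addrAC.
have h1 : is_dderive (avg i m.+1 g) x (basis_vec i) (\sum_(k < (2 * L).+1)
    (delta^-1 * (bspline S m (t - node k) - bspline S m (t - node k - 1))) *: G k%:R).
  have := is_dderive_sum (r := index_enum 'I_(2 * L).+1) (fun k : 'I_(2 * L).+1 =>
    is_dderive_Zl (c := G k%:R) (dphi k)).
  rewrite /is_dderive (_ : dquotient _ _ _ = dquotient (avg i m.+1 g) x (basis_vec i))//.
  apply/funext => h; rewrite /dquotient; congr (_ *: (_ - _)); apply: eq_bigr => k _ //.
  by rewrite /G set_coord_same.
suff -> : avg i m (backward_diff i g) x = \sum_(k < (2 * L).+1)
    (delta^-1 * (bspline S m (t - node k) - bspline S m (t - node k - 1))) *: G k%:R by [].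
pose c (k : nat) := bspline S m (t - node k) *: G (k%:R - 1).
have cS (k : nat) : bspline S m (t - node k - 1) *: G k%:R = c k.+1.
  rewrite /c -natr1 addrK /node -natr1; congr (bspline S m _ *: _).
  by rewrite -addrA -opprD addrAC.
have c0 : c 0%N = 0.
  rewrite /c /node sub0r opprK bspline_ge ?scale0r//.
  have : (m.+2%:R : R) <= m.+3%:R by rewrite ler_nat.
  by move: t1; lra.
have cL : c (2 * L).+1 = 0.
  rewrite /c /node bspline_le0 ?scale0r// mul2n -addnn -natr1 natrD.
  have : (0 : R) <= m.+3%:R by [].
  by move: t2; lra.
transitivity (delta^-1 *: (\sum_(k < (2 * L).+1) bspline S m (t - node k) *: G k%:R -
    \sum_(k < (2 * L).+1) c k)).
  rewrite -sumrB scaler_sumr; apply: eq_bigr => k _.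
  rewrite /backward_diff set_coord_sub scalerA mulrC -scalerA -/t; congr (_ *: _).
  rewrite scalerBr; congr (_ *: _ - _ *: g (set_coord i _ x)).
  by rewrite /node; ring.
have -> : \sum_(k < (2 * L).+1) c k = \sum_(k < (2 * L).+1) c k.+1.
  by rewrite [LHS]big_ord_recl [RHS]big_ord_recr /= c0 cL add0r addr0.
rewrite -sumrB scaler_sumr; apply: eq_bigr => k _.
by rewrite -cS -scalerBl scalerA.
Qed.

Lemma is_dderive_avg_other m i j g dg x : j != i ->
  (forall a, is_dderive g (set_coord i a x) (basis_vec j) (dg (set_coord i a x))) ->
  is_dderive (avg i m g) x (basis_vec j) (avg i m dg x).
Proof.
move=> ji gd.
have h (k : 'I_(2 * L).+1) : is_dderive (fun y => bspline S m (y ord0 i / delta - node k) *: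
    g (set_coord i (delta * node k) y)) x (basis_vec j)
    (bspline S m (x ord0 i / delta - node k) *: dg (set_coord i (delta * node k) x)).
  have h0 : bspline S m (x ord0 i / delta - node k) *:
      dquotient g (set_coord i (delta * node k) x) (basis_vec j) s @[s --> (0 : R)^'] -->
      bspline S m (x ord0 i / delta - node k) *: dg (set_coord i (delta * node k) x).
    by apply: tvs_cvgZ; [exact: cvg_cst|exact: gd].
  apply: cvg_trans h0; apply: near_eq_cvg; apply: nearW => s.
  rewrite /dquotient set_coord_add// scalerA mulrC -scalerA scalerBr.
  by rewrite !(mxE, eqxx)/= eq_sym (negbTE ji) mulr0 addr0.
exact: (is_dderive_sum (r := index_enum _) h).
Qed.

Lemma backward_diff_avg m i j g : j != i ->
  backward_diff j (avg i m g) = avg i m (backward_diff j g).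
Proof.
move=> ji; apply/funext => x; rewrite /backward_diff /avg -sumrB scaler_sumr.
apply: eq_bigr => k _; rewrite -(scaleNr delta (basis_vec j)) set_coord_add//.
rewrite !(mxE, eqxx)/= eq_sym (negbTE ji) mulr0 addr0.
by rewrite -scalerBr !scalerA mulrC.
Qed.

End averaging.

Lemma Ck_sum {R : realType} (V F : tvsType R) (hF : hausdorff_space F) (U : set V)
    (I : Type) (s : seq I) (f : I -> V -> F) (l : diff_order) :
  open U -> (forall i, Ck l U (f i)) -> Ck l U (fun p => \sum_(i <- s) f i p).
Proof.
move=> oU Cf; elim: s => [|i s IH].
  apply: (@Ck_eq _ _ _ _ (fun _ => 0)) => //; last exact: Ck_cst.
  by move=> p _; rewrite big_nil.
have := Ck_lin hF 1 oU (Cf i) IH; apply: Ck_eq => // p _.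
by rewrite !fctE scale1r big_cons.
Qed.

(** [m] assigns a spline order to every coordinate; a partial derivative in the [i]-th one uses up
    one order. *)
Definition decr {d : nat} (m : 'I_d -> nat) (i : 'I_d) : 'I_d -> nat :=
  fun j => if j == i then (m j).-1 else m j.

Section iterated_averages.
Context {R : realType} {d : nat} {F : tvsType R}.
Local Notation E := 'rV[R]_d.
Hypothesis hF : hausdorff_space F.
Variable S : nat -> R -> R.
Hypothesis S_step : forall m, is_step m (S m).
Hypothesis S_derive : forall m (t : R), is_derive t 1 (S m.+1) (S m t - S m (t - 1)).
Variables (L : nat) (delta : R).
Hypothesis delta0 : 0 < delta.
Implicit Types (g h : E -> F) (x y : E) (i j : 'I_d) (m : 'I_d -> nat) (r : seq 'I_d).

Definition avgs r m g : E -> F := foldr (fun i => avg S L delta i (m i)) g r.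

Lemma avgs_closeW M r m g x v (q : cseminorm F) (b : R) : (forall i, (m i <= M)%N) ->
  uniq r -> (forall i, i \in r -> avg_dom L delta M i x) ->
  (forall y, (forall i, `|y ord0 i - x ord0 i| <= M.+2%:R * delta) -> q (g y - v) <= b) ->
  q (avgs r m g x - v) <= b.
Proof.
move=> mM; have MR : 0 <= M.+2%:R * delta by rewrite mulr_ge0// ltW.
(* Strengthened for the induction: the averages do not move the coordinates outside [r']. *)
have H r' : uniq r' -> forall x, (forall i, i \in r' -> avg_dom L delta M i x) ->
  (forall y, (forall i, i \in r' -> `|y ord0 i - x ord0 i| <= M.+2%:R * delta) ->
     (forall i, i \notin r' -> y ord0 i = x ord0 i) -> q (g y - v) <= b) ->
  q (avgs r' m g x - v) <= b.
  elim: r' => [_ {}x _ h|j r' IH /= /andP[jr ur] {}x xM h]; first exact: h.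
  apply: (avg_close S_step delta0).
    by apply: (avg_dom_leq delta0 (mM j)); apply: xM; rewrite mem_head.
  move=> a ax; apply: IH => // [i ir|y y1 y2].
    have ij : (i == j) = false by apply: contraNF jr => /eqP <-.
    by rewrite /avg_dom set_coordE ij; apply: xM; rewrite inE ir orbT.
  apply: h => [i|i]; rewrite inE.
    have [->|ij]/= := eqVneq i j.
      move=> _; rewrite y2// set_coordE eqxx (le_trans ax)// ler_pM2r// ler_nat.
      by rewrite !ltnS mM.
    by move=> /y1; rewrite set_coordE (negbTE ij).
  by rewrite negb_or => /andP[ij /y2 ->]; rewrite set_coordE (negbTE ij).
move=> ur xM h; apply: H => // y y1 y2; apply: h => i.
by have [/y1//|/y2 ->] := boolP (i \in r); rewrite subrr normr0.
Qed.

Lemma avgs_eq0 M r m g x : (forall i, (m i <= M)%N) ->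
  uniq r -> (forall y, (forall i, `|y ord0 i - x ord0 i| <= M.+2%:R * delta) -> g y = 0) ->
  avgs r m g x = 0.
Proof.
move=> mM; have MR : 0 <= M.+2%:R * delta by rewrite mulr_ge0// ltW.
have H r' : uniq r' -> forall x,
  (forall y, (forall i, i \in r' -> `|y ord0 i - x ord0 i| <= M.+2%:R * delta) ->
     (forall i, i \notin r' -> y ord0 i = x ord0 i) -> g y = 0) ->
  avgs r' m g x = 0.
  elim: r' => [_ {}x h|j r' IH /= /andP[jr ur] {}x h]; first exact: h.
  apply: (avg_eq0 S_step _ delta0) => a ax; apply: IH => // y y1 y2.
  apply: h => [i|i]; rewrite inE.
    have [->|ij]/= := eqVneq i j.
      move=> _; rewrite y2// set_coordE eqxx (le_trans ax)// ler_pM2r// ler_nat.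
      by rewrite !ltnS mM.
    by move=> /y1; rewrite set_coordE (negbTE ij).
  by rewrite negb_or => /andP[ij /y2 ->]; rewrite set_coordE (negbTE ij).
move=> ur h; apply: H => // y y1 y2; apply: h => i.
by have [/y1//|/y2 ->] := boolP (i \in r); rewrite subrr normr0.
Qed.

Lemma backward_diff_avgs r m i g : i \notin r ->
  backward_diff delta i (avgs r m g) = avgs r m (backward_diff delta i g).
Proof.
elim: r => [//|j r IH]; rewrite inE negb_or => /andP[ij ir] /=.
by rewrite -IH// backward_diff_avg.
Qed.

Lemma avgs_decr r m i g : i \notin r -> avgs r (decr m i) g = avgs r m g.
Proof.
elim: r => [//|j r IH]; rewrite inE negb_or => /andP[ij ir] /=.
by rewrite IH// /decr eq_sym (negbTE ij).
Qed.

(** The averages outside the one in [i] let the derivative pass; those inside commute with the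
    backward difference that it creates. *)
Lemma is_dderive_avgs r m i g x : uniq r -> i \in r -> (0 < m i)%N ->
  avg_dom L delta (m i) i x ->
  is_dderive (avgs r m g) x (basis_vec i) (avgs r (decr m i) (backward_diff delta i g) x).
Proof.
elim: r x => [//|j r IH] x /= /andP[jr ur]; rewrite inE.
have [-> _|ij /= ir] := eqVneq i j.
  move=> mj xj; rewrite avgs_decr// -backward_diff_avgs// /decr eqxx.
  case: (m j) mj xj => // n _ xj.
  exact: (is_dderive_avg_same S_step S_derive delta0).
move=> mi xi; have -> : decr m i j = m j by rewrite /decr eq_sym (negbTE ij).
apply: is_dderive_avg_other => // a; apply: IH => //.
by rewrite /avg_dom set_coordE (negbTE ij).
Qed.

(** Smoothness of the averages in all variables jointly is obtained one variable
    at a time, the variables in [P] being held at the values given by [c]. *)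
Definition freeze (P : pred 'I_d) (c x : E) : E := \row_j (if P j then c ord0 j else x ord0 j).

Definition smooth_off (P : pred 'I_d) g := forall c, Ck None setT (g \o freeze P c).

Lemma coord_Ck i : Ck None setT (fun x => x ord0 i : R^o).
Proof.
apply: (Ck_linear _ Ro_hausdorff); last exact: openT.
  by move=> a x y; rewrite !mxE.
exact: coord_continuous.
Qed.

(** [g] is evaluated only with its [i]-th coordinate at a node, so the dependence on that coordinate
    is carried by the spline alone. *)
Lemma avg_smooth_off (P : pred 'I_d) i n g : smooth_off [pred j | (j == i) || P j] g ->
  smooth_off P (avg S L delta i n g).
Proof.
move=> gs c; have oT : open [set: E] by exact: openT.
apply: Ck_sum => // k.
apply: (Ck_scale row_hausdorff hF oT).
  case: (boolP (P i)) => Pi.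
    apply: (@Ck_eq _ _ _ _ (fun _ => bspline S n (c ord0 i / delta - node L k) : R^o)) => //.
      by move=> x _; rewrite /= mxE Pi.
    exact: (Ck_cst _ Ro_hausdorff).
  have := Ck_comp row_hausdorff Ro_hausdorff Ro_hausdorff oT openT (fun _ _ => I) (coord_Ck i)
    (Ck_comp_affine1 delta^-1 (- node L k) (bspline_Ck S_step n)).
  by apply: Ck_eq => // x _; rewrite /= mxE (negbTE Pi) mulrC.
have := gs (set_coord i (delta * node L k) c); apply: Ck_eq => // x _ /=.
congr (g _); apply/rowP => j; rewrite !mxE /=.
by case: eqP.
Qed.

Lemma avgs_smooth_off (P : pred 'I_d) r m g : smooth_off [pred j | (j \in r) || P j] g ->
  smooth_off P (avgs r m g).
Proof.
elim: r P => [//|i r IH] P gs /=; apply: avg_smooth_off; apply: IH => c.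
have := gs c; apply: Ck_eq; [exact: openT|] => x _ /=.
congr (g _); apply/rowP => j; rewrite !mxE /= inE.
by case: (j == i); case: (j \in r).
Qed.

End iterated_averages.

Section full_average.
Context {R : realType} {d : nat} {F : tvsType R}.
Local Notation E := 'rV[R]_d.
Hypothesis hF : hausdorff_space F.
Variable S : nat -> R -> R.
Hypothesis S_step : forall m, is_step m (S m).
Hypothesis S_derive : forall m (t : R), is_derive t 1 (S m.+1) (S m t - S m (t - 1)).
Implicit Types (g h : E -> F) (x y : E) (i j : 'I_d) (m : 'I_d -> nat) (L : nat) (delta : R).

Definition average L delta m g : E -> F := avgs S L delta (enum 'I_d) m g.

Definition average_dom L delta (M : nat) : set E := [set x | forall i, avg_dom L delta M i x].

Lemma row_coord_le x i : `|x ord0 i| <= `|x|.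
Proof.
rewrite [leRHS]mx_normE -[leLHS]nngE num_le.
exact: (le_bigmax _ (fun ij => `|x ij.1 ij.2|%:nng) (ord0, i)).
Qed.

Lemma row_norm_coord x : `|x| = 0 \/ exists i, `|x| = `|x ord0 i|.
Proof.
have [x0|x0] := eqVneq (mx_norm x) 0; first by left; exact: x0.
by right; have [[i j] /= e] := mx_norm_neq0 x0; exists j; rewrite (ord1 i) in e.
Qed.

Lemma row_norm_lt x (r : R) : 0 < r -> (forall i, `|x ord0 i| < r) <-> `|x| < r.
Proof.
move=> r0; split=> [h|h i]; last exact: le_lt_trans (row_coord_le x i) h.
by have [->//|[i ->]] := row_norm_coord x.
Qed.

Lemma row_norm_le x (r : R) : 0 <= r -> (forall i, `|x ord0 i| <= r) <-> `|x| <= r.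
Proof.
move=> r0; split=> [h|h i]; last exact: le_trans (row_coord_le x i) h.
by have [->//|[i ->]] := row_norm_coord x.
Qed.

Lemma average_dom_ball L delta M x : `|x| < delta * (L%:R - M.+2%:R) -> average_dom L delta M x.
Proof. by move=> h; have := le_lt_trans (normr_ge0 _) h => r0; exact/row_norm_lt. Qed.

Lemma average_close L delta M m g x v (q : cseminorm F) (b : R) : 0 < delta ->
  (forall i, (m i <= M)%N) -> average_dom L delta M x ->
  (forall y, `|y - x| <= M.+2%:R * delta -> q (g y - v) <= b) ->
  q (average L delta m g x - v) <= b.
Proof.
move=> delta0 mM xM h; apply: (avgs_closeW S_step delta0 mM) => //; first exact: enum_uniq.
move=> y yx; apply: h; apply/row_norm_le; first by rewrite mulr_ge0// ltW.
by move=> i; rewrite !mxE.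
Qed.

Lemma average_eq0 L delta M m g x : 0 < delta -> (forall i, (m i <= M)%N) ->
  (forall y, `|y - x| <= M.+2%:R * delta -> g y = 0) -> average L delta m g x = 0.
Proof.
move=> delta0 mM h; apply: (avgs_eq0 S_step _ delta0 mM); first exact: enum_uniq.
move=> y yx; apply: h; apply/row_norm_le; first by rewrite mulr_ge0// ltW.
by move=> i; rewrite !mxE.
Qed.

(** Once all coordinates are frozen, every map is constant; this starts the passage through the
    coordinates. *)
Lemma average_Ck L delta m g : Ck None setT (average L delta m g).
Proof.
have h : smooth_off (F := F) [pred j | (j \in enum 'I_d) || pred0 j] g.
  move=> c; apply: (@Ck_eq _ _ _ _ (fun _ => g c)); [exact: openT| |].
    by move=> x _ /=; congr (g _); apply/rowP => j; rewrite mxE /= mem_enum.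
  by apply: Ck_cst => //; exact: openT.
have := avgs_smooth_off hF S_step L delta m h 0.
apply: Ck_eq; first exact: openT.
by move=> x _ /=; congr (avgs _ _ _ _ _ _ _); apply/rowP => j; rewrite mxE.
Qed.

End full_average.

Section uniform_continuity.
Context {R : realType} {d : nat} {F : tvsType R}.
Local Notation E := 'rV[R]_d.

(** The conclusion [O y] is also used on its own, with a constant [h], to keep a compact set at
    positive distance from the complement of an open one. *)
Lemma compact_uniform_continuity (K O : set E) (h : E -> F) (q : cseminorm F) (e : R) :
  compact K -> open O -> K `<=` O -> (forall x, O x -> h @ x --> h x) -> 0 < e ->
  exists2 eta : R, 0 < eta & forall x y, K x -> `|x - y| < eta -> O y /\ q (h y - h x) <= e.
Proof.
move=> /compact_near_coveringP cK oO KO ch e0.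
have e2 : 0 < e / 2 by rewrite divr_gt0.
have : \forall eta \near (0 : R)^'+, K `<=` (fun x => forall y, `|x - y| < eta ->
    O y /\ q (h y - h x) <= e).
  apply: cK => x Kx.
  have : \forall y \near x, O y /\ q (h y - h x) < e / 2.
    apply: filterI; first by apply: open_nbhs_nbhs; split=> //; exact: KO.
    exact: (cvg_cseminorm q (ch x (KO x Kx)) e2).
  move=> /nbhs_ballP[r /= r0 hr].
  have r2 : 0 < r / 2 by rewrite divr_gt0.
  exists (ball x (r / 2), [set eta | eta < r / 2]).
    by split; [exact: nbhsx_ballx|exact: nbhs_right_lt].
  move=> [x' eta] /= [x'x etar] y yx'.
  have hx' : ball x r x' by apply: le_ball x'x; move: r0; lra.
  have hy : ball x r y.
    rewrite [r]splitr; apply: ball_triangle x'x _.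
    by rewrite -ball_normE /=; exact: lt_trans etar.
  have [Oy qy] := hr _ hy; have [_ qx] := hr _ hx'; split=> //.
  apply: le_trans (cseminorm_trans q (h x) _ _) _.
  by rewrite [e]splitr lerD ?ltW// cseminorm_distC.
move=> near_eta; near (0 : R)^'+ => eta.
exists eta; first by near: eta; exact: nbhs_right_gt.
have : K `<=` (fun x => forall y, `|x - y| < eta -> O y /\ q (h y - h x) <= e) by near: eta.
by move=> hK x y /hK; apply.
Unshelve. all: by end_near. Qed.

Lemma compact_closed_ball (r : R) : compact [set x : E | `|x| <= r].
Proof.
apply: bounded_closed_compact.
  exists r; split; first exact: num_real.
  by move=> s rs x /= xr; exact: le_trans xr (ltW rs).
apply: (@closed_comp _ _ (fun x : E => `|x|) [set s : R | s <= r]).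
  by move=> x _; exact: norm_continuous.
exact: closed_le.
Qed.

Lemma open_norm_lt (r : R) : open [set x : E | `|x| < r].
Proof.
apply: (@open_comp _ _ (fun x : E => `|x|) [set s : R | s < r]).
  by move=> x _; exact: norm_continuous.
exact: open_lt.
Qed.

End uniform_continuity.

Lemma row_norm_basis {R : realType} {d : nat} (i : 'I_d) : `|basis_vec (R := R) i| <= 1.
Proof.
apply/row_norm_le => // j; rewrite basis_vecE.
by case: eqP => _; rewrite ?normr1// normr0.
Qed.

Section partial_derivatives.
Context {R : realType} {d : nat} {F : tvsType R}.
Local Notation E := 'rV[R]_d.
Hypothesis hF : hausdorff_space F.
Implicit Types (u v g : E -> F) (I : seq 'I_d) (i : 'I_d) (x y : E) (q : cseminorm F).

Definition partials I u : E -> F := iter_dderive u [seq basis_vec i | i <- I].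

Lemma iter_dderive_translate u (c : E) ys x :
  iter_dderive (fun z => u (z - c)) ys x = iter_dderive u ys (x - c).
Proof.
elim: ys u => [//|y ys IH] u /=; rewrite -IH; congr (iter_dderive _ ys x).
apply/funext => z; rewrite /dderive.
rewrite (_ : dquotient (fun z => u (z - c)) z y = dquotient u (z - c) y)//.
by apply/funext => h; rewrite /dquotient addrAC.
Qed.

Lemma Ck_translate (l : diff_order) u (c : E) : Ck l setT u -> Ck l setT (fun z => u (z - c)).
Proof.
have oT : open [set: E] by exact: openT.
move=> Cu; apply: (Ck_comp row_hausdorff row_hausdorff hF oT oT (f := fun z => z - c)) => //.
have C1 : Ck l setT (fun z : E => z) by apply: (Ck_linear _ row_hausdorff) => // x; exact: cvg_id.
have := Ck_lin row_hausdorff 1 oT C1 (Ck_cst l row_hausdorff (- c) oT).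
by apply: Ck_eq => // z _; rewrite !fctE scale1r.
Qed.

Lemma backward_diffE delta i u :
  backward_diff delta i u = delta^-1 *: u + (- delta^-1) *: (fun z => u (z - delta *: basis_vec i)).
Proof. by apply/funext => x; rewrite /backward_diff !fctE scalerBr scaleNr. Qed.

Lemma backward_diff_Ck (l : diff_order) delta i u : Ck l setT u ->
  Ck l setT (backward_diff delta i u).
Proof.
have oT : open [set: E] by exact: openT.
move=> Cu; have Cv := Ck_translate (delta *: basis_vec i) Cu.
have C0 : Ck l setT (0 : E -> F) by exact: Ck0.
have := Ck_lin hF delta^-1 oT Cu (Ck_lin hF (- delta^-1) oT Cv C0).
by rewrite addr0 -backward_diffE.
Qed.

Lemma partials_backward_diff delta I i u : Ck (Some (size I)) setT u ->
  partials I (backward_diff delta i u) = backward_diff delta i (partials I u).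
Proof.
have oT : open [set: E] by exact: openT.
move=> Cu; have Cv := Ck_translate (delta *: basis_vec i) Cu.
have C0 : Ck (Some (size I)) setT (0 : E -> F) by exact: Ck0.
apply/funext => x; rewrite /partials backward_diffE.
have bl (w : E -> F) : Ck (Some (size I)) setT w ->
    dderivable_below w setT (size [seq basis_vec i | i <- I]).
  by move=> Cw; rewrite size_map; exact: (Ck_below Cw (leqnn _)).
rewrite -[_ *: _ in X in _ + X]addr0.
rewrite (iter_dderive_lin hF _ oT) ?inE//; last 2 first.
- exact: bl.
- by apply: bl; exact: Ck_lin.
rewrite !fctE (iter_dderive_lin hF _ oT) ?inE//; last 2 first.
- exact: bl.
- exact: bl.
by rewrite iter_dderive0// addr0 !fctE iter_dderive_translate /backward_diff scalerBr scaleNr.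
Qed.

(** Each direction expands into [d] basis vectors with coefficients of size at most [c], hence a
    factor [d%:R * c] per order. *)
Lemma iter_dderive_partials_bound k u (U : set E) x q (b c : R) : open U ->
  Ck (Some k) U u -> U x -> 0 <= b ->
  (forall I, size I = k -> q (partials I u x) <= b) ->
  forall ys, size ys = k -> (forall y, y \in ys -> `|y| <= c) ->
  q (iter_dderive u ys x) <= (d%:R * c) ^+ k * b.
Proof.
move=> oU Cu Ux b0; elim: k u Cu => [|k IH] u Cu h ys.
  by move=> /size0nil -> _; rewrite expr0 mul1r; exact: (h [::]).
case: ys => // y ys [sys] yc.
have c0 : 0 <= c by apply: le_trans (yc y _); rewrite ?mem_head.
rewrite [y in y :: ys]row_basis (iter_dderive_head_sum hF _ _ _ oU Cu) ?sys//.
apply: le_trans (cseminorm_sum _ _ _ _) _.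
apply: (@le_trans _ _ (\sum_(i < d) c * ((d%:R * c) ^+ k * b))); last first.
  by rewrite sumr_const card_ord -[leLHS]mulr_natl exprS !mulrA.
apply: ler_sum => i _; rewrite cseminormZ.
apply: ler_pM => //; first exact: cseminorm_ge0.
  by apply: le_trans (row_coord_le _ _) (yc y _); rewrite mem_head.
apply: (IH (dderive (basis_vec i) u)) => //; first exact: Ck_dderive.
  by move=> I sI; apply: (h (i :: I)); rewrite /= sI.
by move=> z zys; apply: yc; rewrite inE zys orbT.
Qed.

End partial_derivatives.

(** * Convergence of the averages together with their derivatives *)

Section average_derivatives.
Context {R : realType} {d : nat} {F : tvsType R}.
Local Notation E := 'rV[R]_d.
Hypothesis hF : hausdorff_space F.
Variable S : nat -> R -> R.
Hypothesis S_step : forall m, is_step m (S m).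
Hypothesis S_derive : forall m (t : R), is_derive t 1 (S m.+1) (S m t - S m (t - 1)).
Implicit Types (g u : E -> F) (x y : E) (i : 'I_d) (I : seq 'I_d) (m : 'I_d -> nat)
  (L : nat) (delta : R) (q : cseminorm F).

Lemma dderive_average L delta M m i g (r : R) : 0 < delta -> (forall i, (m i <= M)%N) ->
  (0 < m i)%N -> r <= delta * (L%:R - M.+2%:R) ->
  {in [set x : E | `|x| < r], dderive (basis_vec i) (average S L delta m g) =1
     average S L delta (decr m i) (backward_diff delta i g)}.
Proof.
move=> delta0 mM mi rL x; rewrite inE /= => xr; apply: dderive_eq => //.
apply: (is_dderive_avgs S_step S_derive delta0) => //; [exact: enum_uniq|exact: mem_enum|].
apply: (avg_dom_leq delta0 (mM i)).
by apply: average_dom_ball; exact: lt_le_trans xr rL.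
Qed.

Lemma decr_leq m M i : (forall j, (m j <= M)%N) -> forall j, (decr m i j <= M)%N.
Proof. by move=> mM j; rewrite /decr; case: eqP => // _; rewrite (leq_trans (leq_pred _)). Qed.

Lemma decr_geq m n i : (forall j, (n.+1 <= m j)%N) -> forall j, (n <= decr m i j)%N.
Proof.
move=> mM j; rewrite /decr; case: eqP => _; last exact: ltnW.
by rewrite -ltnS prednK// (leq_trans _ (mM j)).
Qed.

(** Every partial derivative becomes a backward difference, which multiplies a bound on [g] by at
    most [2 / delta], as long as the spline orders last. This is the source of the growth rate of
    the cutoffs. *)
Lemma partials_average_bound L delta M m g q (b r : R) I : 0 < delta ->
  (forall i, (size I <= m i)%N) -> (forall i, (m i <= M)%N) ->
  r <= delta * (L%:R - M.+2%:R) -> (forall y, q (g y) <= b) ->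
  forall x, `|x| < r -> q (partials I (average S L delta m g) x) <= (2 / delta) ^+ size I * b.
Proof.
move=> delta0; elim: I m g b => [|i I IH] m g b mI mM rL gb x xr.
  rewrite expr0 mul1r -[partials _ _ _]subr0 /=.
  apply: (average_close S_step delta0 mM); last by move=> y _; rewrite subr0; exact: gb.
  by apply: average_dom_ball; exact: lt_le_trans xr rL.
have mi : (0 < m i)%N by rewrite (leq_trans _ (mI i)).
have e := dderive_average g delta0 mM mi rL.
rewrite /partials /= (iter_dderive_eq _ (@open_norm_lt R d r) e) ?inE//.
rewrite exprSr -mulrA; apply: IH => //; [exact: decr_geq|exact: decr_leq|].
move=> y; rewrite /backward_diff cseminormZ gtr0_norm ?invr_gt0//.
rewrite [leRHS]mulrAC [leRHS]mulrC ler_pM2l ?invr_gt0// (le_trans (cseminormB _ _ _))//.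
by rewrite mulr_natl mulr2n lerD.
Qed.

(** A sequence [w] is needed because the induction on the order averages backward differences whose
    step shrinks along with the mesh. *)
Definition local_Ck_cvg k (w : nat -> E -> F) u := forall I q (r e : R), (size I <= k)%N ->
  0 < e -> \forall n \near \oo, forall x, `|x| < r -> q (partials I (w n) x - partials I u x) <= e.

Definition mesh (n : nat) : R := n.+1%:R^-1.

Lemma mesh_gt0 n : 0 < mesh n. Proof. by rewrite invr_gt0. Qed.

Lemma mesh_small (c eta : R) : 0 < eta -> \forall n \near \oo, c * mesh n < eta.
Proof.
move=> eta0; have : \forall n \near \oo, c / eta <= n%:R :> R by exact: nbhs_infty_ger.
apply: filterS => n; rewrite ler_pdivrMr// => h.
rewrite /mesh ltr_pdivrMr// (le_lt_trans h)// mulrC ltr_pM2l// ltr_nat.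
by [].
Qed.

Lemma local_uniform_continuity (h : E -> F) q (c r e : R) :
  (forall x, h @ x --> h x) -> 0 < e ->
  \forall n \near \oo, forall x y, `|x| < r -> `|x - y| <= c * mesh n -> q (h y - h x) <= e.
Proof.
move=> ch e0.
have [eta eta0 heta] := compact_uniform_continuity q (@compact_closed_ball R d r) openT
  (fun _ _ => I) (fun x _ => ch x) e0.
apply: filterS (mesh_small c eta0) => n cn x y xr xy.
by have [] := heta x y (ltW xr) (le_lt_trans xy cn).
Qed.

(** A backward difference is compared with the derivatives at the intermediate points of its
    segment; there the derivative of [w n] is close to that of [u], and the latter varies little
    over the distance [mesh n]. *)
Lemma local_Ck_cvg_backward_diff k i w u : (forall n, Ck (Some k.+1) setT (w n)) ->
  Ck (Some k.+1) setT u -> local_Ck_cvg k.+1 w u ->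
  local_Ck_cvg k (fun n => backward_diff (mesh n) i (w n)) (dderive (basis_vec i) u).
Proof.
have oT : open [set: E] by exact: openT.
move=> Cw Cu cw I q r e sI e0.
have e2 : 0 < e / 2 by rewrite divr_gt0.
have CI v : Ck (Some k.+1) setT v -> Ck (Some (size I + 1)%N) setT v.
  by apply: Ck_leq => j /= /leq_trans; apply; rewrite addn1.
have CwI n : Ck (Some 1) setT (partials I (w n)).
  by apply: Ck_iter_dderive; rewrite size_map; exact: CI.
have CuI : Ck (Some 1) setT (partials I u).
  by apply: Ck_iter_dderive; rewrite size_map; exact: CI.
have uE : partials I (dderive (basis_vec i) u) = dderive (basis_vec i) (partials I u).
  apply/funext => x; rewrite /partials -iter_dderive_rcons.
  rewrite -[LHS]/(iter_dderive u (basis_vec i :: [seq basis_vec i | i <- I]) x).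
  apply: (iter_dderive_perm hF oT Cu) => //; first by rewrite /= size_map ltnS.
  by rewrite perm_sym perm_rcons.
have cdu x : dderive (basis_vec i) (partials I u) @ x --> dderive (basis_vec i) (partials I u) x.
  exact: Ck_continuous (Ck_dderive (basis_vec i) CuI) _.
have h1 := local_uniform_continuity q 1 r cdu e2.
(* The intermediate points leave the ball of radius [r] by less than 1. *)
have h2 := cw (rcons I i) q (r + 1) (e / 2).
rewrite size_rcons ltnS in h2; have {}h2 := h2 sI e2.
have h3 : \forall n \near \oo, 1 * mesh n < 1 by exact: mesh_small.
apply: filterS3 h1 h2 h3 => n k1 k2 k3 x xr.
rewrite mul1r in k3.
rewrite (partials_backward_diff hF); last first.
  by apply: Ck_leq (Cw n) => j /= /leq_trans; apply; exact: leqW.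
rewrite uE /backward_diff; set W := partials I (w n); set l := dderive _ _ x.
have seg := @cseminorm_segment _ _ _ W x (basis_vec i)
  (fun s => dderive (basis_vec i) W (x + (s * - mesh n) *: basis_vec i)) l q (- mesh n) e.
have {seg} : q (W (x + - mesh n *: basis_vec i) - W x - - mesh n *: l) <= `|- mesh n| * e.
  apply: seg => s /andP[s0 s1].
    exact: (dderivableP hF (Ck_dderivable _ (CwI n) Logic.I)).
  set y := x + _.
  have xy : `|x - y| <= 1 * mesh n.
    rewrite mul1r -[leRHS]mulr1.
    rewrite /y opprD addrA subrr sub0r normrN normrZ normrM normrN (gtr0_norm (mesh_gt0 n)).
    apply: ler_pM => //; first by rewrite mulr_ge0// ltW// mesh_gt0.
      by rewrite ler_piMl ?ger0_norm// ltW// mesh_gt0.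
    exact: row_norm_basis.
  apply: le_trans (cseminorm_trans q (dderive (basis_vec i) (partials I u) y) _ _) _.
  rewrite [e]splitr lerD//; last exact: k1.
  have := k2 y; rewrite /partials map_rcons !iter_dderive_rcons; apply.
  rewrite -(subrK x y) (le_lt_trans (ler_normD _ _))// addrC ltr_leD//.
  by rewrite distrC (le_trans xy)// mul1r ltW.
rewrite normrN (gtr0_norm (mesh_gt0 n)) scaleNr [- mesh n *: l]scaleNr opprK => seg.
rewrite -(ler_pM2l (mesh_gt0 n)) -{1}(gtr0_norm (mesh_gt0 n)) -cseminormZ scalerBr scalerA.
rewrite mulfV ?gt_eqF ?mesh_gt0// scale1r -cseminormN.
by rewrite opprB addrC opprB.
Qed.

End average_derivatives.

Lemma Ck_leqn {R : realType} {V F : tvsType R} (k n : nat) (f : V -> F) (U : set V) :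
  (k <= n)%N -> Ck (Some n) U f -> Ck (Some k) U f.
Proof. by move=> kn; apply: Ck_leq => j /= /leq_trans; apply. Qed.

Section smooth_approximation.
Context {R : realType} {d : nat}.
Local Notation E := 'rV[R]_d.
Variable S : nat -> R -> R.
Hypothesis S_step : forall m, is_step m (S m).
Hypothesis S_derive : forall m (t : R), is_derive t 1 (S m.+1) (S m t - S m (t - 1)).
Implicit Types (x y : E) (i : 'I_d) (I : seq 'I_d) (m : 'I_d -> nat)
  (L : nat) (delta : R).

(** With [n.+1 ^ 2] nodes on either side at spacing [mesh n], the grid reaches out to distance
    [n.+1] and eventually covers any given ball with the required margin. *)
Lemma mesh_dom (M : nat) (r : R) :
  \forall n \near \oo, r <= @mesh R n * ((n.+1 ^ 2)%:R - M.+2%:R).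
Proof.
have : \forall n \near \oo, r + M.+2%:R <= n%:R :> R by exact: nbhs_infty_ger.
apply: filterS => n h; rewrite mulrBr natrX expr2 /mesh mulrA mulVf ?mul1r ?pnatr_eq0//.
have : n.+1%:R^-1 * M.+2%:R <= M.+2%:R :> R.
  by rewrite ler_piMl// invf_le1// ler1n.
have : (n%:R : R) <= n.+1%:R by rewrite ler_nat.
move: h; set A := _^-1 * _; set B : R := M.+2%:R; set C : R := n%:R; set D : R := n.+1%:R.
by lra.
Qed.

Section approximants.
Context {F : tvsType R}.
Hypothesis hF : hausdorff_space F.
Implicit Types (u : E -> F) (w : nat -> E -> F) (q : cseminorm F).

Lemma local_cvg_average M m w u : (forall i, (m i <= M)%N) -> (forall x, u @ x --> u x) ->
  local_Ck_cvg 0 w u -> forall q (r e : R), 0 < e -> \forall n \near \oo, forall x, `|x| < r ->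
    q (average S (n.+1 ^ 2) (@mesh R n) m (w n) x - u x) <= e.
Proof.
move=> mM cu cw q r e e0; have e2 : 0 < e / 2 by rewrite divr_gt0.
have h1 := local_uniform_continuity q M.+2%:R r cu e2.
have h2 := cw [::] q (r + 1) (e / 2) isT e2.
have h3 : \forall n \near \oo, M.+2%:R * @mesh R n < 1 /\
    r <= @mesh R n * ((n.+1 ^ 2)%:R - M.+2%:R).
  by apply: filterI; [exact: mesh_small|exact: mesh_dom].
apply: filterS3 h1 h2 h3 => n k1 k2 [k3 k4] x xr.
apply: (average_close S_step (@mesh_gt0 R n) mM).
  by apply: average_dom_ball; exact: lt_le_trans xr k4.
move=> y yx; apply: le_trans (cseminorm_trans q (u y) _ _) _.
rewrite [e]splitr lerD//; last by apply: k1; rewrite // distrC.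
apply: k2; rewrite -(subrK x y) (le_lt_trans (ler_normD _ _))// addrC ltr_leD//.
by rewrite (le_trans yx)// ltW.
Qed.

(** Induction on the order: a partial derivative of the average is an average, with one spline order
    less, of backward differences, whose convergence is [local_Ck_cvg_backward_diff]. *)
Lemma local_Ck_cvg_average k M m w u : (forall i, (k <= m i)%N) -> (forall i, (m i <= M)%N) ->
  (forall n, Ck (Some k) setT (w n)) -> Ck (Some k) setT u -> local_Ck_cvg k w u ->
  local_Ck_cvg k (fun n => average S (n.+1 ^ 2) (@mesh R n) m (w n)) u.
Proof.
have base k' m' w' u' : (forall i, (m' i <= M)%N) -> Ck (Some k') setT u' ->
    local_Ck_cvg k' w' u' -> forall q (r e : R), 0 < e -> \forall n \near \oo, forall x, `|x| < r ->
    q (average S (n.+1 ^ 2) (@mesh R n) m' (w' n) x - u' x) <= e.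
  move=> mM Cu cw; apply: (local_cvg_average mM).
    by move=> x; exact: (Ck_continuous Cu Logic.I).
  by move=> I q r e sI; apply: cw; exact: leq_trans sI (leq0n _).
move=> + mM; elim: k m w u mM => [|k IH] m w u mM km Cw Cu cw [|i I] q r e sI e0 //.
- exact: base mM Cu cw q r e e0.
- exact: base mM Cu cw q r e e0.
- have h1 := mesh_dom M r.
  have h2 := IH (decr m i) (fun n => backward_diff (@mesh R n) i (w n)) (dderive (basis_vec i) u)
    (decr_leq i mM) (decr_geq i km)
    (fun n => backward_diff_Ck hF _ _ (Ck_leqn (leqnSn k) (Cw n)))
    (Ck_dderive (basis_vec i) Cu) (local_Ck_cvg_backward_diff hF i Cw Cu cw) I q r e sI e0.
  apply: filterS2 h1 h2 => n k1 k2 x xr.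
  have mi : (0 < m i)%N by rewrite (leq_trans _ (km i)).
  have ee := dderive_average hF S_step S_derive (w n) (@mesh_gt0 R n) mM mi k1.
  rewrite /partials /= (iter_dderive_eq _ (@open_norm_lt R d r) ee) ?inE//.
  exact: k2.
Qed.

Lemma iter_dderive_vanish (O : set E) u ys x : open O -> (forall y, O y -> u y = 0) ->
  O x -> iter_dderive u ys x = 0.
Proof.
move=> oO u0 Ox; have e : {in O, u =1 (0 : E -> F)} by move=> y /[!inE]; exact: u0.
by rewrite (iter_dderive_eq ys oO e) ?inE// iter_dderive0.
Qed.

(** Convergence is uniform on balls only, but [u] and the averages vanish off [K2], which lies in a
    ball. The averages live within [k + 2] mesh widths of [K], hence in [K2] once the mesh is
    fine. *)
Lemma smooth_approximation (K K2 : set E) (eta : R) k u q (e : R) : compact K -> 0 < eta ->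
  (forall x y, K x -> `|y - x| <= eta -> K2 y) -> compact K2 ->
  Ck (Some k) setT u -> (forall x, ~ K x -> u x = 0) -> 0 < e ->
  exists v : E -> F, [/\ Ck None setT v, forall x, ~ K2 x -> v x = 0 &
    forall I x, (size I <= k)%N -> q (partials I v x - partials I u x) <= e].
Proof.
move=> cK eta0 KK2 cK2 Cu u0 e0.
have [r0 hr0] : exists r : R, forall x, K2 x -> `|x| <= r.
  have [M [_ hM]] := compact_bounded cK2.
  by exists (M + 1) => x K2x; apply: (hM (M + 1)) => //; rewrite ltrDl.
have KK : K `<=` K2 by move=> x Kx; apply: (KK2 x) => //; rewrite subrr normr0 ltW.
pose m (_ : 'I_d) := k.
pose A n := average S (n.+1 ^ 2) (@mesh R n) m u.
have cA : local_Ck_cvg k A u.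
  apply: (local_Ck_cvg_average (M := k)) => // J p r e' _ e'0.
  by apply: nearW => n x _; rewrite subrr cseminorm0 ltW.
have h1 : \forall n \near \oo, forall I, (size I <= k)%N -> forall x, `|x| < r0 + 1 ->
    q (partials I (A n) x - partials I u x) <= e.
  have h (j : nat) (jk : (j <= k)%N) : \forall n \near \oo, forall I : j.-tuple 'I_d,
      forall x, `|x| < r0 + 1 -> q (partials I (A n) x - partials I u x) <= e.
    apply: filter_forall => I; apply: cA => //; by rewrite size_tuple.
  have : \forall n \near \oo, forall j : 'I_k.+1, forall I : j.-tuple 'I_d,
      forall x, `|x| < r0 + 1 -> q (partials I (A n) x - partials I u x) <= e.
    by apply: filter_forall => j; apply: h; rewrite -ltnS.
  apply: filterS => n hn I sI x xr.
  by have := hn (Ordinal (sI : size I < k.+1)%N) (in_tuple I) x xr.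
have h2 : \forall n \near \oo, k.+2%:R * @mesh R n < eta by exact: mesh_small.
near \oo => n.
have An0 x : ~ K2 x -> A n x = 0.
  move=> K2x; apply: (average_eq0 S_step _ (@mesh_gt0 R n) (M := k)) => // y yx.
  apply: u0 => Ky; apply: K2x; apply: (KK2 y) => //.
  by rewrite distrC (le_trans yx)// ltW//; near: n.
exists (A n); split=> //; first exact: average_Ck.
move=> I x sI; have [xr|xr] := ltP `|x| (r0 + 1).
  suff : forall I, (size I <= k)%N -> forall x, `|x| < r0 + 1 ->
    q (partials I (A n) x - partials I u x) <= e by apply.
  by near: n.
have oO : open [set y : E | r0 < `|y|].
  apply: (@open_comp _ _ (fun x : E => `|x|) [set s : R | r0 < s]).
    by move=> y _; exact: norm_continuous.
  exact: open_gt.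
have Ox : [set y : E | r0 < `|y|] x by rewrite /= (lt_le_trans _ xr)// ltrDl.
have nK2 y : [set y : E | r0 < `|y|] y -> ~ K2 y.
  by move=> /= yr /hr0; rewrite leNgt yr.
rewrite /partials (iter_dderive_vanish _ oO _ Ox); last by move=> y /nK2; exact: An0.
rewrite (iter_dderive_vanish _ oO _ Ox); last by move=> y /nK2 nK; apply: u0 => /KK.
by rewrite subrr cseminorm0 ltW.
Unshelve. all: by end_near. Qed.

(** At points of [K] a fine average uses only values of [h] in [O], where it is continuous. *)
Lemma smooth_uniform_approximation (K O : set E) (h : E -> F) q (e : R) :
  compact K -> open O -> K `<=` O -> (forall x, O x -> h @ x --> h x) -> 0 < e ->
  exists2 v : E -> F, Ck None setT v & forall x, K x -> q (v x - h x) <= e.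
Proof.
move=> cK oO KO ch e0.
have [r0 hr0] : exists r : R, forall x, K x -> `|x| <= r.
  have [M [_ hM]] := compact_bounded cK.
  by exists (M + 1) => x K2x; apply: (hM (M + 1)) => //; rewrite ltrDl.
have [eta eta0 heta] := compact_uniform_continuity q cK oO KO ch e0.
pose m (_ : 'I_d) := 0%N.
have h1 := mesh_dom 0 (r0 + 1).
have h2 : \forall n \near \oo, 2%:R * @mesh R n < eta by exact: mesh_small.
near \oo => n.
exists (average S (n.+1 ^ 2) (@mesh R n) m h); first exact: average_Ck.
move=> x Kx; apply: (average_close S_step (@mesh_gt0 R n) (M := 0)) => //.
  apply: average_dom_ball.
  apply: (@lt_le_trans _ _ (r0 + 1)); last by near: n.
  by rewrite (le_lt_trans (hr0 x Kx))// ltrDl.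
move=> y yx; have [] := heta x y Kx => //.
by rewrite distrC (le_lt_trans yx)//; near: n.
Unshelve. all: by end_near. Qed.

End approximants.

(** The cutoff is the average, at scale [delta], of the indicator function of [Z]. Spline order [k]
    yields the derivative bounds, and the average at [x] sees only points within [(k + 2) * delta]
    of [x]. *)
Lemma smooth_cutoff k (Omega : set E) (delta r : R) : 0 < delta -> 0 < r ->
  exists chi : E -> R^o, [/\ Ck None setT chi, forall x, 0 <= (chi x : R) <= 1,
    forall x, (chi x : R) != 0 -> `|x| < r + (2 * k.+2)%:R * delta /\
      forall y, `|y - x| < delta -> Omega y,
    forall x, `|x| < r -> (forall y, `|y - x| < (2 * k.+3)%:R * delta -> Omega y) ->
      chi x = 1 &
    forall I x, (size I <= k)%N -> `|partials I chi x : R| <= (2 / delta) ^+ size I].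
Proof.
move=> delta0 r0; pose c : R := k.+2%:R.
have c0 : 0 < c by [].
have cd0 : 0 < c * delta by rewrite mulr_gt0.
(* There is room for one spline width on either side: points within [c * delta] of [Z] have norm
   below [r + 2 * c * delta] and keep their [delta]-ball in [Omega], while a point of norm below [r]
   whose [2 * (c + 1) * delta]-ball lies in [Omega] has its whole [c * delta]-neighbourhood in
   [Z]. *)
pose Z := [set z : E | `|z| < r + c * delta /\ forall y, `|y - z| < (c + 1) * delta -> Omega y].
pose g (z : E) : R^o := (z \in Z)%:R.
have g01 z : 0 <= (g z : R) <= 1 by rewrite /g; case: (z \in Z); rewrite ?lexx ?ler01.
pose r' := r + 2 * c * delta + 1.
have [L hL] : exists L : nat, r' <= delta * (L%:R - k.+2%:R).
  have : \forall n \near \oo, r' / delta + c <= n%:R :> R by exact: nbhs_infty_ger.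
  by move=> /filter_ex[n hn]; exists n; rewrite -ler_pdivrMl// mulrC lerBrDr.
pose m (_ : 'I_d) := k.
pose chi := average S L delta m g.
have chi_supp x : (chi x : R) != 0 -> exists2 z, Z z & `|z - x| <= c * delta.
  move=> chix; apply: contrapT => h.
  move: chix; rewrite /chi (average_eq0 S_step _ delta0 (M := k)) ?eqxx//.
  move=> y yx; rewrite /g; case: (boolP (y \in Z)) => //; rewrite inE => yZ.
  by exfalso; apply: h; exists y.
have chi_r x : (chi x : R) != 0 -> `|x| < r + 2 * c * delta.
  move=> /chi_supp[z [zr _] zx].
  rewrite -(subrK z x) (le_lt_trans (ler_normD _ _))// distrC.
  by move: zr zx; lra.
have dom x : `|x| < r' -> average_dom L delta k x.
  by move=> xr; apply: average_dom_ball; exact: lt_le_trans xr hL.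
exists chi; split.
- exact: (average_Ck Ro_hausdorff S_step).
- move=> x; have [->|chix] := eqVneq (chi x : R) 0; first by rewrite lexx ler01.
  have xr : `|x| < r' by rewrite (lt_trans (chi_r x chix))// ltrDl.
  (* The interval [0, 1] is the closed ball of radius 1/2 about 1/2, a form to which [average_close]
     applies. *)
  have : `|(chi x : R) - 1 / 2| <= 1 / 2.
    apply: (average_close (F := R^o) S_step delta0 (M := k) (m := m) (g := g) (v := 1 / 2)
      (q := abs_seminorm) (b := 1 / 2)) => //.
      exact: dom.
    move=> y _; rewrite /= ler_norml; have := g01 y; set G : R := g y.
    by move=> G01; lra.
  by rewrite ler_norml => h; lra.
- move=> x chix; have := chi_r x chix.
  rewrite natrM; split; first by move: H; lra.
  have [z [_ hz] zx] := chi_supp x chix.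
  move=> y yx; apply: hz; rewrite mulrDl mul1r.
  have := ler_distD x y z; rewrite (distrC x z).
  by move: yx zx; lra.
- move=> x xr hx; apply/eqP; rewrite -subr_eq0 -normr_le0.
  apply: (average_close (F := R^o) S_step delta0 (M := k) (m := m) (g := g) (v := 1)
      (q := abs_seminorm) (b := 0)) => //.
    apply: dom; rewrite (lt_trans xr)// /r'; move: cd0; lra.
  move=> y yx /=; rewrite /g mem_set ?subrr ?normr0//; split.
    by rewrite -(subrK x y) (le_lt_trans (ler_normD _ _))// addrC ltr_leD.
  move=> z zy; apply: hx; apply: le_lt_trans (ler_distD y z x) _.
  have : (2 * k.+3)%:R = 2 * (c + 1) :> R by rewrite natrM natr1.
  by move=> ->; move: zy yx; lra.
- move=> I x sI; have [xr|xr] := ltP `|x| r'.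
    rewrite -[leRHS]mulr1.
    apply: (partials_average_bound (F := R^o) Ro_hausdorff S_step S_derive (M := k) (m := m)
      (q := abs_seminorm) delta0 _ _ hL) => //.
    move=> y /=; rewrite ger0_norm; by case/andP: (g01 y).
  pose O := [set y : E | r + 2 * c * delta < `|y|].
  have oO : open O.
    apply: (@open_comp _ _ (fun x : E => `|x|) [set s : R | r + 2 * c * delta < s]).
      by move=> y _; exact: norm_continuous.
    exact: open_gt.
  have Ox : O x by rewrite /O /= (lt_le_trans _ xr)// ltrDl.
  rewrite /partials (iter_dderive_vanish Ro_hausdorff _ oO _ Ox).
    by rewrite normr0 exprn_ge0// divr_ge0// ltW.
  move=> y Oy; apply/eqP; apply: contraT => /chi_r; by rewrite ltNge ltW.
Qed.

End smooth_approximation.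

(** * Weighted function spaces *)

Section norm_equivalence.
Context {R : realType} {d : nat}.
Local Notation E := 'rV[R]_d.
Variable N : vnorm E.

Lemma vnorm_upper : exists2 C : R, 0 < C & forall y, N y <= C * `|y|.
Proof.
have hN := vnorm_seminorm N.
exists (\sum_i N (basis_vec i) + 1).
  by rewrite ltr_wpDl// sumr_ge0// => i _; exact: seminorm_ge0 hN.
move=> y; rewrite {1}[y]row_basis.
apply: (@le_trans _ _ (\sum_i N (y ord0 i *: basis_vec i))).
  elim/big_rec2: _ => [|i a b _ h]; first by rewrite (seminorm0 hN).
  by apply: le_trans (seminormD hN _ _) _; rewrite lerD2l.
rewrite mulrDl mul1r mulr_suml (@le_trans _ _ (\sum_i N (basis_vec i) * `|y|))//.
  apply: ler_sum => i _; rewrite (seminormZ hN) mulrC ler_wpM2l ?row_coord_le//.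
  exact: seminorm_ge0 hN.
by rewrite lerDl.
Qed.

Lemma vnorm_continuous : continuous (N : E -> R).
Proof.
have hN := vnorm_seminorm N; have [C C0 hC] := vnorm_upper.
have NN y : N (- y) = N y by rewrite -scaleN1r (seminormZ hN) normrN1 mul1r.
have h z w : N z - N w <= N (z - w).
  by rewrite lerBlDr -{1}(subrK w z); exact: seminormD hN _ _.
move=> x A /nbhs_ballP[e /= e0 eA].
apply/nbhs_ballP; exists (e / C); first by rewrite /= divr_gt0.
move=> y; rewrite -ball_normE /= ltr_pdivlMr// => xy.
have hxy : N (x - y) < e by apply: le_lt_trans (hC _) _; rewrite mulrC.
apply: eA; rewrite -ball_normE /=; apply: le_lt_trans hxy.
rewrite ler_norml lerNl opprB (le_trans (h _ _))/= ?(le_trans (h _ _))//.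
by rewrite -NN opprB.
Qed.

Lemma vnorm_lower : exists2 C : R, 0 < C & forall y, `|y| <= C * N y.
Proof.
have hN := vnorm_seminorm N.
pose K := [set x : E | `|x| = 1].
have cK : compact K.
  apply: bounded_closed_compact.
    exists 1; split; first exact: num_real.
    by move=> s s1 x /= ->; exact: ltW.
  apply: (@closed_comp _ _ (fun x : E => `|x|) [set s : R | s = 1]).
    by move=> x _; exact: norm_continuous.
  exact: closed_eq.
move/compact_near_coveringP : cK => cK.
have : \forall e \near (0 : R)^'+, K `<=` (fun x => e < N x).
  apply: cK => x Kx.
  have Nx : 0 < N x.
    rewrite lt_neqAle seminorm_ge0 ?andbT//; apply/negP => /eqP/esym/vnorm_eq0 x0.
    by move: Kx; rewrite /K /= x0 normr0 => /esym/eqP; rewrite oner_eq0.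
  have N2 : N x / 2 < N x by rewrite ltr_pdivrMr// ltr_pMr// ltr1n.
  exists ([set y | N x / 2 < N y], [set e | e < N x / 2]).
    split; last by apply: nbhs_right_lt; rewrite divr_gt0.
    exact: (@cvgr_gt _ _ (nbhs x) _ (N : E -> R) (N x) (vnorm_continuous (x := x)) _ N2).
  by move=> [y e] /= [h1 h2]; exact: lt_trans h2 h1.
move=> h; near (0 : R)^'+ => e.
have e0 : 0 < e by near: e; exact: nbhs_right_gt.
have hK : K `<=` (fun x => e < N x) by near: e.
exists e^-1; first by rewrite invr_gt0.
move=> y; have [->|y0] := eqVneq y 0.
  by rewrite normr0 mulr_ge0 ?invr_ge0 ?(ltW e0)// seminorm_ge0.
have ny : 0 < `|y| by rewrite normr_gt0.
have := hK (`|y|^-1 *: y); rewrite /K /= normrZ normfV normr_id mulVf ?gt_eqF//.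
move=> /(_ erefl); rewrite (seminormZ hN) normfV normr_id ltr_pdivlMl// => /ltW h'.
by rewrite ler_pdivlMl// mulrC.
Unshelve. all: by end_near. Qed.

End norm_equivalence.

Section compact_bound.
Context {R : realType} {d : nat} {F : tvsType R}.
Local Notation E := 'rV[R]_d.
Implicit Types (q : cseminorm F) (K Q : set E).

Lemma compact_seminorm_bound K Q (h : E -> F) q : compact K -> K `<=` Q ->
  (forall x, Q x -> h @ x --> h x) -> exists2 B : R, 0 < B & forall x, K x -> q (h x) <= B.
Proof.
move=> /compact_near_coveringP cK KQ ch.
have : \forall B \near +oo%R, K `<=` (fun x => q (h x) <= B).
  apply: cK => x /KQ Qx.
  exists ([set y | q (h y) < q (h x) + 1], [set B | q (h x) + 1 <= B]).
    split; last by apply: nbhs_pinfty_ge; exact: num_real.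
    have q1 : q (h x) < q (h x) + 1 by rewrite ltrDl.
    exact: (@cvgr_lt _ _ (nbhs x) _ (fun y => q (h y)) (q (h x)) (cseminorm_cvg (q := q) (ch x Qx)) _ q1).
  by move=> [y B] /= [h1 h2]; exact: le_trans (ltW h1) h2.
move=> hB; near (pinfty_nbhs R) => B; exists B; last by near: B.
by near: B; apply: nbhs_pinfty_gt; exact: num_real.
Unshelve. all: by end_near. Qed.

End compact_bound.

Section compactly_supported.
Context {R : realType} {d : nat} {F : tvsType R}.
Local Notation E := 'rV[R]_d.
Hypothesis hF : hausdorff_space F.
Implicit Types (u v : E -> F) (q : cseminorm F) (K Q : set E).

Lemma iter_dderive_bound (N : vnorm E) : exists2 C : R, 0 < C & forall k u Q x q (b : R),
  open Q -> Ck (Some k) Q u -> Q x -> 0 <= b ->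
  (forall I, size I = k -> q (partials I u x) <= b) ->
  forall y, N y <= 1 -> q (iter_dderive u (nseq k y) x) <= C ^+ k * b.
Proof.
have [C C0 hC] := vnorm_lower N.
exists (d%:R * C + 1); first by rewrite ltr_wpDl// mulr_ge0// ltW.
move=> k u Q x q b oQ Cu Qx b0 h y Ny.
apply: (@le_trans _ _ ((d%:R * C) ^+ k * b)).
  apply: (iter_dderive_partials_bound hF oQ Cu Qx b0 h); first exact: size_nseq.
  move=> z /nseqP[-> _]; apply: le_trans (hC y) _.
  by rewrite ler_piMr// ltW.
have dC : 0 <= d%:R * C by rewrite mulr_ge0// ltW.
by rewrite ler_wpM2r// lerXn2r ?nnegrE ?addr_ge0// lerDl.
Qed.

Lemma in_CW_bullet_compact (N : vnorm E) l (W : set (E -> R^o)) (Omega K : set E) u :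
  open Omega -> compact K -> K `<=` Omega -> (forall f, W f -> Ck None Omega f) ->
  Ck l Omega u -> (forall x, Omega x -> ~ K x -> u x = 0) -> in_CW_bullet N l W Omega u.
Proof.
move=> oO cK KO CW Cu u0.
have clK : closed K by apply: compact_closed => //; exact: norm_hausdorff.
have oO' : open (Omega `\` K) by apply: openI => //; exact: closed_openC.
have zero q f k : weighted_norm N (Omega `\` K) q f k u = 0%E.
  apply/eqP; rewrite eq_le weighted_norm_ge0 andbT; apply: weighted_norm_le => //.
  move=> j x y jk Ox Ny; rewrite deltaE (iter_dderive_vanish hF _ oO' _ Ox).
    by rewrite cseminorm0 mule0.
  by move=> z [Oz Kz]; exact: u0.
split; last by move=> f k q e _ _ e0; exists K; split=> //; rewrite zero lte_fin.
split=> // f k q Wf kl.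
have [C C0 hC] := iter_dderive_bound N.
have [Bf Bf0 hBf] : exists2 B : R, 0 < B & forall x, K x -> `|f x : R| <= B.
  have [B B0 hB] := compact_seminorm_bound abs_seminorm cK KO (h := f)
    (fun x Ox => Ck_continuous (CW f Wf) Ox).
  by exists B.
have hk j : (j <= k)%N -> exists2 B : R, 0 < B & forall x I, K x -> size I = j ->
    q (partials I u x) <= B.
  move=> jk.
  have h (I : j.-tuple 'I_d) : exists B : R, 0 < B /\ forall x, K x -> q (partials I u x) <= B.
    have jl : le_order (size [seq basis_vec (R := R) i | i <- I]) l.
      by rewrite size_map size_tuple; case: (l) kl => //= n; exact: leq_trans.
    have [B B0 hB] := compact_seminorm_bound q cK KO (h := partials I u)
      (fun x Ox => iter_dderive_continuous Cu Ox jl).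
    by exists B.
  have [B hB] := choice h.
  exists (\sum_I B I + 1).
    by rewrite ltr_wpDl// sumr_ge0// => I _; rewrite ltW//; case: (hB I).
  move=> x I Kx /eqP sI; have [_ /(_ x Kx) h'] := hB (Tuple sI).
  apply: le_trans h' _; rewrite (bigD1 (Tuple sI))//= -addrA lerDl addr_ge0//.
  by rewrite sumr_ge0// => J _; rewrite ltW//; case: (hB J).
have hk2 j : exists B : R, (j <= k)%N -> 0 < B /\ forall x I, K x -> size I = j ->
    q (partials I u x) <= B.
  by case: (leqP j k) => [/hk[B B0 hB]|_]; [exists B|exists 0].
have [B hB] := choice hk2.
pose c j := Bf * (C ^+ j * B j).
apply: (@le_lt_trans _ _ (\sum_(j < k.+1) c j)%:E); last exact: ltry.
have c0 j : (j <= k)%N -> 0 <= c j.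
  move=> jk; have [Bj _] := hB j jk.
  by rewrite /c !mulr_ge0 ?exprn_ge0// ltW.
apply: weighted_norm_le; first by rewrite lee_fin sumr_ge0// => j _; apply: c0; rewrite -ltnS.
move=> j x y jk Ox Ny.
have cj : c j <= \sum_(i < k.+1) c i.
  rewrite (bigD1 (Ordinal (jk : j < k.+1)%N))//= lerDl sumr_ge0// => i _.
  by apply: c0; rewrite -ltnS.
have [Kx|Kx] := pselect (K x); last first.
  apply: le_trans (_ : 0 <= _)%E; last by rewrite lee_fin (le_trans (c0 j jk)).
  rewrite -(zero q f k); apply: weighted_norm_ge => //.
rewrite -EFinM lee_fin (le_trans _ cj)// ler_pM//; first exact: cseminorm_ge0.
  exact: hBf.
rewrite deltaE; have [Bj h] := hB j jk.
apply: (hC j u Omega) => //; [|exact: ltW|by move=> I sI; exact: h].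
have /CkP := Cu; apply; by case: (l) kl => //= n; exact: leq_trans.
Qed.

End compactly_supported.

Lemma first_exit {R : realType} {d : nat} (Omega : set 'rV[R]_d) x z :
  open Omega -> Omega x -> ~ Omega z -> exists z', [/\ ~ Omega z', `|z' - x| <= `|z - x| &
    forall t : R, 0 <= t < 1 -> Omega (x + t *: (z' - x))].
Proof.
move=> oO Ox Oz.
pose S := `[0 : R, 1] `&` (fun t : R => x + t *: (z - x)) @^-1` (~` Omega).
have S1 : S 1 by split; rewrite /= ?in_itv /= ?ler01 ?lexx// scale1r addrC subrK.
have cS : compact S.
  apply: compact_closedI; first exact: segment_compact.
  apply: closed_comp; last exact: open_closedC.
  move=> t _; apply: tvs_cvgD; first exact: cvg_cst.
  by apply: tvs_cvgZ; [exact: cvg_id|exact: cvg_cst].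
have [] := @compact_EVT_min R R (fun t : R => t) S _ cS.
- by exists 1.
- by apply: continuous_subspaceT => t; exact: cvg_id.
move=> t; rewrite inE => -[/=]; rewrite in_itv /= => /andP[t0 t1] Ot tmin.
have tp : 0 < t.
  by rewrite lt_neqAle t0 andbT; apply/eqP => t00; apply: Ot; rewrite -t00 scale0r addr0.
exists (x + t *: (z - x)); split=> //.
  by rewrite addrC addKr normrZ ger0_norm// ler_piMl.
move=> r /andP[r0 r1]; apply: contrapT => Or.
have rt : r * t < t by rewrite gtr_pMl.
suff : r * t \in S by move=> /tmin; rewrite leNgt rt.
rewrite inE; split; last by move: Or; rewrite /= [x + _ - x]addrC addKr scalerA.
rewrite /= in_itv /= mulr_ge0//=.
by apply: le_trans t1; rewrite ler_piMl// ltW.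
Qed.

(** * Decay of weighted derivatives at infinity and near the boundary *)

Section decay.
Context {R : realType} {d : nat} {F : tvsType R}.
Local Notation E := 'rV[R]_d.
Hypothesis hF : hausdorff_space F.
Variables (N : vnorm E) (l : diff_order) (Omega : set E) (W : set (E -> R^o)).
Hypothesis oO : open Omega.
Hypothesis hW : weight_conditions N l Omega W.
Variables (u : E -> F) (k : nat) (q : cseminorm F) (f : E -> R^o).
Hypothesis hu : in_CW_bullet N l W Omega u.
Hypothesis kl : le_order k l.
Hypothesis Wf : W f.

Lemma finite_compact_union (m : nat) (P : nat -> E -> Prop) :
  (forall i, (i < m)%N -> exists K, [/\ compact K, K `<=` Omega &
     forall x, Omega x -> ~ K x -> P i x]) ->
  exists K, [/\ compact K, K `<=` Omega &
    forall i x, (i < m)%N -> Omega x -> ~ K x -> P i x].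
Proof.
elim: m => [|m IH] h; first by exists set0; split=> //; exact: compact0.
have [K [cK KO hK]] := IH (fun i im => h i (ltnW im)).
have [L [cL LO hL]] := h m (ltnSn m).
exists (K `|` L); split; [exact: compactU|by move=> x [/KO|/LO]|].
move=> i x; rewrite ltnS leq_eqVlt => /orP[/eqP->|im] Ox KLx.
  by apply: hL => // Lx; apply: KLx; right.
by apply: hK => // Kx; apply: KLx; left.
Qed.

Let Cu : Ck (Some k) Omega u.
Proof. by have [[/CkP Cu _] _] := hu; exact: Cu. Qed.

Let Cfn n : Ck (Some n) Omega f.
Proof. by have /Ck_NoneP := weight_smooth hW Wf. Qed.

(** Condition (iii) with a single factor bounds the derivatives of [f] by another
    weight, for which the decay of [u] is known. *)
Lemma mixed_decay_single a n (e : R) : (a <= k)%N -> (n <= k)%N -> 0 < e ->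
  exists K, [/\ compact K, K `<=` Omega &
    forall x, Omega x -> ~ K x -> forall v ys, N v <= 1 -> size ys = n ->
      (forall y, y \in ys -> N y <= 1) ->
      `|iter_dderive f (nseq a v) x : R| * q (iter_dderive u ys x) <= e].
Proof.
move=> ak nk e0.
have al : le_order a l by case: (l) kl => //= m; exact: leq_trans.
have [C [g [C0 Wg hg]]] := weight_prod hW (ltn0Sn 0) (fun _ : 'I_1 => Wf) (fun _ : 'I_1 => al).
have {}hg x v : Omega x -> N v <= 1 -> `|iter_dderive f (nseq a v) x : R| <= C * g x.
  move=> /hg; rewrite big_ord1 => hx Nv; rewrite -lee_fin; apply: le_trans hx.
  by apply: ereal_sup_ubound; exists v => //=; rewrite deltaE.
have [P P0 hP] := polarization_bound hF (vnorm_seminorm N) n.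
(* [C] stems from the weight condition and [P] from polarization; adding 1 keeps the divisor
   positive when [P] is 0. *)
have [_ /(_ g k q (e / (C * P + 1)) Wg kl)] := hu.
have CP : 0 < C * P + 1 by rewrite ltr_wpDl// mulr_ge0// ltW.
case; first by rewrite divr_gt0.
move=> K [cK KO hK]; exists K; split=> // x Ox Kx v ys Nv sys Nys.
have g0 : 0 <= g x by exact: (weight_ge0 hW).
have hq y : N y <= 1 -> g x * q (iter_dderive u (nseq n y) x) <= e / (C * P + 1).
  move=> Ny; rewrite -lee_fin; apply: le_trans (ltW hK); rewrite -deltaE EFinM.
  by rewrite -{1}(ger0_norm g0); apply: weighted_norm_ge.
(* Where [g] vanishes, the weight condition makes the derivative of [f] vanish too. *)
have [gx0|gx0] := eqVneq (g x : R) 0.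
  have := hg x v Ox Nv; rewrite gx0 mulr0 normr_le0 => /eqP ->.
  by rewrite normr0 mul0r ltW.
have gp : 0 < (g x : R) by rewrite lt_neqAle eq_sym gx0.
have Cun : Ck (Some n) Omega u by exact: Ck_leqn Cu.
have := hP u Omega x q (e / (C * P + 1) / g x) oO Cun Ox.
move=> /(_ _ ys sys Nys) h.
apply: (@le_trans _ _ ((C * g x) * (P * (e / (C * P + 1) / g x)))).
  apply: ler_pM => //; [exact: cseminorm_ge0|exact: hg|].
  by apply: h => y Ny; rewrite ler_pdivlMr// mulrC; exact: hq.
have -> : C * g x * (P * (e / (C * P + 1) / g x)) = e * (C * P / (C * P + 1)).
  by field; rewrite gx0 gt_eqF.
by rewrite ler_piMr ?(ltW e0)// ler_pdivrMr// mul1r lerDl.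
Qed.

Lemma mixed_decay (e : R) : 0 < e -> exists K, [/\ compact K, K `<=` Omega &
  forall x, Omega x -> ~ K x -> forall a v ys, (a <= k)%N -> (size ys <= k)%N ->
    N v <= 1 -> (forall y, y \in ys -> N y <= 1) ->
    `|iter_dderive f (nseq a v) x : R| * q (iter_dderive u ys x) <= e].
Proof.
move=> e0.
pose P a n x := forall v ys, N v <= 1 -> size ys = n ->
  (forall y, y \in ys -> N y <= 1) ->
  `|iter_dderive f (nseq a v) x : R| * q (iter_dderive u ys x) <= e.
have [K [cK KO hK]] := @finite_compact_union k.+1
  (fun a x => forall n, (n < k.+1)%N -> P a n x)
  (fun a ak => match @finite_compact_union k.+1 (P a)
      (fun n nk => mixed_decay_single ak nk e0) with
    ex_intro K (And3 h1 h2 h3) => ex_intro _ K (And3 h1 h2 (fun x Ox Kx n nk => h3 n x nk Ox Kx)) end).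
exists K; split=> // x Ox Kx a v ys ak sk Nv Nys.
exact: (hK a x ak Ox Kx (size ys) sk).
Qed.

(** Follow the segment from [x] towards [z] up to its first exit point from
    [Omega]: all derivatives of [f * D_y^i u] along it are small by [mixed_decay] and
    tend to [0] at the exit point, so integrating [k - i] times gains the factor
    [s ^+ (k - i)], which compensates the growth of the derivatives of a cutoff of
    width [s]. *)
Lemma boundary_estimate (e : R) : 0 < e -> exists2 r : R, 0 < r & forall x z (s : R),
  Omega x -> ~ Omega z -> `|z - x| <= s -> 0 < s -> s < r ->
  forall i y, (i <= k)%N -> N y <= 1 ->
  f x * q (iter_dderive u (nseq i y) x) <= e * s ^+ (k - i).
Proof.
move=> e0; have hN := vnorm_seminorm N.
have [C C0 hC] := vnorm_upper N.
(* [C] compares [N] with the maximum norm, so that dividing [w] by [D * s] yields [N v <= 1]; the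
   bound [1 <= D] is for comparing powers of [D] at the end. *)
pose D := C + 1; have D0 : 0 < D by rewrite addr_gt0.
have D1 : 1 <= D by rewrite lerDr ltW.
pose e1 := e / (2 ^+ k * D ^+ k).
have e10 : 0 < e1 by rewrite divr_gt0// mulr_gt0// exprn_gt0.
have [K [cK KO hK]] := mixed_decay e10.
(* Points of [K] have distance at least [r] from the complement of [Omega], so the segment towards
   the exit point, being shorter than [r], avoids [K]. *)
have [r r0 hr] := @compact_uniform_continuity _ _ _ K Omega (cst (0 : R^o)) abs_seminorm 1
  cK oO KO (fun x _ => cvg_cst _) ltr01.
exists r => // x z s Ox Oz xzs s0 sr i y ik Ny.
have [z' [Oz' zz' seg]] := first_exit oO Ox Oz.
pose w := z' - x; have ws : `|w| <= s by exact: le_trans xzs.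
pose t0 := D * s; have t00 : 0 < t0 by rewrite mulr_gt0.
pose v := t0^-1 *: w.
have Nv : N v <= 1.
  rewrite (seminormZ hN) gtr0_norm ?invr_gt0// ler_pdivrMl// mulr1.
  apply: le_trans (hC _) _; apply: ler_pM => //; first exact: ltW.
  by rewrite lerDl.
pose p (t : R) := x + (t * t0) *: v.
have pE t : p t = x + t *: w by rewrite /p /v scalerA mulfK ?gt_eqF.
have pO t : 0 <= t < 1 -> Omega (p t) by rewrite pE; exact: seg.
have pz t : 0 <= t < 1 -> `|p t - z'| <= (1 - t) * s.
  move=> /andP[t_0 t_1]; rewrite pE (_ : x + t *: w - z' = - ((1 - t) *: w)).
    by rewrite normrN normrZ gtr0_norm ?subr_gt0// ler_wpM2l// subr_ge0 ltW.
  rewrite /w scalerBl scale1r opprB opprB; apply/matrixP => a b; rewrite !mxE; ring.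
have pK t : 0 <= t < 1 -> ~ K (p t).
  move=> t01 Kp; have [] := hr (p t) z' Kp; last by move=> /Oz'.
  apply: le_lt_trans (pz t t01) _; apply: le_lt_trans sr.
  by rewrite ler_piMl ?(ltW s0)//; case/andP: t01 => *; lra.
pose g x := (f x : R) *: iter_dderive u (nseq i y) x.
have Cg : Ck (Some (k - i)%N) Omega g.
  apply: (Ck_scale (@norm_hausdorff _ _) hF) => //.
  by apply: Ck_iter_dderive; rewrite size_nseq subnKC.
have leib j x' e' : (j <= k - i)%N -> Omega x' -> (forall a v ys, (a <= k)%N -> (size ys <= k)%N ->
    N v <= 1 -> (forall y, y \in ys -> N y <= 1) ->
    `|iter_dderive f (nseq a v) x' : R| * q (iter_dderive u ys x') <= e') ->
    q (iter_dderive g (nseq j v) x') <= 2 ^+ j * e'.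
  move=> jk Ox' h.
  have Cuj : Ck (Some j) Omega (iter_dderive u (nseq i y)).
    apply: Ck_iter_dderive; rewrite size_nseq; apply: (Ck_leqn _ Cu).
    by rewrite -leq_subRL.
  apply: (leibniz_bound hF (@norm_hausdorff _ _) oO (Cfn j) Cuj Ox').
  move=> b bj; rewrite -[iter_dderive (iter_dderive _ _) _]foldl_cat; apply: h => //.
  - exact: leq_trans bj (leq_trans jk (leq_subr _ _)).
  - rewrite size_cat !size_nseq -leq_subRL//; exact: leq_trans (leq_subr _ _) jk.
  - by move=> y'; rewrite mem_cat => /orP[] /nseqP[->].
pose M := 2 ^+ k * e1.
have M00 : 0 <= M by rewrite mulr_ge0 ?exprn_ge0// ltW.
(* Downward induction on the order of the derivative of [g]: each integration towards the exit point
   contributes a factor [t0]. *)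
have claim m : (m <= k - i)%N -> forall t, 0 <= t < 1 ->
    q (iter_dderive g (nseq (k - i - m) v) (p t)) <= t0 ^+ m * M.
  elim: m => [|m IH] mk t t01.
    rewrite expr0 mul1r subn0; apply: le_trans (leib _ _ e1 _ _ _) _ => //; first exact: pO.
      exact: hK (pO t t01) (pK t t01).
    by rewrite ler_wpM2r ?(ltW e10)// ler_weXn2l ?ler1n// leq_subr.
  set j := (k - i - m.+1)%N; have jm : (k - i - m = j.+1)%N by rewrite /j subnS prednK// subn_gt0.
  have M0 : 0 <= t0 ^+ m * M by rewrite mulr_ge0// exprn_ge0// ltW.
  apply/ler_addgt0Pr => e' e'0.
  (* Nothing is known about [u] at the exit point itself. It lies outside [Omega], however, hence
     off the compact set [K'], so the derivative is at most [e'] at a point [p t'] shortly before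
     it. *)
  have e2 : 0 < e' / 2 ^+ k by rewrite divr_gt0// exprn_gt0.
  have [K' [cK' K'O hK']] := mixed_decay e2.
  have : nbhs z' (~` K').
    apply: open_nbhs_nbhs; split; last by move=> /K'O.
    by apply: closed_openC; apply: compact_closed => //; exact: norm_hausdorff.
  move=> /nbhs_ballP[rho /= rho0 hrho].
  have /andP[t_0 t_1] := t01.
  pose dt := Num.min (1 - t) (rho / (2 * s)); pose t' := 1 - dt.
  have dt0 : 0 < dt by rewrite lt_min subr_gt0 t_1 divr_gt0// mulr_gt0.
  have dtt : dt <= 1 - t by rewrite ge_min lexx.
  have dts : dt * s < rho.
    apply: (@le_lt_trans _ _ (rho / (2 * s) * s)).
      by rewrite ler_wpM2r ?(ltW s0)// ge_min lexx orbT.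
    by rewrite invfM mulrA mulfVK ?gt_eqF// ltr_pdivrMr// ltr_pMr// ltr1n.
  have tt' : t <= t' by rewrite /t'; lra.
  have t'1 : 0 <= t' < 1 by rewrite /t'; lra.
  have K't' : ~ K' (p t').
    apply: hrho; rewrite -ball_normE /= distrC; apply: le_lt_trans (pz t' t'1) _.
    by rewrite /t' opprB addrCA subrr addr0.
  have ht' : q (iter_dderive g (nseq j v) (p t')) <= e'.
    apply: le_trans (leib _ _ (e' / 2 ^+ k) _ _ _) _; first exact: leq_subr.
    - exact: pO.
    - exact: hK' (pO _ t'1) K't'.
    - rewrite mulrA ler_pdivrMr ?exprn_gt0// mulrC ler_wpM2l ?(ltW e'0)//.
      by rewrite ler_weXn2l ?ler1n// (leq_trans (leq_subr _ _) (leq_subr _ _)).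
  pose c r' := iter_dderive g (nseq j v) (p r').
  have hAB : q (c t' - c t) <= (t0 * (t0 ^+ m * M)) * (t' - t).
    apply: (@cseminorm_mvt _ _ c (fun r' => t0 *: iter_dderive g (nseq j.+1 v) (p r'))) => //.
  - move=> tau /andP[h1 h2]; have tau1 : 0 <= tau < 1 by case/andP: t'1 => *; lra.
    apply: line_curve_derivative.
    have -> : nseq j.+1 v = rcons (nseq j v) v by rewrite -cats1 -[[:: v]]/(nseq 1 v) -nseqD addn1.
    rewrite iter_dderive_rcons; apply: dderivableP => //.
    apply: (Ck_dderivable (n := 0) (U := Omega)); last exact: pO.
  apply: Ck_iter_dderive; rewrite size_nseq; apply: (Ck_leqn _ Cg).
    by rewrite addn1 -jm leq_subr.
  - move=> tau /andP[h1 h2]; have tau1 : 0 <= tau < 1 by case/andP: t'1 => *; lra.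
    by rewrite cseminormZ gtr0_norm// ler_wpM2l ?(ltW t00)// -jm; apply: IH => //; exact: ltnW.
  have qB : q (c t) <= q (c t') + q (c t' - c t).
    by rewrite cseminorm_distC -[X in q X <= _](subrK (c t') (c t)) addrC; exact: cseminormD.
  apply: le_trans qB _; rewrite addrC; apply: lerD => //.
  apply: le_trans hAB _; rewrite exprS -[leRHS]mulrA ler_piMr//.
    by rewrite mulr_ge0// ltW.
  by case/andP: t'1 => *; lra.
have := claim (k - i)%N (leqnn _) 0; rewrite subnn lexx ltr01 => /(_ isT).
rewrite /p mul0r scale0r addr0 /= /g cseminormZ ger0_norm; last exact: (weight_ge0 hW).
move=> h; apply: le_trans h _.
rewrite /M /e1 /t0 exprMn.
have -> : D ^+ (k - i) * s ^+ (k - i) * (2 ^+ k * (e / (2 ^+ k * D ^+ k))) =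
    e * s ^+ (k - i) * (D ^+ (k - i) / D ^+ k).
  by field; rewrite expf_neq0 ?gt_eqF.
rewrite ler_piMr//; first by rewrite mulr_ge0// ?exprn_ge0 ?ltW.
by rewrite ler_pdivrMr ?exprn_gt0// mul1r ler_weXn2l// leq_subr.
Qed.

End decay.

Lemma cseminorm_dominate {R : realType} {F : tvsType R} m (q : 'I_m -> cseminorm F) :
  exists Q : cseminorm F, forall i y, q i y <= Q y.
Proof.
elim: m q => [|m IH] q.
  have h0 : is_seminorm (fun _ : F => 0 : R) by split=> [x y|a x]; rewrite ?addr0 ?mulr0.
  by exists (CSeminorm h0 (fun x => @cvg_cst _ _ _ _ _)) => -[].
have [Q hQ] := IH (fun i => q (lift ord0 i)).
exists (cseminorm_add (q ord0) Q) => i y /=.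
case: (unliftP ord0 i) => [j|] ->.
  by apply: le_trans (hQ j y) _; rewrite lerDr cseminorm_ge0.
by rewrite lerDl cseminorm_ge0.
Qed.

(** * Cutting off and smoothing in the modelling space *)

Section cutting.
Context {R : realType} {d : nat} {F : tvsType R}.
Local Notation E := 'rV[R]_d.
Hypothesis hF : hausdorff_space F.
Implicit Types (x y : E) (I : seq 'I_d).

Definition is_cutoff k (Omega : set E) (delta r : R) (chi : E -> R^o) :=
  [/\ Ck None setT chi, forall x, 0 <= (chi x : R) <= 1,
    forall x, (chi x : R) != 0 -> `|x| < r + (2 * k.+2)%:R * delta /\
      forall y, `|y - x| < delta -> Omega y,
    forall x, `|x| < r -> (forall y, `|y - x| < (2 * k.+3)%:R * delta -> Omega y) ->
      chi x = 1 &
    forall I x, (size I <= k)%N -> `|partials I chi x : R| <= (2 / delta) ^+ size I].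

Lemma cutoff_exists k (Omega : set E) (delta r : R) : 0 < delta -> 0 < r ->
  exists chi, is_cutoff k Omega delta r chi.
Proof. by have [S [S1 S2]] := @steps R; exact: smooth_cutoff. Qed.

Variables (N : vnorm E) (l : diff_order) (Omega : set E) (W : set (E -> R^o)).
Hypothesis oO : open Omega.
Hypothesis hW : weight_conditions N l Omega W.
Variables (u : E -> F) (k : nat).
Hypothesis hu : in_CW_bullet N l W Omega u.
Hypothesis kl : le_order k l.

(** The remainder of [u] after the cutoff, in the form [a *: u + v] to which the linearity lemmas
    apply. *)
Definition cut_rest (chi : E -> R^o) : E -> F := (-1 : R) *: (fun x => (chi x : R) *: u x) + u.

Let Cu : Ck (Some k) Omega u.
Proof. by have [[/CkP Cu _] _] := hu; exact: Cu. Qed.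

Let cut_rest_bound (f : E -> R^o) (q : cseminorm F) (chi : E -> R^o) x y n (e : R) :
  Ck None setT chi -> (n <= k)%N -> Omega x -> 0 <= (f x : R) ->
  (forall j, (j <= n)%N -> `|iter_dderive chi (nseq j y) x : R| *
     (f x * q (iter_dderive u (nseq (n - j) y) x)) <= e) ->
  f x * q (iter_dderive u (nseq n y) x) <= e ->
  f x * q (iter_dderive (cut_rest chi) (nseq n y) x) <= (2 ^+ n + 1) * e.
Proof.
move=> Cchi nk Ox f0 h h0.
have Cun : Ck (Some n) Omega u by exact: Ck_leqn Cu.
have Cchin : Ck (Some n) Omega chi.
  by have /Ck_NoneP/(_ n) := Cchi; apply: Ck_subset.
have Cs := Ck_scale (@norm_hausdorff _ _) hF oO Cchin Cun.
have nn : le_order n (Some n) by exact: leqnn.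
rewrite (iter_dderive_lin hF _ oO) ?inE//; last 2 first.
- by rewrite size_nseq; exact: Ck_below Cs nn.
- by rewrite size_nseq; exact: Ck_below Cun nn.
rewrite !fctE scaleN1r mulrDl mul1r.
have [fx0|fx0] := eqVneq (f x : R) 0.
  have e0 : 0 <= e by apply: le_trans h0; rewrite fx0 mul0r.
  by rewrite fx0 mul0r -[X in X + _]/(2 ^+ n * e) addr_ge0// mulr_ge0// exprn_ge0.
have fp : 0 < (f x : R) by rewrite lt_neqAle eq_sym fx0.
apply: (@le_trans _ _ (f x * (q (iter_dderive (fun x => (chi x : R) *: u x) (nseq n y) x) +
    q (iter_dderive u (nseq n y) x)))).
  by rewrite ler_wpM2l//; apply: le_trans (cseminormD _ _ _) _; rewrite cseminormN.
rewrite mulrDr; apply: lerD => //.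
rewrite -ler_pdivlMl// mulrCA.
apply: (leibniz_bound hF (@norm_hausdorff _ _) oO Cchin Cun Ox) => j jn.
by rewrite ler_pdivlMl// mulrCA; exact: h.
Qed.

(** Three kinds of points: far out, [mixed_decay] beats the factor [D ^+ k], fixed by then; near the
    complement of [Omega], the powers of the distance in [boundary_estimate] cancel the powers of
    [delta^-1]; elsewhere [chi] is 1 nearby and the remainder vanishes. *)
Lemma cut_rest_small (f : E -> R^o) (q : cseminorm F) (e : R) : W f -> 0 < e ->
  \forall delta \near (0 : R)^'+, \forall r \near +oo, forall chi,
    is_cutoff k Omega delta r chi ->
    forall x y n, Omega x -> N y <= 1 -> (n <= k)%N ->
      f x * q (iter_dderive (cut_rest chi) (nseq n y) x) <= e.
Proof.
move=> Wf e0.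
have [C C0 hC] := @iter_dderive_bound R d R^o (@norm_hausdorff _ _) N.
(* One more than the margin at which a cutoff equals 1, in units of [delta], so that at the
   remaining points it equals 1 on a whole neighbourhood. *)
pose A : R := (2 * k.+3)%:R + 1.
have A0 : 0 < A by rewrite ltr_wpDl.
pose e1 : R := e / (2 ^+ k + 1).
have e10 : 0 < e1 by rewrite divr_gt0// ltr_wpDl// exprn_ge0.
(* [2 * C * A] is the growth rate [C * (2 / delta)] of the cutoff times the distance [A * delta];
   being free of [delta], it fixes the boundary tolerance before [delta] is chosen. *)
pose B := 1 + 2 * C * A.
have CA0 : 0 <= 2 * C * A by rewrite !mulr_ge0// ltW.
have B1 : 1 <= B by rewrite lerDl.
have B0 : 0 < B by exact: lt_le_trans B1.
have Bk0 : 0 < B ^+ k by exact: exprn_gt0.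
have e3 : 0 < e1 / B ^+ k by rewrite divr_gt0.
have [r1 r10 hr1] := boundary_estimate hF oO hW q hu kl Wf e3.
near=> delta.
have d0 : 0 < delta by near: delta; exact: nbhs_right_gt.
have dA : delta * A < Num.min r1 1.
  rewrite -ltr_pdivlMr//; near: delta; apply: nbhs_right_lt.
  by rewrite divr_gt0// lt_min r10 ltr01.
(* Powers of [D] bound the derivatives of the cutoff; since [D] depends on [delta], so do the
   compact set and the radius below. *)
pose D := 1 + C * (2 / delta).
have D0' : 0 <= C * (2 / delta) by rewrite mulr_ge0 ?divr_ge0 ?(ltW C0)// ltW.
have D1 : 1 <= D by rewrite lerDl.
have D0 : 0 < D by exact: lt_le_trans D1.
have e2 : 0 < e1 / D ^+ k by rewrite divr_gt0// exprn_gt0.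
have [K [cK KO hK]] := mixed_decay hF oO hW q hu kl Wf e2.
have [M [_ hM]] := compact_bounded cK.
near=> r.
have rM : M + 1 < r by near: r; apply: nbhs_pinfty_gt; exact: num_real.
move=> chi [Cchi chi01 _ chi1 chid] x y n Ox Ny nk.
have f0 : 0 <= (f x : R) by exact: (weight_ge0 hW).
have chiD j : (j <= n)%N -> `|iter_dderive chi (nseq j y) x : R| <= (C * (2 / delta)) ^+ j.
  move=> jn; rewrite exprMn; apply: (hC j chi setT x abs_seminorm) => //.
  - exact: openT.
  - by have /Ck_NoneP := Cchi.
  - by rewrite exprn_ge0// divr_ge0// ltW.
  - by move=> I sI; rewrite -sI; apply: chid; rewrite sI (leq_trans jn nk).
have bad : (forall j, (j <= n)%N -> `|iter_dderive chi (nseq j y) x : R| *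
     (f x * q (iter_dderive u (nseq (n - j) y) x)) <= e1) ->
    f x * q (iter_dderive u (nseq n y) x) <= e1 ->
    f x * q (iter_dderive (cut_rest chi) (nseq n y) x) <= e.
  move=> h1 h2; apply: le_trans (cut_rest_bound Cchi nk Ox f0 h1 h2) _.
  rewrite /e1 mulrCA ler_piMr ?(ltW e0)// ler_pdivrMr ?ltr_wpDl ?exprn_ge0// mul1r.
  by rewrite lerD2r ler_weXn2l// ler1n.
have [xr|xr] := leP r `|x|.
  have Kx : ~ K x.
    have M1 : M < M + 1 by rewrite ltrDl.
    by move=> Kx; have := hM _ M1 x Kx; rewrite /= leNgt (lt_le_trans rM xr).
  have hq i : (i <= k)%N -> f x * q (iter_dderive u (nseq i y) x) <= e1 / D ^+ k.
    move=> ik; have := hK x Ox Kx 0%N y (nseq i y) (leq0n k); rewrite size_nseq => /(_ ik Ny).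
    rewrite /= ger0_norm//; apply => z /nseqP[->]//.
  have e1D : e1 / D ^+ k <= e1.
    by rewrite ler_pdivrMr ?exprn_gt0// ler_peMr ?(ltW e10)// exprn_ege1.
  apply: bad; last by apply: le_trans (hq n nk) _.
  move=> j jn; have nj : (n - j <= k)%N by exact: leq_trans (leq_subr _ _) nk.
  apply: (@le_trans _ _ (D ^+ k * (e1 / D ^+ k))).
    apply: ler_pM => //; [by rewrite mulr_ge0// cseminorm_ge0| |exact: hq].
    apply: le_trans (chiD j jn) _; apply: (@le_trans _ _ (D ^+ j)).
      by rewrite lerXn2r ?nnegrE ?(ltW D0)// lerDr.
    by rewrite ler_weXn2l// (leq_trans jn nk).
  by rewrite mulrCA divff ?mulr1// gt_eqF// exprn_gt0.
have [[z [xz Oz]]|good] := pselect (exists z, `|z - x| < A * delta /\ ~ Omega z).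
  pose s := A * delta; have s0 : 0 < s by rewrite mulr_gt0.
  have [sr s1] : s < r1 /\ s < 1 by apply/andP; rewrite -lt_min /s mulrC.
  have hq i : (i <= k)%N -> f x * q (iter_dderive u (nseq i y) x) <= e1 / B ^+ k * s ^+ (k - i).
    by move=> ik; apply: (hr1 x z s) => //; exact: ltW.
  have e1B : e1 / B ^+ k <= e1.
    by rewrite ler_pdivrMr// ler_peMr ?(ltW e10)// exprn_ege1.
  apply: bad.
    move=> j jn; have nj : (n - j <= k)%N by exact: leq_trans (leq_subr _ _) nk.
    apply: (@le_trans _ _ ((C * (2 / delta)) ^+ j * (e1 / B ^+ k * s ^+ (k - (n - j))))).
      apply: ler_pM => //; [by rewrite mulr_ge0// cseminorm_ge0|exact: chiD|exact: hq].
    rewrite subnA// addnC exprD mulrCA (mulrA (_ ^+ j)) -exprMn.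
    have -> : C * (2 / delta) * s = 2 * C * A by rewrite /s; field; rewrite gt_eqF.
    rewrite mulrA -[leRHS]mulr1; apply: ler_pM => //.
    - by rewrite mulr_ge0 ?(ltW e3)// exprn_ge0.
    - by rewrite exprn_ge0// ltW.
    - rewrite mulrAC -mulrA ler_piMr ?(ltW e10)// ler_pdivrMr// mul1r.
      apply: (@le_trans _ _ (B ^+ j)).
        by rewrite lerXn2r ?nnegrE ?(ltW B0)// lerDr.
      by rewrite ler_weXn2l// (leq_trans jn nk).
    - by rewrite exprn_ile1 ?(ltW s0) ?(ltW s1).
  apply: le_trans (hq n nk) _; rewrite -[leRHS]mulr1; apply: ler_pM => //.
  - exact: ltW.
  - by rewrite exprn_ge0// ltW.
  - by rewrite exprn_ile1 ?(ltW s0) ?(ltW s1).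
pose rho := Num.min (r - `|x|) delta.
have rho0 : 0 < rho by rewrite lt_min subr_gt0 xr.
have oB : open [set z | `|z - x| < rho].
  rewrite (_ : [set z | _] = ball x rho); first exact: ball_open.
  by apply/seteqP; split=> z; rewrite -ball_normE /= distrC.
rewrite (iter_dderive_vanish hF _ oB (x := x)) ?cseminorm0 ?mulr0 ?(ltW e0)//; last first.
  by rewrite /= subrr normr0.
move=> z /= zx; rewrite /cut_rest !fctE chi1 ?scale1r ?scaleN1r ?addNr//.
  rewrite -(subrK x z); apply: le_lt_trans (ler_normD _ _) _.
  by rewrite -ltrBrDr; apply: lt_le_trans zx _; rewrite ge_min lexx.
move=> t tz; apply: contrapT => Ot; apply: good; exists t; split=> //.
rewrite -(subrK z t) -addrA; apply: le_lt_trans (ler_normD _ _) _.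
rewrite /A mulrDl mul1r; apply: ltrD => //.
by apply: lt_le_trans zx _; rewrite ge_min lexx orbT.
Unshelve. all: by end_near. Qed.

Lemma compact_inner (Q : set E) (r delta : R) :
  compact [set x | `|x| <= r /\ forall y, `|y - x| < delta -> Q y].
Proof.
rewrite (_ : [set x | _] =
    [set x | `|x| <= r] `&` ~` \bigcup_(y in ~` Q) ball y delta).
  apply: compact_closedI; first exact: compact_closed_ball.
  by apply: open_closedC; apply: bigcup_open => y _; exact: ball_open.
apply/seteqP; split=> x [xr h]; split=> //.
  by move=> [y Qy]; rewrite -ball_normE /= => /h.
by move=> y yx; apply: contrapT => Qy; apply: h; exists y => //; rewrite -ball_normE.
Qed.

(** The error splits into that of the cutoff and that of the smoothing. The latter lives in the
    compact set [K2], where the finitely many weights have a common bound [Bt], and one seminorm [Q]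
    dominates all the [q i]. *)
Lemma smooth_cut_approx m (f : 'I_m -> E -> R^o) (q : 'I_m -> cseminorm F) (e : R) :
  (forall i, W (f i)) -> (forall x, ~ Omega x -> u x = 0) -> 0 < e ->
  exists v K, [/\ compact K, K `<=` Omega, Ck None setT v, forall x, ~ K x -> v x = 0 &
    forall i x y n, Omega x -> N y <= 1 -> (n <= k)%N ->
      f i x * q i (iter_dderive ((-1 : R) *: v + u) (nseq n y) x) <= e].
Proof.
move=> Wf u0 e0; have e2 : 0 < e / 2 by rewrite divr_gt0.
have : \forall delta \near (0 : R)^'+, forall i, \forall r \near +oo, forall chi,
    is_cutoff k Omega delta r chi ->
    forall x y n, Omega x -> N y <= 1 -> (n <= k)%N ->
      f i x * q i (iter_dderive (cut_rest chi) (nseq n y) x) <= e / 2.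
  by apply: filter_forall => i; exact: cut_rest_small.
move=> hd; near (0 : R)^'+ => delta.
have d0 : 0 < delta by near: delta; exact: nbhs_right_gt.
have : \forall r \near +oo, forall i chi, is_cutoff k Omega delta r chi ->
    forall x y n, Omega x -> N y <= 1 -> (n <= k)%N ->
      f i x * q i (iter_dderive (cut_rest chi) (nseq n y) x) <= e / 2.
  by apply: filter_forall; near: delta; exact: hd.
move=> hr; near (pinfty_nbhs R) => r.
have r0 : 0 < r by near: r; apply: nbhs_pinfty_gt; exact: num_real.
have hcut : forall i chi, is_cutoff k Omega delta r chi ->
    forall x y n, Omega x -> N y <= 1 -> (n <= k)%N ->
      f i x * q i (iter_dderive (cut_rest chi) (nseq n y) x) <= e / 2.
  by near: r; exact: hr.
have [chi hchi] := cutoff_exists k Omega d0 r0; have [Cchi chi01 supp _ _] := hchi.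
pose w : E -> F := fun x => (chi x : R) *: u x.
pose rho := r + (2 * k.+2)%:R * delta.
pose K := [set x | `|x| <= rho /\ forall y, `|y - x| < delta -> Omega y].
pose K2 := [set x | `|x| <= rho + delta / 2 /\ forall y, `|y - x| < delta / 2 -> Omega y].
have d2 : 0 < delta / 2 by rewrite divr_gt0.
have cK : compact K by exact: compact_inner.
have cK2 : compact K2 by exact: compact_inner.
have KO : K `<=` Omega by move=> x [_ h]; apply: h; rewrite subrr normr0.
have K2O : K2 `<=` Omega by move=> x [_ h]; apply: h; rewrite subrr normr0.
have w0 x : ~ K x -> w x = 0.
  move=> Kx; rewrite /w; have [->|c0] := eqVneq (chi x : R) 0; first by rewrite scale0r.
  by exfalso; apply: Kx; have [h1 h2] := supp x c0; split=> //; exact: ltW.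
have Cchik : Ck (Some k) Omega chi by have /Ck_NoneP/(_ k) := Cchi; exact: Ck_subset.
have CwO : Ck (Some k) Omega w by exact: (Ck_scale (@norm_hausdorff _ _) hF oO Cchik Cu).
have oK : open (~` K) by apply: closed_openC; apply: compact_closed => //; exact: norm_hausdorff.
have oK2 : open (~` K2) by apply: closed_openC; apply: compact_closed => //; exact: norm_hausdorff.
(* On [Omega] the map [w] is a product of C^k maps; off the closed set [K], which lies in [Omega],
   it is zero. *)
have Cw : Ck (Some k) setT w.
  apply: Ck_bigcup => x _; have [Kx|Kx] := pselect (K x); first by exists Omega => //; exact: KO.
  exists (~` K) => //; apply: (Ck_eq oK) (Ck0 hF _ _); first by move=> z /[!inE] /w0.
have [Q hQ] := cseminorm_dominate q.
have [C C0 hC] := @iter_dderive_bound R d F hF N.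
have Cf i : Ck None Omega (f i) by exact: (weight_smooth hW).
have hB i : exists B : R, 0 < B /\ forall x, K2 x -> f i x <= B.
  have [B B0 hB] := compact_seminorm_bound abs_seminorm cK2 K2O (h := f i)
    (fun x Ox => Ck_continuous (Cf i) Ox).
  by exists B; split=> // x K2x; exact: le_trans (ler_norm _) (hB x K2x).
have [B hB'] := choice hB.
pose Bt := \sum_i B i + 1; have Bt0 : 0 < Bt.
  by rewrite ltr_wpDl// sumr_ge0// => i _; rewrite ltW//; case: (hB' i).
have BBt i x : K2 x -> f i x <= Bt.
  move=> K2x; apply: le_trans (proj2 (hB' i) x K2x) _; rewrite /Bt (bigD1 i)//= -addrA lerDl.
  by rewrite addr_ge0// sumr_ge0// => j _; rewrite ltW//; case: (hB' j).
pose C' := 1 + C; have C'1 : 1 <= C' by rewrite lerDl ltW.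
have C'0 : 0 < C' by exact: lt_le_trans C'1.
(* The divisor accounts for the weights on [K2] and for the passage from partial derivatives to
   derivatives along vectors with [N y <= 1]. *)
pose e' := e / 2 / (Bt * C' ^+ k).
have e'0 : 0 < e' by rewrite divr_gt0// mulr_gt0// exprn_gt0.
have [S [S1 S2]] := @steps R.
have KK2 x y : K x -> `|y - x| <= delta / 2 -> K2 y.
  move=> [h1 h2] yx; split=> [|z zy].
    rewrite -(subrK x y) addrC; apply: le_trans (ler_normD _ _) _; exact: lerD.
  apply: h2; rewrite -(subrK y z) -addrA; apply: le_lt_trans (ler_normD _ _) _.
  by rewrite [delta]splitr; apply: ltr_leD.
have [v [Cv v0 hv]] := smooth_approximation S1 S2 hF Q cK d2 KK2 cK2 Cw w0 e'0.
exists v, K2; split=> // i x y n Ox Ny nk.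
have f0 : 0 <= (f i x : R) by exact: (weight_ge0 hW).
have nn j : le_order j (Some j) by exact: leqnn.
have Cvn j : Ck (Some j) setT v by have /Ck_NoneP := Cv.
have Cwn : Ck (Some n) setT w by exact: Ck_leqn Cw.
have Cun : Ck (Some n) Omega u by exact: Ck_leqn Cu.
pose vw := (-1 : R) *: v + w.
have Cvw : Ck (Some n) setT vw by exact: (Ck_lin hF _ openT (Cvn n) Cwn).
have -> : (-1 : R) *: v + u = (1 : R) *: vw + cut_rest chi.
  by apply/funext => z; rewrite /vw /cut_rest !fctE scale1r !scaleN1r addrA addrK.
have Ccut : Ck (Some n) Omega (cut_rest chi).
  by apply: (Ck_lin hF) => //; exact: Ck_subset Cwn.
rewrite (iter_dderive_lin hF _ oO) ?inE//; last 2 first.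
- by rewrite size_nseq; exact: (Ck_below (Ck_subset (@subsetT _ _) Cvw) (nn n)).
- by rewrite size_nseq; exact: Ck_below Ccut (nn n).
rewrite !fctE scale1r.
apply: (@le_trans _ _ (f i x * (q i (iter_dderive vw (nseq n y) x) +
    q i (iter_dderive (cut_rest chi) (nseq n y) x)))).
  by rewrite ler_wpM2l//; exact: cseminormD.
rewrite mulrDr [leRHS]splitr; apply: lerD; last exact: hcut.
have [K2x|K2x] := pselect (K2 x); last first.
  rewrite (iter_dderive_vanish hF _ oK2) ?cseminorm0 ?mulr0 ?(ltW e2)//.
  move=> z K2z; rewrite /vw !fctE v0// w0 ?scaler0 ?addr0// => Kz; apply: K2z.
  by apply: (KK2 z z Kz); rewrite subrr normr0 ltW.
apply: (@le_trans _ _ (Bt * (C' ^+ k * e'))).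
  apply: ler_pM => //; [exact: cseminorm_ge0|exact: BBt|].
  apply: le_trans (hQ i _) _; apply: (@le_trans _ _ (C ^+ n * e')).
    apply: (hC n vw setT) => //; [exact: openT|exact: ltW|].
    move=> I sI; rewrite /partials (iter_dderive_lin hF _ openT) ?inE//; last 2 first.
    - by apply: Ck_below (nn _).
    - by rewrite size_map sI; apply: Ck_below (nn n).
    rewrite !fctE scaleN1r addrC cseminorm_distC; apply: hv; by rewrite sI.
  rewrite ler_wpM2r ?(ltW e'0)//; apply: (@le_trans _ _ (C' ^+ n)).
    by rewrite lerXn2r ?nnegrE ?(ltW C0) ?(ltW C'0)// lerDr.
  by rewrite ler_weXn2l.
rewrite mulrA /e' mulrCA divff ?mulr1// gt_eqF// mulr_gt0// exprn_gt0//.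
Unshelve. all: by end_near. Qed.

End cutting.

Lemma open_preimage_in {T U : topologicalType} (O : set T) (D : set U) (f : T -> U) :
  open O -> {in O, continuous f} -> open D -> open (O `&` f @^-1` D).
Proof.
move=> oO cf oD; rewrite openE => x [Ox Dx]; apply: filterI; first exact: open_nbhs_nbhs.
have /cf : x \in O by rewrite inE.
by apply; exact: open_nbhs_nbhs.
Qed.

Lemma continuous_eq_in {T U : topologicalType} (O : set T) (f g : T -> U) :
  open O -> {in O, f =1 g} -> {in O, continuous f} -> {in O, continuous g}.
Proof.
move=> oO fg cf x xO; have Ox : O x by rewrite inE in xO.
rewrite /continuous_at -(fg x xO); apply: cvg_trans (cf x xO); apply: near_eq_cvg.
have : nbhs x O by exact: open_nbhs_nbhs.
by apply: filterS => y Oy; rewrite fg ?inE.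
Qed.

(** * Mapping groups *)

Section manifold_valued.
Context {R : realType} {d : nat} {F : tvsType R} {G : lieGroupType F}.
Local Notation E := 'rV[R]_d.
Implicit Types (b g : E -> G) (O : set E) (x : E) (c : chart F G).

Let hF : hausdorff_space F := @lie_model_hausdorff R F G.
Let hE : hausdorff_space E := @norm_hausdorff _ _.

Lemma Ck_map_subset l O Q b : Q `<=` O -> Ck_map l O b -> Ck_map l Q b.
Proof.
move=> OQ [cb Cb]; split=> [x|c ac]; first by rewrite inE => /OQ Ox; apply: cb; rewrite inE.
by apply: Ck_subset (Cb c ac) => x [/OQ].
Qed.

Lemma Ck_map_leq l O b : Ck_map None O b -> Ck_map l O b.
Proof. by move=> [cb Cb]; split=> // c ac; exact: Ck_leq (Cb c ac). Qed.

Lemma Ck_map_eq l O b b' : open O -> {in O, b =1 b'} -> Ck_map l O b -> Ck_map l O b'.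
Proof.
move=> oO bb' [cb Cb]; split; first exact: continuous_eq_in cb.
move=> c ac; rewrite (_ : _ `&` _ = O `&` b @^-1` chart_dom c); last first.
  by apply/seteqP; split=> x [Ox]; rewrite /= bb' ?inE.
apply: (Ck_eq (open_preimage_in oO cb (chart_dom_open c))) (Cb c ac).
by move=> x /[!inE] -[Ox _]; rewrite /= bb' ?inE.
Qed.

Lemma Ck_map_bigcup l O b :
  (forall x, O x -> exists2 Q, Ck_map l Q b & Q x) -> Ck_map l O b.
Proof.
move=> h; split=> [x|c ac]; first by rewrite inE => /h [Q [cb _] Qx]; apply: cb; rewrite inE.
apply: Ck_bigcup => x [/h[Q [_ Cb] Qx] bx].
by exists (Q `&` b @^-1` chart_dom c); [exact: Cb|].
Qed.

Lemma Ck_map_chart l O b c : lie_atlas c -> (forall x, O x -> chart_dom c (b x)) ->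
  Ck_map l O b -> Ck l O (c \o b).
Proof. by move=> ac bc [_ Cb]; apply: Ck_subset (Cb c ac) => x Ox; split=> //; exact: bc. Qed.

Lemma Ck_map_chart_inv l O (v : E -> F) c : open O -> lie_atlas c ->
  (forall x, O x -> chart_cod c (v x)) -> Ck l O v -> Ck_map l O (chart_inv c \o v).
Proof.
move=> oO ac vc Cv.
have cv : {in O, continuous (chart_inv c \o v)}.
  move=> x /[!inE] Ox; apply: (@continuous_comp _ _ _ v (chart_inv c)).
    exact: Ck_continuous Cv Ox.
  by apply: chart_inv_continuous; rewrite inE; exact: vc.
split=> // c' ac'.
have oT : open (chart_cod c `&` chart_inv c @^-1` chart_dom c').
  apply: open_preimage_in; [exact: chart_cod_open| |exact: chart_dom_open].
  exact: chart_inv_continuous.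
apply: (@Ck_comp _ l E F F hE hF hF _ _ v (c' \o chart_inv c) _ oT).
- exact: open_preimage_in oO cv (chart_dom_open c').
- by move=> x [Ox cx]; split=> //; exact: vc.
- by apply: Ck_subset Cv => x [].
- exact: Ck_leq (lie_atlas_compatible _ _ ac ac').
Qed.

Lemma Ck_map_mul l O b g : open O -> Ck_map l O b -> Ck_map l O g ->
  Ck_map l O (fun x => (b x * g x)%g).
Proof.
move=> oO [cb Cb] [cg Cg].
have cm : {in O, continuous (fun x => (b x * g x)%g)}.
  move=> x xO; apply: (@continuous_comp _ _ _ (fun x => (b x, g x)) (fun p : G * G => (p.1 * p.2)%g)).
    exact: (@cvg_pair _ _ _ _ (nbhs (b x)) (nbhs (g x)) (nbhs_filter x) _ _ b g (cb x xO) (cg x xO)).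
  exact: lie_mulg_continuous.
split=> // c ac; apply: Ck_bigcup => x [Ox mx].
have [c1 a1 d1] := lie_atlas_cover (b x); have [c2 a2 d2] := lie_atlas_cover (g x).
pose U := (O `&` b @^-1` chart_dom c1) `&` (O `&` g @^-1` chart_dom c2) `&`
  (O `&` (fun x => (b x * g x)%g) @^-1` chart_dom c).
have oU : open U.
  apply: openI; last exact: open_preimage_in (chart_dom_open c).
  by apply: openI; apply: open_preimage_in => //; exact: chart_dom_open.
exists U; last by split; [split|].
pose T := [set p : F * F | [/\ chart_cod c1 p.1, chart_cod c2 p.2 &
  chart_dom c (chart_inv c1 p.1 * chart_inv c2 p.2)%g]].
have oT : open T.
  rewrite (_ : T = (chart_cod c1 `*` chart_cod c2) `&`
      (fun p : F * F => (chart_inv c1 p.1 * chart_inv c2 p.2)%g) @^-1` chart_dom c); last first.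
    by apply/seteqP; split=> p /=; [move=> [? ? ?]|move=> [[? ?] ?]].
  apply: open_preimage_in; [|move=> p /[!inE] -[p1 p2]|exact: chart_dom_open].
    rewrite (_ : _ `*` _ = (setT `&` fst @^-1` chart_cod c1) `&` (setT `&` snd @^-1` chart_cod c2)).
      apply: openI; apply: open_preimage_in; (try exact: openT); (try exact: chart_cod_open) => p _.
        exact: cvg_fst.
      exact: cvg_snd.
    by apply/seteqP; split=> p /=; [move=> [? ?]|move=> [[_ ?] [_ ?]]].
  apply: (@continuous_comp _ _ _ (fun p : F * F => (chart_inv c1 p.1, chart_inv c2 p.2))
    (fun p : G * G => (p.1 * p.2)%g)); last exact: lie_mulg_continuous.
  apply: (@cvg_pair _ _ _ _ (nbhs (chart_inv c1 p.1)) (nbhs (chart_inv c2 p.2))).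
    apply: (@continuous_comp _ _ _ fst (chart_inv c1)); first exact: cvg_fst.
    by apply: chart_inv_continuous; rewrite inE.
  apply: (@continuous_comp _ _ _ snd (chart_inv c2)); first exact: cvg_snd.
  by apply: chart_inv_continuous; rewrite inE.
have Cb1 : Ck l U (c1 \o b) by apply: Ck_subset (Cb c1 a1) => y [[]].
have Cg2 : Ck l U (c2 \o g) by apply: Ck_subset (Cg c2 a2) => y [[]].
have h := @Ck_comp _ l E (F * F)%type F hE (prod_hausdorff hF hF) hF U T
  (fun y => (c1 (b y), c2 (g y)))
  (fun p : F * F => c (chart_inv c1 p.1 * chart_inv c2 p.2)%g) oU oT.
have {}h := h _ (Ck_pair hF hF oU Cb1 Cg2) (Ck_leq _ (lie_mulg_smooth _ _ _ a1 a2 ac)).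
apply: Ck_eq (h _ _) => //.
- move=> y /[!inE] -[[[_ y1] [_ y2]] _] /=.
  by rewrite !chart_mapK ?inE.
- move=> y [[[_ y1] [_ y2]] [_ y3]]; split=> /=; [exact: chart_map_cod..|].
  by rewrite !chart_mapK ?inE.
Qed.

End manifold_valued.

Section bump.
Context {R : realType} {d : nat}.
Local Notation E := 'rV[R]_d.
Implicit Types (K Q Omega A : set E).

Lemma compact_closure_inter K Omega A : compact K -> K `<=` Omega -> A `<=` K ->
  compact (closure A `&` Omega).
Proof.
move=> cK KO AK; have clK : closed K by apply: compact_closed => //; exact: norm_hausdorff.
have clA : closure A `<=` K by rewrite [X in _ `<=` X](closure_id K).1//; exact: closure_subset.
rewrite (_ : _ `&` _ = closure A); last by apply/setIidPl; exact: subset_trans KO.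
by apply: subclosed_compact clA => //; exact: closed_closure.
Qed.

Lemma bump_exists K Omega : compact K -> open Omega -> K `<=` Omega ->
  exists h : E -> R^o, exists K2 Q,
  [/\ Ck None setT h, forall x, 0 <= (h x : R) <= 1, compact K2, K2 `<=` Omega &
      forall x, ~ K2 x -> h x = 0] /\
  [/\ open Q, K `<=` Q & forall x, Q x -> h x = 1].
Proof.
move=> cK oO KO.
have [eta eta0 heta] := @compact_uniform_continuity _ _ _ K Omega (cst (0 : R^o)) abs_seminorm 1
  cK oO KO (fun x _ => cvg_cst _) ltr01.
have [M [_ hM]] := compact_bounded cK.
(* A cutoff of order 0 equals 1 at points of norm below [r] whose [6 * delta]-ball lies in [Omega];
   one more [delta] grants this on the whole [delta]-neighbourhood of [K]. The summand [delta] in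
   [r] has the same purpose. *)
pose delta := eta / 7; have d0 : 0 < delta by rewrite divr_gt0.
pose r := `|M| + 1 + delta; have r0 : 0 < r by rewrite addr_gt0// ltr_wpDl.
have [h [Ch h01 supp h1 _]] := cutoff_exists 0 Omega d0 r0.
exists h, [set x | `|x| <= r + (2 * 2)%:R * delta /\ forall y, `|y - x| < delta -> Omega y].
exists (\bigcup_(x in K) ball x delta); split; split=> //.
- exact: compact_inner.
- by move=> x [_]; apply; rewrite subrr normr0.
- move=> x; apply: contra_notP => /eqP/supp[h2 h3]; split=> //; exact: ltW.
- by apply: bigcup_open => x _; exact: ball_open.
- by move=> x Kx; exists x => //; exact: ballxx.
move=> x [z Kz]; rewrite -ball_normE /= => zx; apply: h1.
  have M1 : M < `|M| + 1 by rewrite (le_lt_trans (ler_norm M))// ltrDl.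
  have zM := hM _ M1 z Kz; rewrite -(subrK z x); apply: le_lt_trans (ler_normD _ _) _.
  by rewrite /r [ltRHS]addrC; apply: ltr_leD => //; rewrite distrC.
move=> y yx; suff [] : Omega y /\ abs_seminorm (cst (0 : R^o) y - cst 0 z) <= 1 by [].
apply: heta Kz _; rewrite -(subrK x z) -addrA; apply: le_lt_trans (ler_normD _ _) _.
rewrite (_ : eta = delta + (2 * 3)%:R * delta); last by rewrite /delta; field.
by rewrite distrC in yx; exact: ltrD.
Qed.

End bump.

(** * Smoothing of group-valued maps, chart by chart *)

Section patching.
Context {R : realType} {d : nat} {F : tvsType R} {G : lieGroupType F}.
Local Notation E := 'rV[R]_d.
Implicit Types (b g : E -> G) (Q : set E) (x z : E) (c : chart F G).
Variable Omega : set E.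
Hypothesis oO : open Omega.

Let hF : hausdorff_space F := @lie_model_hausdorff R F G.
Let hE : hausdorff_space E := @norm_hausdorff _ _.

Definition smooth_at b x :=
  exists2 Q, [/\ open Q, Q `<=` Omega & Q x] & Ck_map None Q b.

(** In the chart [c], [b] is replaced by [eta + h * (zeta - eta)], where
    [eta = c \o b] and [zeta] is a smooth approximation of [eta]; smoothness that [b]
    already has is not destroyed. *)
Lemma patch_step b (K : set E) c (U : set G) : {in Omega, continuous b} -> lie_atlas c ->
  compact K -> K `<=` Omega -> (forall x, K x -> chart_dom c (b x)) -> nbhs (1%g : G) U ->
  exists b' K2, [/\ {in Omega, continuous b'}, compact K2, K2 `<=` Omega,
    forall x, ~ K2 x -> b' x = b x & forall x, U ((b' x)^-1 * b x)%g] /\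
    ((forall x, smooth_at b x -> smooth_at b' x) /\ forall x, K x -> smooth_at b' x).
Proof.
move=> cb ac cK KO Kc U1.
pose D := Omega `&` b @^-1` chart_dom c.
have oD : open D by exact: open_preimage_in (chart_dom_open c).
have KD : K `<=` D by move=> x Kx; split; [exact: KO|exact: Kc].
have [h [K2 [Q [[Ch h01 cK2 K2D h0] [oQ KQ hQ]]]]] := bump_exists cK oD KD.
pose eta x := c (b x).
have ceta x : D x -> eta @ x --> eta x.
  move=> [Ox bx]; apply: (@continuous_comp _ _ _ b c); first by apply: cb; rewrite inE.
  by apply: chart_map_continuous; rewrite inE.
pose P y x := chart_cod c (eta x + y) /\ U ((chart_inv c (eta x + y))^-1 * b x)%g.
(* Since [K2] is compact, one neighbourhood of 0 consists of perturbations of [eta] that are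
   admissible at all points of [K2] simultaneously. *)
have : \forall y \near (0 : F), K2 `<=` P y.
  move/compact_near_coveringP : (cK2); apply => x /K2D Dx; have [Ox bx] := Dx.
  have cod_eta : chart_cod c (eta x) by exact: chart_map_cod.
  have cs : (fun p : E * F => eta p.1 + p.2) p @[p --> (x, 0)] --> eta x.
    rewrite -[X in _ --> X]addr0; apply: tvs_cvgD; last exact: cvg_snd.
    by apply: (@cvg_comp _ _ _ fst eta _ (nbhs x)); [exact: cvg_fst|exact: ceta].
  have n1 : \forall p \near ((x, 0) : E * F), chart_cod c (eta p.1 + p.2).
    by apply: cs; apply: open_nbhs_nbhs; split=> //; exact: chart_cod_open.
  have ci : (fun p : E * F => chart_inv c (eta p.1 + p.2)) p @[p --> (x, 0)] --> b x.
    rewrite -[X in _ --> X](@chart_mapK _ _ _ c) ?inE//.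
    apply: (@cvg_comp _ _ _ (fun p : E * F => eta p.1 + p.2) (chart_inv c) _ (nbhs (eta x))) => //.
    by apply: chart_inv_continuous; rewrite inE.
  have civ : (fun p : E * F => (chart_inv c (eta p.1 + p.2))^-1%g) p @[p --> (x, 0)] --> (b x)^-1%g.
    by apply: (@cvg_comp _ _ _ _ (fun g : G => g^-1%g) _ (nbhs (b x))) => //; exact: lie_invg_continuous.
  have cbp : (fun p : E * F => b p.1) p @[p --> (x, 0)] --> b x.
    by apply: (@cvg_comp _ _ _ fst b _ (nbhs x)); [exact: cvg_fst|apply: cb; rewrite inE].
  have cm : (fun p : E * F => ((chart_inv c (eta p.1 + p.2))^-1 * b p.1)%g) p @[p --> (x, 0)] --> (1%g : G).
    rewrite -[X in _ --> X](mulVg (b x)).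
    apply: (@cvg_comp _ _ _ (fun p : E * F => ((chart_inv c (eta p.1 + p.2))^-1%g, b p.1))
      (fun p : G * G => (p.1 * p.2)%g) _ (nbhs ((b x)^-1%g, b x))).
      exact: (@cvg_pair _ _ _ _ (nbhs ((b x)^-1%g)) (nbhs (b x))).
    exact: (lie_mulg_continuous ((b x)^-1%g, b x)).
  have n2 := cm U U1.
  by apply: filterS2 n1 n2 => p h1 h2; split.
move=> /cseminorm_sub_nbhs[q hq].
have h2 : 0 < (2^-1 : R) by rewrite invr_gt0.
have [zeta Czeta hzeta] : exists2 v : E -> F, Ck None setT v &
    forall x, K2 x -> q (v x - eta x) <= 2^-1.
  by have [S [S1 _]] := @steps R; exact: (smooth_uniform_approximation S1 hF q cK2 oD K2D ceta h2).
pose v x := eta x + (h x : R) *: (zeta x - eta x).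
pose b' x := if pselect (K2 x) then chart_inv c (v x) else b x.
have vP x : K2 x -> P ((h x : R) *: (zeta x - eta x)) x.
  move=> K2x; apply: hq => //=; rewrite cseminormZ.
  have /andP[hx0 hx1] := h01 x.
  rewrite ger0_norm//; apply: (@le_lt_trans _ _ (1 * 2^-1)).
    by apply: ler_pM => //; [exact: cseminorm_ge0|exact: hzeta].
  by rewrite mul1r invf_lt1// ltr1n.
have vn x : ~ K2 x -> v x = eta x by move=> /h0 hx; rewrite /v hx scale0r addr0.
have vcod x : D x -> chart_cod c (v x).
  move=> [Ox bx]; have [/vP[]//|/vn ->] := pselect (K2 x); exact: chart_map_cod.
have b'n x : ~ K2 x -> b' x = b x by rewrite /b'; case: pselect.
have b'D : {in D, chart_inv c \o v =1 b'}.
  move=> x /[!inE] -[Ox bx] /=; rewrite /b'; case: pselect => [//|K2x]; rewrite vn//.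
  by rewrite chart_mapK ?inE.
have oK2 : open (~` K2) by apply: closed_openC; exact: compact_closed.
have K2O : K2 `<=` Omega by move=> x K2x; have [Ox _] := K2D x K2x.
exists b', K2; split; [split=> //|split].
- move=> x /[!inE] Ox; have [/K2D Dx|K2x] := pselect (K2 x).
    suff : {in D, continuous b'} by apply; rewrite inE.
    apply: continuous_eq_in oD b'D _ => z /[!inE] Dz.
    apply: (@continuous_comp _ _ _ v (chart_inv c)).
      have hz : h @ z --> h z by exact: Ck_continuous Ch _.
      have zz : zeta @ z --> zeta z by exact: Ck_continuous Czeta _.
      have ez := ceta z Dz.
      exact: (tvs_cvgD (FG := nbhs_filter z) ez (tvs_cvgZ (FG := nbhs_filter z) hz
        (tvs_cvgB (FG := nbhs_filter z) zz ez))).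
    by apply: chart_inv_continuous; rewrite inE; exact: vcod.
  suff : {in Omega `&` ~` K2, continuous b'} by apply; rewrite inE.
  apply: continuous_eq_in (openI oO oK2) _ _ => [z /[!inE] -[_ /b'n ->]//|z /[!inE] -[Oz _]].
  by apply: cb; rewrite inE.
- move=> x; have [K2x|K2x] := pselect (K2 x); last by rewrite b'n// mulVg; exact: nbhs_singleton.
  by have [_] := vP x K2x; rewrite /b'; case: pselect.
- move=> x [B [oB BO Bx] CB]; have [/K2D Dx|K2x] := pselect (K2 x).
    have oBD : open (B `&` D) by exact: openI.
    exists (B `&` D); first by split=> // z [/BO].
    apply: (Ck_map_eq oBD (b := chart_inv c \o v)).
      by move=> z /[!inE] -[_ Dz]; apply: b'D; rewrite inE.
    apply: Ck_map_chart_inv => //; first by move=> z [_]; exact: vcod.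
    have Ceta : Ck None (B `&` D) eta.
      by apply: (Ck_map_chart ac); [move=> z [_ []]|apply: Ck_map_subset CB => z []].
    have Cz : Ck None (B `&` D) zeta by exact: Ck_subset Czeta.
    have Chz : Ck None (B `&` D) h by exact: Ck_subset Ch.
    have -> : v = (1 : R) *: eta + (fun z => (h z : R) *: ((-1 : R) *: eta + zeta) z).
      by apply/funext => z; rewrite !fctE scale1r scaleN1r /v [- _ + _]addrC.
    apply: (Ck_lin hF) => //; apply: Ck_scale => //; exact: (Ck_lin hF).
  exists (B `&` ~` K2); first by split=> //; [exact: openI|move=> z [/BO]].
  apply: (Ck_map_eq (openI oB oK2) (b := b)); first by move=> z /[!inE] -[_ /b'n].
  by apply: Ck_map_subset CB => z [].
- move=> x Kx; have oQD : open (Q `&` D) by exact: openI.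
  exists (Q `&` D); first by split=> //; [move=> z [_ []]|split; [exact: KQ|exact: KD]].
  have vz z : Q z -> v z = zeta z by move=> /hQ hz; rewrite /v hz scale1r addrC subrK.
  apply: (Ck_map_eq oQD (b := chart_inv c \o zeta)).
    by move=> z /[!inE] -[Qz Dz]; rewrite -b'D ?inE//= vz.
  apply: Ck_map_chart_inv => //; last exact: Ck_subset Czeta.
  by move=> z [Qz Dz]; rewrite -vz//; exact: vcod.
Qed.

Lemma nbhs_mulg (U : set G) : nbhs (1%g : G) U ->
  exists2 U', nbhs (1%g : G) U' & forall s t, U' s -> U' t -> U (s * t)%g.
Proof.
move=> U1; have := lie_mulg_continuous ((1, 1) : G * G)%g.
rewrite /continuous_at /= mulg1 => /(_ U U1) [[A B] [/= A1 B1] AB].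
exists (A `&` B); first exact: filterI.
by move=> s t [As _] [_ Bt]; exact: (AB (s, t)).
Qed.

(** [U] is quantified inside the induction because the patches made before the one for [x] must be
    finer than the final requirement: their error is still multiplied by that of the last patch, and
    [b1] must map [K x] into the domain of [c x], which was chosen for [b]. *)
Lemma patch_seq b (K : E -> set E) (c : E -> chart F G) (s : seq E) : {in Omega, continuous b} ->
  (forall x, x \in s -> [/\ lie_atlas (c x), compact (K x), K x `<=` Omega &
     forall z, K x z -> chart_dom (c x) (b z)]) ->
  forall U : set G, nbhs (1%g : G) U ->
  exists b' K2, [/\ {in Omega, continuous b'}, compact K2, K2 `<=` Omega,
    forall x, ~ K2 x -> b' x = b x & forall x, U ((b' x)^-1 * b x)%g] /\
    ((forall x, smooth_at b x -> smooth_at b' x) /\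
     forall x, x \in s -> forall z, K x z -> smooth_at b' z).
Proof.
move=> cb; elim: s => [|x s IH] hs U U1.
  exists b, set0; split; [split=> //; first exact: compact0|by []].
  by move=> x; rewrite mulVg; exact: nbhs_singleton.
have [ac cK KO Kc] := hs x (mem_head _ _).
have [U2 nU2 hU2] := nbhs_mulg U1.
have U3 : \forall t \near (1%g : G), K x `<=` (fun z => chart_dom (c x) (b z * t^-1)%g).
  move/compact_near_coveringP : (cK); apply => z Kz.
  have cm : (fun p : E * G => (b p.1 * p.2^-1)%g) p @[p --> (z, 1%g)] --> b z.
    rewrite -[X in _ --> X]mulg1 -[X in (_ * X)%g]invg1.
    apply: (@cvg_comp _ _ _ (fun p : E * G => (b p.1, p.2^-1%g))
      (fun p : G * G => (p.1 * p.2)%g) _ (nbhs (b z, (1%g)^-1%g))); last first.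
      exact: (lie_mulg_continuous (b z, (1%g)^-1%g)).
    apply: (@cvg_pair _ _ _ _ (nbhs (b z)) (nbhs ((1%g)^-1%g))).
      by apply: (@cvg_comp _ _ _ fst b _ (nbhs z)); [exact: cvg_fst|apply: cb; rewrite inE; exact: KO].
    apply: (@cvg_comp _ _ _ snd (fun g : G => g^-1%g) _ (nbhs 1%g)); first exact: cvg_snd.
    exact: lie_invg_continuous.
  by apply: cm; apply: open_nbhs_nbhs; split; [exact: chart_dom_open|exact: Kc].
have [b1 [K1 [[cb1 cK1 K1O b1n b1U] [sb1 sb1K]]]] :=
  IH (fun y ys => hs y (mem_behead (s := x :: s) ys)) _ (filterI nU2 U3).
have b1c z : K x z -> chart_dom (c x) (b1 z).
  by move=> Kz; have [_ /(_ z Kz)] := b1U z; rewrite /= invgM invgK mulVKg.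
have [b2 [K2 [[cb2 cK2 K2O b2n b2U] [sb2 sb2K]]]] := patch_step cb1 ac cK KO b1c nU2.
exists b2, (K1 `|` K2); split; [split=> //|split].
- exact: compactU.
- by move=> y [/K1O|/K2O].
- by move=> y yK; rewrite b2n ?b1n// => h; apply: yK; [left|right].
- move=> y; rewrite -[b y](mulVKg (b1 y)) mulgA; apply: hU2 => //.
  by have [] := b1U y.
- by move=> y /sb1/sb2.
- move=> y; rewrite inE => /predU1P[->|ys] z Kz; first exact: sb2K.
  by apply: sb2; exact: sb1K Kz.
Qed.

Lemma Ck_map_cst l Q (g : G) : open Q -> Ck_map l Q (fun _ : E => g).
Proof.
move=> oQ; have cc : {in Q, continuous (fun _ : E => g)} by move=> x _; exact: (@cvg_cst _ _ _ (nbhs x)).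

split=> // c ac; apply: (Ck_cst _ hF (c g)).
exact: open_preimage_in (chart_dom_open c).
Qed.

(** Finitely many balls cover [K], each inside a compact set that [b] maps into a single chart
    domain. Off [K] the map is constant, hence smooth already, and patching preserves this. *)
Lemma Cc_map_approx b (K : set E) (U : set G) : {in Omega, continuous b} -> compact K ->
  K `<=` Omega -> (forall x, ~ K x -> b x = 1%g) -> nbhs (1%g : G) U ->
  exists g, [/\ Cc_map Omega g, forall x, ~ Omega x -> g x = 1%g,
     exists K', [/\ compact K', K' `<=` Omega & forall x, ~ K' x -> g x = 1%g] &
     forall x, U ((g x)^-1 * b x)%g].
Proof.
move=> cb cK KO b1 U1.
have h x : exists p : R * (set E * chart F G), K x -> [/\ 0 < p.1, ball x p.1 `<=` p.2.1 &
    [/\ lie_atlas p.2.2, compact p.2.1, p.2.1 `<=` Omega &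
     forall z, p.2.1 z -> chart_dom p.2.2 (b z)]].
  have [c ac bc] := lie_atlas_cover (b x).
  have [Kx|nKx] := pselect (K x); last by exists (0, (set0, c)).
  have oD : open (Omega `&` b @^-1` chart_dom c) by exact: open_preimage_in (chart_dom_open c).
  have : nbhs x (Omega `&` b @^-1` chart_dom c).
    by apply: open_nbhs_nbhs; split=> //; split=> //; exact: KO.
  move=> /nbhs_ballP[e /= e0 he].
  have e2 : 0 < e / 2 by rewrite divr_gt0.
  pose C := [set y | `|y| <= `|x| + 1 /\
     forall z, `|z - y| < e / 2 -> (Omega `&` b @^-1` chart_dom c) z].
  exists (Num.min 1 (e / 2), (C, c)) => _; split=> /=.
  - by rewrite lt_min ltr01.
  - move=> y; rewrite -ball_normE /= lt_min => /andP[y1 y2]; split.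
      rewrite -(subrK x y) addrC; apply: le_trans (ler_normD _ _) _.
      by rewrite lerD2l distrC ltW.
    move=> z zy; apply: he; rewrite -ball_normE /= -(subrK y x) -addrA.
    apply: le_lt_trans (ler_normD _ _) _; rewrite [e]splitr; apply: ltrD => //.
    by rewrite distrC.
  - split=> //; first exact: compact_inner.
      by move=> y [_ /(_ y)]; rewrite subrr normr0 => /(_ e2) [].
    by move=> y [_ /(_ y)]; rewrite subrr normr0 => /(_ e2) [].
have [p hp] := choice h.
have cK' : cover_compact K by rewrite -compact_cover.
have [||D DK Dcov] := cK' E K (fun x => ball x (p x).1).
- by move=> x _; exact: ball_open.
- by move=> x Kx; exists x => //; apply: ballxx; case: (hp x Kx).
have hs x : x \in finmap.enum_fset D -> [/\ lie_atlas (p x).2.2, compact (p x).2.1, (p x).2.1 `<=` Omega &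
     forall z, (p x).2.1 z -> chart_dom (p x).2.2 (b z)].
  by move=> xD; have /DK := xD; rewrite inE => /hp[].
have [g [K2 [[cg cK2 K2O gn gU] [sg sgK]]]] := patch_seq cb hs U1.
have g1 x : ~ (K `|` K2) x -> g x = 1%g.
  by move=> xK; rewrite gn ?b1// => ?; apply: xK; [left|right].
have KKO : K `|` K2 `<=` Omega by move=> x [/KO|/K2O].
exists g; split=> //.
- split; last first.
    apply: (@compact_closure_inter R d (K `|` K2)) => //; first exact: compactU.
    by move=> x [Ox]; apply: contra_notP => /g1.
  apply: Ck_map_bigcup => x Ox; suff [Q [oQ QO Qx] CQ] : smooth_at g x by exists Q.
  have [Kx|Kx] := pselect (K x).
    have [y yD yx] := Dcov x Kx; apply: (sgK y yD).
    by have /DK := yD; rewrite inE => /hp[_ + _]; apply.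
  apply: sg; have oK : open (Omega `&` ~` K).
    by apply: openI => //; apply: closed_openC; exact: compact_closed.
  exists (Omega `&` ~` K); first by split=> // z [].
  by apply: Ck_map_eq (Ck_map_cst None 1%g oK) => // z /[!inE] -[_ /b1].
- by move=> x Ox; apply: g1 => /KKO.
- by exists (K `|` K2); split; [exact: compactU|exact: KKO|exact: g1].
Qed.

End patching.

Lemma seminorm_sub {R : realType} {V : lmodType R} (p : V -> R) x y : is_seminorm p ->
  p (x - y) = p ((-1 : R) *: x + y).
Proof.
move=> hp; rewrite (_ : _ + y = (-1 : R) *: (x - y)).
  by rewrite (seminormZ hp) normrN1 mul1r.
by rewrite scalerBr !scaleN1r opprK.
Qed.

Lemma le_order_bigmax m (k : 'I_m -> nat) (l : diff_order) :
  (forall j, le_order (k j) l) -> le_order (\max_j k j)%N l.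
Proof. by case: l => //= n h; apply/bigmax_leqP => j _; exact: h. Qed.

Section extension.
Context {R : realType} {d : nat} {F : tvsType R}.
Local Notation E := 'rV[R]_d.
Hypothesis hF : hausdorff_space F.
Variables (N : vnorm E) (l : diff_order) (W : set (E -> R^o)).

(** Near [K] the map [u] vanishes with all its derivatives, so [K] adds nothing to the weighted
    norms, and the compact sets that witness the decay of [w] serve for [u] as well. *)
Lemma in_CW_bullet_extend (Omega K O : set E) (u w : E -> F) : open Omega -> compact K ->
  K `<=` Omega -> open O -> K `<=` O ->
  (forall x, Omega x -> ~ K x -> u x = w x) -> (forall x, O x -> Omega x -> u x = 0) ->
  in_CW_bullet N l W (Omega `\` K) w -> in_CW_bullet N l W Omega u.
Proof.
move=> oO cK KO oQ KQ uw u0 [[Cw Ww] Bw].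
have oOK : open (Omega `\` K).
  apply: openI => //; apply: closed_openC; apply: compact_closed => //; exact: norm_hausdorff.
have wu : {in Omega `\` K, w =1 u} by move=> x /[!inE] -[Ox Kx]; rewrite uw.
have oOO : open (O `&` Omega) by exact: openI.
have le S q f k : S `<=` Omega -> (weighted_norm N S q f k u <= weighted_norm N (S `\` K) q f k w)%E.
  move=> SO; apply: weighted_norm_le; first exact: weighted_norm_ge0.
  move=> j x y jk Sx Ny; have [Kx|Kx] := pselect (K x).
    rewrite deltaE (iter_dderive_vanish hF _ oOO) ?cseminorm0 ?mule0 ?weighted_norm_ge0//.
      by move=> z [Oz /u0]; exact.
    by split; [exact: KQ|exact: KO].
  rewrite deltaE -(iter_dderive_eq (nseq j y) oOK wu) ?inE; last by split=> //; exact: SO.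
  by rewrite -deltaE; apply: weighted_norm_ge.
split.
  split=> [|f k q Wf kl].
    apply: Ck_bigcup => x Ox; have [Kx|Kx] := pselect (K x).
      exists (O `&` Omega); last by split=> //; exact: KQ.
      by apply: Ck_eq oOO _ (Ck0 hF _ _) => z /[!inE] -[Oz /u0 ->].
    by exists (Omega `\` K) => //; exact: Ck_eq oOK wu Cw.
  by apply: le_lt_trans (le _ q f k (@subset_refl _ _)) _; exact: Ww.
move=> f k q e Wf kl e0; have [K' [cK' K'O hK']] := Bw f k q e Wf kl e0.
exists K'; split=> // [x /K'O []//|].
apply: le_lt_trans (le _ q f k _) _; first by move=> x [].
apply: le_lt_trans hK'; apply: weighted_norm_sub.
by move=> x [[Ox K'x] Kx].
Qed.

End extension.

Lemma Cc_map_mul {R : realType} {d : nat} {F : tvsType R} {G : lieGroupType F}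
    (Omega : set 'rV[R]_d) (b g : 'rV[R]_d -> G) : open Omega ->
  Cc_map Omega b -> Cc_map Omega g -> Cc_map Omega (fun x => (b x * g x)%g).
Proof.
move=> oO [Cb cb] [Cg cg]; split; first exact: Ck_map_mul.
apply: compact_closure_inter (compactU cb cg) _ _; first by move=> x [] [].
move=> x [Ox bg]; have [b1|b1] := pselect (b x = 1%g).
  right; split=> //; apply: subset_closure; split=> // g1.
  by apply: bg; rewrite b1 g1 mulg1.
by left; split=> //; apply: subset_closure.
Qed.

(** * Density in the modelling space *)

Section density.
Context {R : realType} {d : nat} {F : tvsType R}.
Local Notation E := 'rV[R]_d.
Context (hF : hausdorff_space F) (N : vnorm E) (l : diff_order).
Context (W : set (E -> R^o)) (Omega : set E) (oO : open Omega).
Hypothesis hW : weight_conditions N l Omega W.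
Local Notation CW := (CW_bullet hF N l W oO).

Lemma CW_bullet_of u : in_CW_bullet N l W Omega u -> (forall x, ~ Omega x -> u x = 0) ->
  exists eta : CW, eta = u :> (E -> F).
Proof.
move=> h1 h2; have hu : u \in CW_bullet_pred N l W hF oO by apply/asboolP.
by exists (CWBullet hu).
Qed.

Lemma CW_bullet_of_compact u K : compact K -> K `<=` Omega -> Ck l Omega u ->
  (forall x, ~ K x -> u x = 0) -> exists eta : CW, eta = u :> (E -> F).
Proof.
move=> cK KO Cu u0; apply: CW_bullet_of; last by move=> x Ox; apply: u0 => /KO.
by apply: in_CW_bullet_compact cK KO (weight_smooth hW) Cu _ => // x _; exact: u0.
Qed.

Lemma CW_bullet_density (eta : CW) (A : set CW) : nbhs eta A ->
  exists v : CW, [/\ A v, Ck None setT v &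
    exists K, [/\ compact K, K `<=` Omega & forall x, ~ K x -> v x = 0]].
Proof.
move=> [s [e [e0 sA]]].
pose idx (j : 'I_(size s)) := tnth (in_tuple s) j.
pose k := (\max_j CW_index_k (idx j))%N.
have kl : le_order k l by apply: le_order_bigmax => j; exact: CW_index_l.
have kk j : (CW_index_k (idx j) <= k)%N by exact: (leq_bigmax j).
(* A basic neighbourhood is given by a sum over [s]; the successor makes the total strictly less
   than [e] and allows [s] to be empty. *)
pose e1 := e / (size s).+1%:R; have e10 : 0 < e1 by rewrite divr_gt0.
have eta0 x : ~ Omega x -> eta x = 0 by have /asboolP[_] := CW_bullet_funP eta; exact.
have [v [K [cK KO Cv v0 hv]]] := smooth_cut_approx hF oO hW (CW_bulletP eta) kl
  (fun j => CW_index_q (idx j)) (fun j => CW_index_W (idx j)) eta0 e10.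
have Cvl : Ck l Omega v by apply: Ck_subset (Ck_leq _ Cv).
have [w wv] := CW_bullet_of_compact cK KO Cvl v0.
have wE : CW_bullet_fun ((-1 : R) *: w + eta) = (-1 : R) *: v + (eta : E -> F).
  by rewrite -wv.
exists w; split; last by exists K; rewrite wv.
  apply: sA => /=; apply: (@le_lt_trans _ _ (\sum_(i <- s) e1)).
    rewrite big_tnth [leRHS]big_tnth; apply: ler_sum => j _.
    rewrite (seminorm_sub _ _ (CW_seminorm_is_seminorm hF N oO (idx j))) -lee_fin CW_seminormE wE.
    apply: weighted_norm_le; first by rewrite lee_fin ltW.
    move=> n x y nk Ox Ny; rewrite deltaE -EFinM lee_fin ger0_norm; last first.
      exact: (weight_ge0 hW) (CW_index_W _) Ox.
    by apply: hv => //; exact: leq_trans (kk j).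
  rewrite big_const_seq count_predT iter_addr_0 /e1 -[ltLHS]mulr_natr -mulrA gtr_pMr//.
  by rewrite mulrC ltr_pdivrMr// mul1r ltr_nat.
by rewrite wv.
Qed.

End density.

(** * From the modelling space to the group *)

Section mapping_group.
Context {R : realType} {d : nat} {F : tvsType R} {G : lieGroupType F}.
Local Notation E := 'rV[R]_d.
Context (hF : hausdorff_space F) (N : vnorm E) (l : diff_order).
Context (W : set (E -> R^o)) (Omega : set E) (oO : open Omega).
Hypothesis hW : weight_conditions N l Omega W.
Local Notation CW := (CW_bullet hF N l W oO).
Context (H : lieGroupType CW) (iota : H -> E -> G).
Hypothesis hI : is_CW_group iota.
Implicit Types (a b : H) (x : E).

Let iotaM a b x : iota (a * b)%g x = (iota a x * iota b x)%g.
Proof. exact: (CW_group_mul hI). Qed.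

Let iota1 x : iota 1%g x = 1%g.
Proof. by apply: (mulgI (iota 1%g x)); rewrite -iotaM !mulg1. Qed.

Let iotaV a x : iota (a^-1)%g x = ((iota a x)^-1)%g.
Proof. by apply: (mulgI (iota a x)); rewrite -iotaM !mulgV iota1. Qed.

Let iota_range a : in_CW_ex N l W Omega (iota a) /\ forall x, ~ Omega x -> iota a x = 1%g.
Proof.
have h : range iota (iota a) by exists a.
by rewrite (CW_group_range hI) in h.
Qed.

Let Dc := [set a | Cc_map Omega (iota a)].

Lemma Cc_map_range (g : E -> G) : Cc_map Omega g -> (forall x, ~ Omega x -> g x = 1%g) ->
  range iota g.
Proof.
move=> [Cg cg] g1; rewrite (CW_group_range hI); split=> //; split; first exact: Ck_map_leq.
(* The neutral element of the mapping group is itself described by a chart of [G] that sends 1 to 0;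
   this supplies [c]. *)
have [[_ [c [_ [_ [[ac c1 c0] _]]]]] _] := iota_range 1%g.
pose K := closure [set x | Omega x /\ g x <> 1%g] `&` Omega.
have KO : K `<=` Omega by move=> x [].
have gK x : Omega x -> ~ K x -> g x = 1%g.
  by move=> Ox; apply: contra_notP => gx; split=> //; exact: subset_closure.
have [h [K2 [Q [[Ch h01 cK2 K2O h0] [oQ KQ hQ]]]]] := bump_exists cg oO KO.
exists c, K, h; split=> //; split; [split=> //|split].
- by move=> x [Ox /gK ->].
- split; first exact: Ck_subset Ch.
  apply: compact_closure_inter cK2 K2O _ => x [Ox].
  by apply: contra_notP => /h0.
- by exists Q; split=> // x [/hQ].
have oOK : open (Omega `\` K).
  apply: openI => //; apply: closed_openC; apply: compact_closed => //; exact: norm_hausdorff.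
(* Off the support [K] the function in question is 0, so the empty set serves as its compact
   support. *)
apply: (@in_CW_bullet_compact R d F hF N l W _ set0 _ oOK (@compact0 _) (@sub0set _ _)).
- by move=> f Wf; apply: Ck_subset (weight_smooth hW Wf) => x [].
- apply: Ck_eq oOK _ (Ck0 hF _ _) => x /[!inE] -[Ox Kx].
  by rewrite gK// c0 scaler0.
- by move=> x [Ox Kx] _; rewrite gK// c0 scaler0.
Qed.

Section in_chart.
Variables (c : chart F G) (V0 : set F) (C : chart CW H).
Hypotheses (ac : lie_atlas c) (c1 : chart_dom c 1%g) (c0 : c 1%g = 0).
Hypotheses (oV0 : open V0) (V00 : V0 0) (V0c : V0 `<=` chart_cod c).
Hypothesis Ccod : chart_cod C = [set eta | forall x, Omega x -> V0 (eta x)].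
Hypothesis Cdom : chart_dom C = [set a | exists2 eta, chart_cod C eta &
              forall x, Omega x -> iota a x = chart_inv c (eta x)].
Hypothesis CE : forall a x, chart_dom C a -> Omega x -> C a x = c (iota a x).

Let iota_chart_inv (eta : CW) x : chart_cod C eta -> Omega x ->
  iota (chart_inv C eta) x = chart_inv c (eta x).
Proof.
move=> Ceta Ox; have Da := chart_inv_dom Ceta; have := Da; rewrite Cdom => -[xi Cxi hxi].
have cxi : chart_cod c (xi x) by apply: V0c; move: Cxi; rewrite Ccod; exact.
rewrite hxi//; congr chart_inv.
by have := CE Da Ox; rewrite (chart_invK (c := C)) ?inE// hxi// (chart_invK (c := c)) ?inE.
Qed.

Lemma chart_dom_closure a : chart_dom C a -> closure Dc a.
Proof.
move=> Da A aA; have Ca := chart_map_cod Da.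
have cC : chart_inv C @ C a --> a.
  rewrite -[X in _ --> X](chart_mapK (c := C)) ?inE//.
  by apply: chart_inv_continuous; rewrite inE.
have nA : nbhs (C a) (chart_cod C `&` chart_inv C @^-1` A).
  apply: filterI; first by apply: open_nbhs_nbhs; split=> //; exact: chart_cod_open.
  exact: cC.
have [v [[Cv Av] Cvs [K [cK KO v0]]]] := CW_bullet_density hW nA.
exists (chart_inv C v); split=> //.
have vcod x : Omega x -> chart_cod c (v x).
  by move=> Ox; apply: V0c; move: Cv; rewrite Ccod; exact.
split.
  apply: (Ck_map_eq oO (b := chart_inv c \o v)).
    by move=> x /[!inE] Ox; rewrite iota_chart_inv.
  by apply: Ck_map_chart_inv => //; exact: Ck_subset Cvs.
apply: compact_closure_inter cK KO _ => x [Ox].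
apply: contra_notP => Kx; rewrite iota_chart_inv// v0// -c0.
by rewrite (chart_mapK (c := c)) ?inE.
Qed.

(** Compact support takes care of the weighted conditions, so only the values remain to be
    controlled. *)
Lemma chart_dom_compact a K : compact K -> K `<=` Omega ->
  (forall x, ~ K x -> iota a x = 1%g) ->
  (forall x, chart_dom c (iota a x) /\ V0 (c (iota a x))) -> chart_dom C a.
Proof.
move=> cK KO a1 aV.
have [[Cka _] _] := iota_range a.
have Ceta : Ck l Omega (c \o iota a).
  by apply: Ck_map_chart Cka => // x _; case: (aV x).
have [eta etaE] := CW_bullet_of_compact hF oO hW cK KO Ceta
  (fun x Kx => etrans (congr1 c (a1 x Kx)) c0).
rewrite Cdom; exists eta.
  by rewrite Ccod => x _; rewrite etaE; case: (aV x).
by move=> x _; rewrite etaE /= (chart_mapK (c := c)) ?inE//; case: (aV x).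
Qed.

(** [a2] is the inverse image under [C] of [(1 - chi) (1 - h) (c \o iota a)], which
    takes values in [V0] and agrees with [c \o iota a] off a compact set. *)
Lemma chart_factor a K (h : E -> R^o) O : compact K -> K `<=` Omega ->
  (forall x, (Omega `\` K) x -> chart_dom c (iota a x)) -> Cc_fun Omega h ->
  open O -> K `<=` O -> (forall x, (O `&` Omega) x -> h x = 1) ->
  in_CW_bullet N l W (Omega `\` K) (fun x => (1 - h x : R) *: c (iota a x)) ->
  exists2 a2, chart_dom C a2 & exists K', [/\ compact K', K' `<=` Omega &
    forall x, ~ K' x -> iota (a * a2^-1)%g x = 1%g].
Proof.
move=> cK KO Kc [Ch ch] oQ KQ hQ hB.
pose u x := if pselect ((Omega `\` K) x) then (1 - h x : R) *: c (iota a x) else 0.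
have uE x : Omega x -> ~ K x -> u x = (1 - h x : R) *: c (iota a x).
  by move=> Ox Kx; rewrite /u; case: pselect => // h'; exfalso; apply: h'.
have u0 x : ~ Omega x -> u x = 0.
  by move=> Ox; rewrite /u; case: pselect => // h'; exfalso; apply: Ox; exact: h'.1.
have Bu : in_CW_bullet N l W Omega u.
  apply: in_CW_bullet_extend cK KO oQ KQ uE _ hB => // x Qx Ox; rewrite /u.
  by case: pselect => // h'; rewrite hQ// subrr scale0r.
have [q hq] : exists q : cseminorm F, [set y | q y < 1] `<=` V0.
  by apply: cseminorm_sub_nbhs; exact: open_nbhs_nbhs.
(* For the weight 1 and the order 0, decay is a bound on values: off a compact set [K1] those of [u]
   lie in the unit ball of [q], hence in [V0]. *)
have [f1 Wf1 f1E] := weight_one hW.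
have l0 : le_order 0 l by case: (l).
have [_ /(_ f1 0%N q 1 Wf1 l0 ltr01) [K1 [cK1 K1O hK1]]] := Bu.
have qu x : Omega x -> ~ K1 x -> q (u x) < 1.
  move=> Ox Kx; rewrite -lte_fin; apply: le_lt_trans hK1.
  have N0 : N 0 <= 1 by rewrite (seminorm0 (vnorm_seminorm N)).
  have := @weighted_norm_ge R d F N (Omega `\` K1) q f1 0%N u 0%N x 0 (leqnn 0) (conj Ox Kx) N0.
  by rewrite f1E// normr1 mul1e deltaE.
have [chi [K2 [Q [[Cchi chi01 cK2 K2O chi0] [oQ' KQ' chi1]]]]] := bump_exists cK1 oO K1O.
have Cu : Ck l Omega u by case: Bu => -[].
have Bcu : in_CW_bullet N l W Omega (fun x => (chi x : R) *: u x).
  apply: in_CW_bullet_compact cK2 K2O (weight_smooth hW) _ _ => //.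
    have Cchil : Ck l Omega chi by apply: Ck_subset (Ck_leq _ Cchi).
    exact: (Ck_scale (@norm_hausdorff _ _) hF oO Cchil Cu).
  by move=> x Ox /chi0 ->; rewrite scale0r.
have [eta etaE] := CW_bullet_of hF oO (in_CW_bullet_lin hF (-1) oO Bcu Bu)
  (fun x Ox => etrans (congr1 (fun z => -1 *: (chi x *: z) + z) (u0 x Ox))
     (etrans (addr0 _) (etrans (congr1 _ (scaler0 _ _)) (scaler0 _ _)))).
have etaE' x : eta x = (1 - chi x : R) *: u x.
  by rewrite etaE !fctE scaleN1r scalerBl scale1r addrC.
have Ceta : chart_cod C eta.
  rewrite Ccod => x Ox; rewrite etaE'; apply: hq; rewrite /= cseminormZ.
  (* On [K1], where [u] may be large, [eta] is zero; elsewhere the factor [1 - chi x] only shrinks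
     it. *)
  have [K1x|K1x] := pselect (K1 x).
    by rewrite chi1 ?subrr ?normr0 ?mul0r//; exact: KQ'.
  apply: le_lt_trans (qu x Ox K1x); rewrite ler_piMl ?cseminorm_ge0//.
  by have /andP[h0 h1] := chi01 x; rewrite ger0_norm; lra.
exists (chart_inv C eta); first exact: chart_inv_dom.
pose Ks := closure [set x | Omega x /\ h x <> 0] `&` Omega.
exists (K `|` Ks `|` K2); split.
- by apply: compactU => //; exact: compactU.
- by move=> x [[/KO|[]]|/K2O].
move=> x Kx; have [Ox|Ox] := pselect (Omega x); last first.
  by rewrite iotaM iotaV !(proj2 (iota_range _))// mulgV.
have nK : ~ K x by move=> ?; apply: Kx; left; left.
have nK2 : ~ K2 x by move=> ?; apply: Kx; right.
have hx : h x = 0.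
  apply: contrapT => hx; apply: Kx; left; right; split=> //.
  exact: subset_closure.
rewrite iotaM iotaV iota_chart_inv// etaE' chi0// uE// hx !subr0 !scale1r.
by rewrite (chart_mapK (c := c)) ?mulgV// inE; apply: Kc; split.
Qed.

Lemma chart_decomposition a :
  (exists K, [/\ compact K, K `<=` Omega & forall x, ~ K x -> iota a x = 1%g]) ->
  exists b, Dc b /\ chart_dom C (b^-1 * a)%g.
Proof.
move=> [K [cK KO a1]].
pose U := chart_dom c `&` c @^-1` V0.
have U1 : nbhs (1%g : G) U.
  apply: open_nbhs_nbhs; split; last by split=> //=; rewrite c0.
  apply: open_preimage_in => //; first exact: chart_dom_open.
  exact: chart_map_continuous.
have [[[ca _] _] _] := iota_range a.
have [g [Cg g1 [K' [cK' K'O gK]] gU]] := Cc_map_approx oO ca cK KO a1 U1.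
have [b _ bg] := Cc_map_range Cg g1.
exists b; split; first by rewrite /Dc /= bg.
apply: (@chart_dom_compact _ (K `|` K')); first exact: compactU.
- by move=> x [/KO|/K'O].
- move=> x Kx; rewrite iotaM iotaV bg a1; last by move=> ?; apply: Kx; left.
  by rewrite gK ?mulg1 ?invg1// => ?; apply: Kx; right.
- by move=> x; rewrite iotaM iotaV bg; have [] := gU x.
Qed.

End in_chart.

Let closure_mul a b : closure Dc a -> closure Dc b -> closure Dc (a * b)%g.
Proof.
move=> ha hb A Aab; have := lie_mulg_continuous (a, b) A Aab.
move=> [[A1 A2] [/= nA1 nA2] h].
have [a' [Da Aa]] := ha A1 nA1; have [b' [Db Ab]] := hb A2 nA2.
exists (a' * b')%g; split; last exact: (h (a', b')).
rewrite /Dc /= (_ : iota _ = fun x => (iota a' x * iota b' x)%g); last first.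
  by apply/funext => x; rewrite iotaM.
exact: Cc_map_mul.
Qed.

Theorem CW_group_dense : Cc_dense Omega iota.
Proof.
split=> [g [Cg g1]|]; first exact: Cc_map_range.
suff h a : closure Dc a.
  move=> B [a Ba] oB; have [b [Db Bb]] := h a B (open_nbhs_nbhs (conj oB Ba)).
  by exists b.
have [[_ [c [K [h [[ac c1 c0] [[cK KO Kc] [Ch [Q [oQ KQ hQ]] hB]]]]]]] _] := iota_range a.
have [V0 [oV0 V00 V0c [C aC [Ccod Cdom CE]]]] := CW_group_chart hI ac c1 c0.
have [a2 Da2 hK] := chart_factor oV0 V00 V0c Ccod Cdom CE cK KO Kc Ch oQ KQ hQ hB.
have [b [Db Dp]] := chart_decomposition ac c1 c0 oV0 V00 Ccod Cdom hK.
have -> : a = (b * (b^-1 * (a * a2^-1)) * a2)%g by rewrite mulVKg mulgVK.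
have hcl := chart_dom_closure ac c1 c0 V0c Ccod Cdom CE.
apply: closure_mul (hcl _ Da2); apply: closure_mul (hcl _ Dp).
exact: subset_closure.
Qed.

End mapping_group.

(** * Schwartz weights *)

Section polynomial_growth.
Context {R : realType} {d : nat}.
Local Notation E := 'rV[R]_d.
Variable N : vnorm E.
Implicit Types (f g : E -> R^o) (w : E -> R) (x y : E) (i : 'I_d).

Let hE : hausdorff_space E := @norm_hausdorff _ _.
Let hR : hausdorff_space R^o := Ro_hausdorff.

(** A single majorant [w] for all orders is wasteful, since differentiation lowers the degree of a
    polynomial, but it makes the bounds multiplicative; the weight condition only asks for some
    weight on the right. *)
Definition derivatives_le w f := Ck None setT f /\ forall k, exists2 C : R, 0 <= C &
  forall x y, N y <= 1 -> `|iter_dderive f (nseq k y) x : R| <= C * w x.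

Lemma derivatives_le_cst w (a : R) : (forall x, 1 <= w x) -> derivatives_le w (fun=> a).
Proof.
move=> w1; split=> [|k]; first by apply: (Ck_cst _ hR); exact: openT.
have w0 x : 0 <= w x by exact: le_trans (w1 x).
exists `|a| => // x y _; case: k => [|k] /=; first by rewrite ler_peMr.
rewrite (_ : dderive y _ = 0) ?iter_dderive0 ?normr0 ?mulr_ge0//.
by apply/funext => z; apply: (dderive_eq hR); exact: is_dderive_cst.
Qed.

Lemma derivatives_le_coord i : derivatives_le (fun x => 1 + `|x ord0 i|) (fun x => x ord0 i).
Proof.
split=> [|k]; first exact: coord_Ck.
have [C C0 hC] := vnorm_lower N.
have dE y : dderive y (fun x => x ord0 i : R^o) = fun=> y ord0 i.
  apply/funext => x; apply: (dderive_eq hR).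
  have e : {near (0 : R)^', cst (y ord0 i : R^o) =1 dquotient (fun x => x ord0 i : R^o) x y}.
    near=> h; have h0 : h != 0 by near: h; exact: nbhs_dnbhs_neq.
    by rewrite /dquotient !mxE [x _ _ + _]addrC addrK [RHS]mulrA mulVf// mul1r.
  exact: cvg_trans (near_eq_cvg e) (cvg_cst _).
case: k => [|[|k]].
- by exists 1 => // x y _ /=; rewrite mul1r lerDr.
- exists C; [exact: ltW|move=> x y Ny].
  rewrite /= dE; apply: (@le_trans _ _ (C * 1)).
    apply: le_trans (row_coord_le y i) _; apply: le_trans (hC y) _.
    by rewrite ler_wpM2l// ltW.
  by rewrite ler_wpM2l ?(ltW C0)// lerDl.
- exists 0 => // x y _ /=; rewrite dE (_ : dderive y _ = 0) ?iter_dderive0 ?normr0 ?mul0r//.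
  by apply/funext => z; apply: (dderive_eq hR); exact: is_dderive_cst.
Unshelve. all: by end_near. Qed.

Lemma derivatives_leM w w' f g : (forall x, 0 <= w x) -> (forall x, 0 <= w' x) ->
  derivatives_le w f -> derivatives_le w' g ->
  derivatives_le (fun x => w x * w' x) (fun x => (f x : R) * g x).
Proof.
move=> w0 w'0 [Cf hf] [Cg hg]; split=> [|k].
  exact: (Ck_scale hE hR openT Cf Cg).
have [A hA] := choice (fun k => let: ex_intro2 C C0 hC := hf k in
  ex_intro (fun C => 0 <= C /\ forall x y, N y <= 1 -> `|iter_dderive f (nseq k y) x : R| <= C * w x)
    C (conj C0 hC)).
have [B hB] := choice (fun k => let: ex_intro2 C C0 hC := hg k in
  ex_intro (fun C => 0 <= C /\ forall x y, N y <= 1 -> `|iter_dderive g (nseq k y) x : R| <= C * w' x)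
    C (conj C0 hC)).
have A0 j : 0 <= A j by case: (hA j).
have B0 j : 0 <= B j by case: (hB j).
pose SA := \sum_(j < k.+1) A j; pose SB := \sum_(j < k.+1) B j.
have ASA j : (j <= k)%N -> A j <= SA.
  move=> jk; rewrite /SA (bigD1 (Ordinal (jk : j < k.+1)%N))//= lerDl.
  by rewrite sumr_ge0.
have BSB j : (j <= k)%N -> B j <= SB.
  move=> jk; rewrite /SB (bigD1 (Ordinal (jk : j < k.+1)%N))//= lerDl.
  by rewrite sumr_ge0.
have SA0 : 0 <= SA by exact: sumr_ge0.
have SB0 : 0 <= SB by exact: sumr_ge0.
exists (2 ^+ k * (SA * SB)); first by rewrite mulr_ge0 ?exprn_ge0// mulr_ge0.
move=> x y Ny; rewrite -mulrA.
apply: (leibniz_bound hR hE (q := abs_seminorm) openT) => //.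
- by have /Ck_NoneP := Cf.
- by have /Ck_NoneP := Cg.
move=> j jk; rewrite mulrACA; apply: ler_pM => //; first exact: cseminorm_ge0.
  apply: le_trans (proj2 (hA j) x y Ny) _; by rewrite ler_wpM2r// ASA.
apply: le_trans (proj2 (hB _) x y Ny) _; by rewrite ler_wpM2r// BSB// leq_subr.
Qed.

Lemma derivatives_leD w f g : derivatives_le w f -> derivatives_le w g ->
  derivatives_le w (fun x => (f x : R) + g x).
Proof.
move=> [Cf hf] [Cg hg].
have e : (fun x => (f x : R) + g x) = (1 : R) *: f + g :> (E -> R^o).
  by apply/funext => x; rewrite !fctE scale1r.
rewrite e; split=> [|k]; first exact: (Ck_lin hR 1 openT Cf Cg).
have [A A0 hA] := hf k; have [B B0 hB] := hg k.
exists (A + B); [exact: addr_ge0|move=> x y Ny].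
rewrite (iter_dderive_lin hR 1 openT (Ck_below (j := size (nseq k y)) Cf isT) (Ck_below Cg isT)) ?inE//.
rewrite !fctE scale1r mulrDl; apply: le_trans (ler_normD _ _) _.
by apply: lerD; [exact: hA|exact: hB].
Qed.

Lemma derivatives_le_sum w (I : Type) (s : seq I) (f : I -> E -> R^o) : (forall x, 1 <= w x) ->
  (forall j, derivatives_le w (f j)) -> derivatives_le w (fun x => \sum_(j <- s) (f j x : R)).
Proof.
move=> w1 hf; elim: s => [|j s IH].
  by under eq_fun do rewrite big_nil; exact: derivatives_le_cst.
by under eq_fun do rewrite big_cons; exact: derivatives_leD.
Qed.

Definition schwartz_base x : R := 1 + \sum_(i < d) (x ord0 i) ^+ 2.

Lemma schwartz_base_ge1 x : 1 <= schwartz_base x.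
Proof. by rewrite lerDl sumr_ge0// => i _; exact: sqr_ge0. Qed.

Lemma derivatives_le_schwartz n :
  derivatives_le (fun x => schwartz_base x ^+ n) (fun x => schwartz_base x ^+ n).
Proof.
have h1 := schwartz_base_ge1; have h0 x : 0 <= schwartz_base x by exact: le_trans (h1 x).
have hb : derivatives_le schwartz_base schwartz_base.
  apply: derivatives_leD; first exact: derivatives_le_cst.
  apply: derivatives_le_sum => // i.
  have hi := derivatives_le_coord i.
  have p0 x : 0 <= 1 + `|x ord0 i| by rewrite addr_ge0.
  have [Cf hf] : derivatives_le (fun x => (1 + `|x ord0 i|) * (1 + `|x ord0 i|))
      (fun x => (x ord0 i : R) ^+ 2) := derivatives_leM p0 p0 hi hi.
  split=> // k; have [C C0 hC] := hf k.
  (* The factor 2 comes from [(1 + |a|)^2 <= 2 * (1 + a^2)]. *)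
  exists (C * 2); [exact: mulr_ge0|move=> x y Ny].
  apply: le_trans (hC x y Ny) _; rewrite -mulrA ler_wpM2l//.
  have xi : (x ord0 i) ^+ 2 <= \sum_(j < d) (x ord0 j) ^+ 2.
    by rewrite (bigD1 i)//= lerDl sumr_ge0// => j _; exact: sqr_ge0.
  have := real_normK (num_real (x ord0 i)); move: xi; rewrite /schwartz_base.
  set a := x ord0 i; set S := \sum_(j < d) _ => xi na.
  have sq : 0 <= (1 - `|a|) ^+ 2 by exact: sqr_ge0.
  nra.
elim: n => [|n IH].
  by under eq_fun do rewrite expr0; exact: derivatives_le_cst.
by under eq_fun do rewrite exprS; apply: derivatives_leM => // x; exact: exprn_ge0.
Qed.

Lemma schwartz_weight_conditions : weight_conditions N None setT (@schwartz_weights R d).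
Proof.
split.
- by move=> f [n ->]; have [] := derivatives_le_schwartz n.
- by exists (fun=> 1) => //; exists 0%N; apply/funext => x; rewrite expr0.
- move=> f x [n ->] _; rewrite exprn_ge0//; exact: le_trans (schwartz_base_ge1 x).
- by move=> x _; exists (fun=> 1) => //; exists 0%N; apply/funext => z; rewrite expr0.
move=> n f k _ Wf _.
have [m hm] := choice Wf.
have h j : exists C : R, 0 <= C /\ forall x, (delta_norm N abs_seminorm (k j) (f j) x <=
    (C * schwartz_base x ^+ m j)%:E)%E.
  have [_ /(_ (k j)) [C C0 hC]] := derivatives_le_schwartz (m j).
  exists C; split=> // x; apply: ge_ereal_sup => _ [y Ny <-].
  by rewrite lee_fin deltaE hm; exact: hC.
have [C hC] := choice h.
have C0 j : 0 <= C j by case: (hC j).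
have PC : 0 <= \prod_j C j by exact: prodr_ge0.
(* The exponents add up, and the summand 1 makes the constant positive. *)
exists (\prod_j C j + 1), (fun x => schwartz_base x ^+ (\sum_j m j)); split.
- by rewrite ltr_wpDl.
- by exists (\sum_j m j)%N.
move=> x _; have s0 : 0 <= schwartz_base x by exact: le_trans (schwartz_base_ge1 x).
apply: (@le_trans _ _ (\prod_j (C j * schwartz_base x ^+ m j))%:E); last first.
  rewrite lee_fin big_split /= -expr_sum ler_wpM2r ?exprn_ge0//.
  by rewrite lerDl.
(* Nonnegativity is carried along because the product of two inequalities between extended reals
   requires it. *)
have hp (s : seq 'I_n) : (0 <= \big[*%E/1%E]_(j <- s) delta_norm N abs_seminorm (k j) (f j) x <=
    (\prod_(j <- s) (C j * schwartz_base x ^+ m j))%:E)%E.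
  elim: s => [|j s /andP[IH1 IH2]]; first by rewrite !big_nil lexx lee_fin ler01.
  have dn0 : (0 <= delta_norm N abs_seminorm (k j) (f j) x)%E.
    apply: (@le_trans _ _ (abs_seminorm (delta (k j) (f j) x 0))%:E).
      by rewrite lee_fin cseminorm_ge0.
    by apply: ereal_sup_ubound; exists 0 => //=; rewrite (seminorm0 (vnorm_seminorm N)).
  rewrite !big_cons mule_ge0//= EFinM; apply: lee_pmul => //.
  exact: (proj2 (hC j)).
by case/andP: (hp (index_enum 'I_n)).
Qed.

End polynomial_growth.


Theorem proposition10p16 (R : realType) (d : nat) (hd : (0 < d)%N)
    (N : vnorm 'rV[R]_d) (F : tvsType R) (hF : hausdorff_space F)
    (G : lieGroupType F) :
  [/\ (forall (l : diff_order) (Omega : set 'rV[R]_d) (oOmega : open Omega)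
          (W : set ('rV[R]_d -> R^o)),
        weight_conditions N l Omega W ->
        forall (H : lieGroupType (CW_bullet hF N l W oOmega))
            (iota : H -> 'rV[R]_d -> G),
          is_CW_group iota -> Cc_dense Omega iota),
      (forall W : set ('rV[R]_d -> R^o),
        weight_conditions N None setT W -> BCR_weights N W ->
        forall (H : lieGroupType (CW_bullet hF N None W openT))
            (iota : H -> 'rV[R]_d -> G),
          is_CW_group iota -> Cc_dense setT iota) &
      (forall (H : lieGroupType (CW_bullet hF N None schwartz_weights openT))
            (iota : H -> 'rV[R]_d -> G),
          is_CW_group iota -> Cc_dense setT iota)].
Proof.
split=> [l Omega oOmega W hW H iota|W hW _ H iota|H iota].
- exact: CW_group_dense.
- exact: CW_group_dense.
- exact: CW_group_dense (schwartz_weight_conditions N) _ _.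
Qed.
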